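(* For $i=1,2$ let $(X_i,d_i,\mu_i)$ be a space of homogeneous type in the sense of Coifman and Weiss with $\mu_i(X_i)=\infty$, with upper dimension $\omega_i$, and let $\eta_i$ be the Hölder regularity exponent of the Auscher–Hytönen wavelets on $X_i$. For all $p$ with $p>\max\{\omega_i/(\omega_i+\eta_i): i=1,2\}$, the product Hardy space $H^p(X_1\times X_2)$ is independent of the particular choices of the Auscher–Hytönen wavelets and of the reference dyadic grids used in its construction: any two such choices (on $X_1$ and on $X_2$) yield the same space $H^p(X_1\times X_2)$.
   Context: **Spaces.** A quasi-metric on a set $X$ is a function $d:X\times X\to[0,\infty)$ with $d(x,y)=d(y,x)$, $d(x,y)=0$ iff $x=y$, and $d(x,y)\le A_0[d(x,z)+d(z,y)]$ for all $x,y,z$, for some constant $A_0\ge 1$. Put $B(x,r)=\{y: d(x,y)<r\}$. A set $U$ is open if for every $x\in U$ there is $r>0$ with $B(x,r)\subset U$. A space of homogeneous type $(X,d,\mu)$ (Coifman–Weiss) is a set with a quasi-metric $d$ and a nonzero measure $\mu$, defined on a $\sigma$-algebra containing all balls and Borel sets, Borel regular (each measurable $A$ contains a Borel set $B$ with $\mu(B)=\mu(A)$) and doubling: $0<\mu(B(x,2r))\le C_\mu\,\mu(B(x,r))<\infty$ for all $x$, $r>0$. Standing assumption: $\mu(X)=\infty$. The upper dimension is $\omega=\log_2 C_\mu$, so $\mu(B(x,\lambda r))\le C_\mu\lambda^\omega\mu(B(x,r))$ for $\lambda\ge1$. The geometric constants of $X$ are $A_0,C_\mu,\omega$. Objects on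 $X_i$ carry an index $i$ (e.g. $A_0^{(i)}$). Write $\widetilde X=X_1\times X_2$, $\mu=\mu_1\times\mu_2$. **Reference grids and wavelets.** Fix a small $\delta\le10^{-3}A_0^{-10}$ and points $\mathscr X^k=\{x^k_\alpha\}_{\alpha\in\mathscr A_k}$ ($k\in\mathbb Z$, $\mathscr A_k$ countable) with $\mathscr X^k\subset\mathscr X^{k+1}$, obtained as follows: $\mathscr X^0$ is a maximal $1$-separated set, and inductively for $k\ge 1$, $\mathscr X^k\supset\mathscr X^{k-1}$ and $\mathscr X^{-k}\subset\mathscr X^{-(k-1)}$ are maximal $\delta^k$- and $\delta^{-k}$-separated sets. A reference dyadic grid $\mathscr D^W=\{Q^k_\alpha\}$ is a family of sets (cubes) with centers $x^k_\alpha$ such that: if $\ell\ge k$ then $Q^\ell_\beta\subset Q^k_\alpha$ or $Q^\ell_\beta\cap Q^k_\alpha=\emptyset$; for each $k$, $X$ is the disjoint union of the $Q^k_\alpha$, $\alpha\in\mathscr A_k$; $B(x^k_\alpha,c_1\delta^k)\subset Q^k_\alpha\subset B(x^k_\alpha,C_1\delta^k)$ with $c_1=A_0^{-5}/6$, $C_1=6A_0^4$; and if $\ell\ge k$, $Q^\ell_\beta\subset Q^k_\alpha$, then $B(x^\ell_\beta,C_1\delta^\ell)\subset B(x^k_\alpha,C_1\delta^k)$. Put $\mathscr Y^k=\mathscr X^{k+1}\setminus\mathscr X^k$, whose points are relabelled $y^k_\alpha$ ($\alpha\in\mathscr A_{k+1}\setminus\mathscr A_k$, also written $\alpha\in\mathscr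 Y^k$). The Auscher–Hytönen wavelets built on $\mathscr D^W$ form an orthonormal basis $\{\psi^k_\alpha\}_{k\in\mathbb Z,\alpha\in\mathscr Y^k}$ of $L^2(X)$ such that, with $a=(1+2\log_2A_0)^{-1}$ and constants $C,\nu>0$, $\eta\in(0,1)$ depending only on the geometric constants: $|\psi^k_\alpha(x)|\le C\mu(B(y^k_\alpha,\delta^k))^{-1/2}\exp(-\nu(d(y^k_\alpha,x)/\delta^k)^a)$; $|\psi^k_\alpha(x)-\psi^k_\alpha(y)|\le C\mu(B(y^k_\alpha,\delta^k))^{-1/2}(d(x,y)/\delta^k)^\eta\exp(-\nu(d(y^k_\alpha,x)/\delta^k)^a)$ if $d(x,y)\le\delta^k$; $\int_X\psi^k_\alpha\,d\mu=0$. The same construction provides, for all $x_0\in X$, $R_0>0$, cut-off functions $h$ with $0\le h\le1$, $h=1$ on $B(x_0,R_0/4)$, $h=0$ off $B(x_0,A_0^2R_0)$, $|h(x)-h(y)|\le C(d(x,y)/R_0)^\eta$. For $\alpha\in\mathscr Y^k$, $Q^k_\alpha$ denotes the cube of $\mathscr D^W$ centered at $y^k_\alpha$ associated with $\psi^k_\alpha$. On $X_i$ the wavelets are $\{\psi^{k_i}_{\alpha_i}\}$ with reference grid $\mathscr D^W_i$ and exponent $\eta_i$. **Test functions and distributions.** Let $V_r(x)=\mu(B(x,r))$, $V(x,y)=\mu(B(x,d(x,y)))$. For $x_0\in X$, $r>0$, $\beta\in(0,\eta]$, $\gamma>0$, $G(x_0,r,\beta,\gamma)$ is the set of measurable $f$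 with $\int_X f\,d\mu=0$ such that for some $C$: $|f(x)|\le C\frac1{V_r(x_0)+V(x,x_0)}\big(\frac r{r+d(x,x_0)}\big)^\gamma$ for all $x$, and $|f(x)-f(y)|\le C\big(\frac{d(x,y)}{r+d(x,x_0)}\big)^\beta\frac1{V_r(x_0)+V(x,x_0)}\big(\frac r{r+d(x,x_0)}\big)^\gamma$ if $d(x,y)<(2A_0)^{-1}(r+d(x,x_0))$; the norm is the infimum of such $C$. The product space $G(x_0,y_0;r_1,r_2;\beta_1,\beta_2;\gamma_1,\gamma_2)$ consists of $f$ on $X_1\times X_2$ with $f(\cdot,y)\in G(x_0,r_1,\beta_1,\gamma_1)$, $f(x,\cdot)\in G(y_0,r_2,\beta_2,\gamma_2)$ for all $x,y$ and, for some $C$, $\|f(\cdot,y)\|_{G(x_0,r_1,\beta_1,\gamma_1)}\le C\frac1{V_{r_2}(y_0)+V(y_0,y)}\big(\frac{r_2}{r_2+d_2(y,y_0)}\big)^{\gamma_2}$ and $\|f(\cdot,y)-f(\cdot,y')\|_{G(x_0,r_1,\beta_1,\gamma_1)}\le C\big(\frac{d_2(y,y')}{r_2+d_2(y,y_0)}\big)^{\beta_2}\frac1{V_{r_2}(y_0)+V(y_0,y)}\big(\frac{r_2}{r_2+d_2(y,y_0)}\big)^{\gamma_2}$ when $d_2(y,y')\le(r_2+d_2(y,y_0))/(2A_0^{(2)})$, and the same with the roles of $x,y$ interchanged; norm = infimum of such $C$. Fix a base point and $r_1=r_2=1$, giving $G(\beta_1,\beta_2;\gamma_1,\gamma_2)$.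 Fix $\beta_i',\gamma_i'\in(0,\eta_i)$; $\mathring G$ is the completion of $G(\eta_1,\eta_2;\gamma_1',\gamma_2')$ in the norm of $G(\beta_1',\beta_2';\gamma_1',\gamma_2')$, and $(\mathring G)'$ is the space of bounded linear functionals on it. Product wavelets lie in $\mathring G$. **Hardy space.** For a given choice of wavelets and reference grids on $X_1,X_2$ and $f\in(\mathring G)'$, $$S(f)(x_1,x_2)=\Big\{\sum_{k_1,k_2\in\mathbb Z}\sum_{\alpha_1\in\mathscr Y^{k_1},\alpha_2\in\mathscr Y^{k_2}}|\langle f,\psi^{k_1}_{\alpha_1}\psi^{k_2}_{\alpha_2}\rangle|^2\frac{\chi_{Q^{k_1}_{\alpha_1}}(x_1)\chi_{Q^{k_2}_{\alpha_2}}(x_2)}{\mu_1(Q^{k_1}_{\alpha_1})\mu_2(Q^{k_2}_{\alpha_2})}\Big\}^{1/2},$$ and $H^p(X_1\times X_2)=\{f\in(\mathring G)': S(f)\in L^p(\widetilde X)\}$ with $\|f\|_{H^p}=\|S(f)\|_{L^p}$. *)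

(* Defs.v *)
From HB Require Import structures.
From mathcomp Require Import all_boot all_order all_algebra.
From mathcomp Require Import all_classical all_reals all_analysis.
From mathcomp Require Import measurable_realfun.

Set Implicit Arguments.
Unset Strict Implicit.
Unset Printing Implicit Defensive.

Import Order.TTheory GRing.Theory Num.Theory.
Import numFieldNormedType.Exports.

Local Open Scope classical_set_scope.
Local Open Scope ring_scope.

(** * Spaces of homogeneous type *)

Definition qball (R : realType) (X : Type) (d : X -> X -> R) (x : X) (r : R) :
  set X := [set y | d x y < r].

Definition qopen (R : realType) (X : Type) (d : X -> X -> R) : set (set X) :=
  [set U | forall x, U x -> exists2 r, 0 < r & qball d x r `<=` U].

(* The constants [A0] and [Cmu] are part of the data.  Balls need not be open,
   so their measurability is a separate axiom. *)
Record sht (R : realType) (disp : measure_display) (X : measurableType disp) :=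
  Sht {
    dist : X -> X -> R ;
    A0 : R ;
    sht_measure : {measure set X -> \bar R} ;
    Cmu : R ;
    dist_ge0 : forall x y, 0 <= dist x y ;
    dist_sym : forall x y, dist x y = dist y x ;
    dist_eq0 : forall x y, dist x y = 0 <-> x = y ;
    A0_ge1 : 1 <= A0 ;
    dist_quasi : forall x y z, dist x y <= A0 * (dist x z + dist z y) ;
    sht_nonzero : exists A, measurable A /\ sht_measure A <> 0%E ;
    sht_ball_measurable : forall x r, measurable (qball dist x r) ;
    sht_borel_measurable : forall A, <<s qopen dist >> A -> measurable A ;
    sht_borel_regular : forall A, measurable A ->
      exists B, [/\ <<s qopen dist >> B, B `<=` A
                  & sht_measure B = sht_measure A] ;
    sht_doubling : forall x r, 0 < r ->
      [/\ (0 < sht_measure (qball dist x (2 * r)))%E,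
          (sht_measure (qball dist x (2 * r)) <=
             Cmu%:E * sht_measure (qball dist x r))%E
        & (sht_measure (qball dist x r) < +oo)%E] }.

Definition mu (R : realType) (disp : measure_display) (X : measurableType disp)
  (S : sht R X) : set X -> \bar R := sht_measure S.

HB.instance Definition _ (R : realType) (disp : measure_display)
  (X : measurableType disp) (S : sht R X) := Measure.on (mu S).

Lemma mu_sigma_finite (R : realType) (disp : measure_display)
  (X : measurableType disp) (S : sht R X) : sigma_finite setT (mu S).
Proof.
have [A [_ muA]] := sht_nonzero S.
have [x _] : A !=set0.
  by apply/set0P/eqP => A_eq0; apply: muA; rewrite A_eq0 measure0.
exists (fun n => qball (dist S) x n.+1%:R).
  apply/seteqP; split => // y _; exists (Num.bound (dist S x y)) => //=.
  apply: (lt_trans (archi_boundP (dist_ge0 S x y))).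
  by rewrite ltr_nat.
move=> n; split; first exact: sht_ball_measurable.
by have [] := @sht_doubling _ _ _ S x n.+1%:R (ltr0Sn _ _).
Qed.

HB.instance Definition _ (R : realType) (disp : measure_display)
  (X : measurableType disp) (S : sht R X) :=
  Measure_isSigmaFinite.Build disp X R (mu S) (mu_sigma_finite S).

Section OneParameter.
Context (R : realType) (disp : measure_display) (X : measurableType disp).
Variable S : sht R X.

Local Notation d := (dist S).
Local Notation B := (qball (dist S)).

Definition upper_dim : R := ln (Cmu S) / ln 2.

(* [vol r x] is V_r(x) and [Vol x y] is V(x, y); in particular V(x, x) = 0. *)
Definition vol (r : R) (x : X) : R := fine (mu S (B x r)).
Definition Vol (x y : X) : R := vol (d x y) x.

(** * Reference dyadic grids *)

Definition separated (r : R) (P : set X) : Prop :=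
  forall x y, P x -> P y -> x <> y -> r <= d x y.

Definition maximal_separated (r : R) (E P : set X) : Prop :=
  [/\ P `<=` E, separated r P &
      forall P', P `<=` P' -> P' `<=` E -> separated r P' -> P' `<=` P].

Definition c1 : R := A0 S ^- 5 / 6.
Definition C1 : R := 6 * A0 S ^+ 4.

(* The index set A_k is identified with the set of points [pts k], so that
   [cube k x] is the cube Q^k_alpha with x = x^k_alpha; it is meaningful only
   for x in [pts k].  At negative levels, maximality is relative to the
   previous (finer) set of points. *)
Record reference_grid := ReferenceGrid {
  delta : R ;
  pts : int -> set X ;
  cube : int -> X -> set X ;
  delta_gt0 : 0 < delta ;
  delta_small : delta <= 10 ^- 3 * A0 S ^- 10 ;
  pts_countable : forall k, countable (pts k) ;
  pts_zero : maximal_separated 1 setT (pts 0) ;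
  pts_pos : forall n : nat, pts n%:Z `<=` pts n.+1%:Z /\
    maximal_separated (delta ^+ n.+1) setT (pts n.+1%:Z) ;
  pts_neg : forall n : nat,
    maximal_separated (delta ^- n.+1) (pts (- n%:Z)) (pts (- n.+1%:Z)) ;
  cube_measurable : forall k x, pts k x -> measurable (cube k x) ;
  cube_nested : forall k l x y, k <= l -> pts k x -> pts l y ->
    cube l y `<=` cube k x \/ cube l y `&` cube k x = set0 ;
  cube_cover : forall k, \bigcup_(x in pts k) cube k x = setT ;
  cube_disjoint : forall k, trivIset (pts k) (cube k) ;
  cube_ball : forall k x, pts k x ->
    B x (c1 * delta ^ k) `<=` cube k x /\ cube k x `<=` B x (C1 * delta ^ k) ;
  cube_ball_nested : forall k l x y, k <= l -> pts k x -> pts l y ->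
    cube l y `<=` cube k x ->
    B y (C1 * delta ^ l) `<=` B x (C1 * delta ^ k) }.

(* Indices (k, y^k_alpha) of the wavelets, with y^k_alpha in Y^k. *)
Definition wav_index (D : reference_grid) : set (int * X) :=
  [set i | (pts D (i.1 + 1) `\` pts D i.1) i.2].

(* y^k_alpha is a point of X^(k+1) that is not in X^k, so the cube of the grid
   of which it is the center is one of generation k + 1. *)
Definition wav_cube (D : reference_grid) (i : int * X) : set X :=
  cube D (i.1 + 1) i.2.

(** * Auscher-Hytonen wavelets *)

Definition exp_a : R := (1 + 2 * (ln (A0 S) / ln 2))^-1.

Definition l2 (f : X -> R) : Prop := f \in Lfun (mu S) 2%:E.

Definition orthonormal_basis (I : choiceType) (J : set I) (psi : I -> X -> R) :
    Prop :=
  [/\ forall i, J i -> l2 (psi i),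
      forall i j, J i -> J j ->
        (\int[mu S]_x (psi i x * psi j x)%:E = (i == j)%:R%:E)%E
    & forall f, l2 f -> forall e, 0 < e ->
        exists n (i : 'I_n -> I) (c : 'I_n -> R),
          (forall m, J (i m)) /\
          ('N[mu S]_2%:E
             [(fun x => (f x - \sum_(m < n) c m * psi (i m) x)%:E)] < e%:E)%E].

Definition wav_envelope (D : reference_grid) (nu : R) (i : int * X) (x : X) :=
  (Num.sqrt (vol (delta D ^ i.1) i.2))^-1 *
  expR (- nu * (d i.2 x / delta D ^ i.1) `^ exp_a).

(* Only the values of [psi] on [wav_index D] matter.  The cut-off functions do
   not involve the wavelets; they come with the Holder exponent [eta] of the
   construction. *)
Record ah_wavelets (eta : R) (D : reference_grid) := AHWavelets {
  psi : int * X -> X -> R ;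
  psi_basis : orthonormal_basis (wav_index D) psi ;
  psi_bounds : exists C nu : R, [/\ 0 < C, 0 < nu,
    forall i x, wav_index D i -> `|psi i x| <= C * wav_envelope D nu i x
  & forall i x y, wav_index D i -> d x y <= delta D ^ i.1 ->
      `|psi i x - psi i y| <=
        C * (d x y / delta D ^ i.1) `^ eta * wav_envelope D nu i x] ;
  psi_cancel : forall i, wav_index D i ->
    (\int[mu S]_x (psi i x)%:E = 0)%E ;
  cutoffs : exists2 C : R, 0 < C & forall x0 R0, 0 < R0 ->
    exists h : X -> R, [/\ forall x, 0 <= h x <= 1,
      forall x, B x0 (R0 / 4) x -> h x = 1,
      forall x, ~ B x0 (A0 S ^+ 2 * R0) x -> h x = 0
    & forall x y, `|h x - h y| <= C * (d x y / R0) `^ eta] }.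

(** * One-parameter test functions *)

Definition G_bound (x0 : X) (r beta gamma : R) (f : X -> R) (C : R) : Prop :=
  (forall x, `|f x| <=
     C * (vol r x0 + Vol x x0)^-1 * (r / (r + d x x0)) `^ gamma) /\
  (forall x y, d x y < (2 * A0 S)^-1 * (r + d x x0) ->
     `|f x - f y| <= C * (d x y / (r + d x x0)) `^ beta *
        (vol r x0 + Vol x x0)^-1 * (r / (r + d x x0)) `^ gamma).

Definition G (x0 : X) (r beta gamma : R) : set (X -> R) :=
  [set f | [/\ measurable_fun setT f, (\int[mu S]_x (f x)%:E = 0)%E
             & exists C, G_bound x0 r beta gamma f C]].

Definition G_norm (x0 : X) (r beta gamma : R) (f : X -> R) : R :=
  inf [set C | G_bound x0 r beta gamma f C].

End OneParameter.

(** * Product test functions and distributions *)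

Definition G2_half_bound (R : realType) (d1 d2 : measure_display)
    (X1 : measurableType d1) (X2 : measurableType d2)
    (S1 : sht R X1) (S2 : sht R X2) (x0 : X1) (y0 : X2)
    (r1 r2 b1 b2 g1 g2 : R) (f : X1 -> X2 -> R) (C : R) : Prop :=
  (forall y, G_norm S1 x0 r1 b1 g1 (fun x => f x y) <=
     C * (vol S2 r2 y0 + Vol S2 y0 y)^-1 *
       (r2 / (r2 + dist S2 y y0)) `^ g2) /\
  (forall y y', dist S2 y y' <= (r2 + dist S2 y y0) / (2 * A0 S2) ->
     G_norm S1 x0 r1 b1 g1 (fun x => f x y - f x y') <=
       C * (dist S2 y y' / (r2 + dist S2 y y0)) `^ b2 *
         (vol S2 r2 y0 + Vol S2 y0 y)^-1 *
         (r2 / (r2 + dist S2 y y0)) `^ g2).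

Section Product.
Context (R : realType) (d1 d2 : measure_display).
Context (X1 : measurableType d1) (X2 : measurableType d2).
Variables (S1 : sht R X1) (S2 : sht R X2) (x0 : X1) (y0 : X2).

Definition G2_bound (r1 r2 b1 b2 g1 g2 : R) (f : X1 -> X2 -> R) (C : R) :=
  G2_half_bound S1 S2 x0 y0 r1 r2 b1 b2 g1 g2 f C /\
  G2_half_bound S2 S1 y0 x0 r2 r1 b2 b1 g2 g1 (fun y x => f x y) C.

Definition G2 (r1 r2 b1 b2 g1 g2 : R) : set (X1 -> X2 -> R) :=
  [set f | [/\ forall y, G S1 x0 r1 b1 g1 (fun x => f x y),
               forall x, G S2 y0 r2 b2 g2 (f x)
             & exists C, G2_bound r1 r2 b1 b2 g1 g2 f C]].

Definition G2_norm (r1 r2 b1 b2 g1 g2 : R) (f : X1 -> X2 -> R) : R :=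
  inf [set C | G2_bound r1 r2 b1 b2 g1 g2 f C].

Variables (eta1 eta2 b1 b2 g1 g2 : R).

(* The completion is realized as the closure inside the (complete) space
   G(b1, b2; g1, g2), so that its elements are functions. *)
Definition G_ring : set (X1 -> X2 -> R) :=
  [set f | G2 1 1 b1 b2 g1 g2 f /\
     forall e, 0 < e -> exists2 g, G2 1 1 eta1 eta2 g1 g2 g &
       G2_norm 1 1 b1 b2 g1 g2 (fun x y => f x y - g x y) < e].

(* Functionals are total functions extended by 0 off [G_ring]; this makes two
   elements of the dual equal as soon as they agree on [G_ring]. *)
Definition distributions : set ((X1 -> X2 -> R) -> R) :=
  [set F | [/\ forall f, ~ G_ring f -> F f = 0,
      forall (a : R) f g, G_ring f -> G_ring g ->
        F (fun x y => a * f x y + g x y) = a * F f + F g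
    & exists C, forall f, G_ring f ->
        `|F f| <= C * G2_norm 1 1 b1 b2 g1 g2 f]].

(** * Product Hardy spaces *)

Definition square_function (D1 : reference_grid S1) (D2 : reference_grid S2)
    (W1 : ah_wavelets eta1 D1) (W2 : ah_wavelets eta2 D2)
    (F : (X1 -> X2 -> R) -> R) (x : X1 * X2) : \bar R :=
  (\esum_(i in wav_index D1 `*` wav_index D2)
     (`|F (fun x1 x2 => psi W1 i.1 x1 * psi W2 i.2 x2)| ^+ 2 *
       (\1_(wav_cube D1 i.1) x.1 * \1_(wav_cube D2 i.2) x.2 /
         (fine (mu S1 (wav_cube D1 i.1)) *
          fine (mu S2 (wav_cube D2 i.2)))))%:E) `^ 2^-1.

Definition Hp_norm (p : R) (D1 : reference_grid S1) (D2 : reference_grid S2)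
    (W1 : ah_wavelets eta1 D1) (W2 : ah_wavelets eta2 D2)
    (F : (X1 -> X2 -> R) -> R) : \bar R :=
  Lnorm (mu S1 \x mu S2)%E p%:E (square_function W1 W2 F).

Definition Hp (p : R) (D1 : reference_grid S1) (D2 : reference_grid S2)
    (W1 : ah_wavelets eta1 D1) (W2 : ah_wavelets eta2 D2) :
    set ((X1 -> X2 -> R) -> R) :=
  [set F | [/\ distributions F,
               measurable_fun setT (square_function W1 W2 F)
             & (Hp_norm p W1 W2 F < +oo)%E]].

End Product.

(* Main.v *)
Require Import Defs.
From mathcomp Require Import all_boot all_order all_algebra.
From mathcomp Require Import all_classical all_reals all_analysis.
From mathcomp Require Import measurable_realfun.
From mathcomp Require Import lra ring zify.

Set Implicit Arguments.
Unset Strict Implicit.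
Unset Printing Implicit Defensive.

Import Order.TTheory GRing.Theory Num.Theory.

Local Open Scope classical_set_scope.
Local Open Scope ring_scope.

(** Wavelets of two different families are almost orthogonal: cancellation and
    Hoelder regularity bound |<psi'_b, psi_a>| by
    (r_min / r_max)^eta (V_min / V_max)^(1/2) times an arbitrary power decay in
    d(y_a, y_b) / r_max.  A matrix with such bounds maps square functions to
    square functions in L^p for every p > omega / (omega + eta): for p = 2 this
    is Schur's test; for p <= 1 the indices are grouped into atoms, the cubes on
    which the partial square function stays at one dyadic level, and the image
    of an atom is controlled by the case p = 2 near its cube and by the decay
    far from it; 1 < p < 2 is an interpolation that splits each coefficient
    according to the partial square function, and p > 2 is duality.  On the
    product, Minkowski's inequality in l^2 and Tonelli's theorem allow one to
    apply the one-parameter bound in each variable in turn.  It applies to the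
    coefficients of a distribution because psi'_b is the limit, in the norm of
    the test functions, of finite partial sums of sum_a <psi'_b, psi_a> psi_a. *)

(* Every estimate is proved for finite families of indices, with constants independent of the
   family; infinite sums enter only when the square function is recovered as a supremum over finite
   families. The matrices carry absolute values of the pairings: up to an arbitrarily small error, a
   coefficient in one family is dominated by a finite sum of nonnegative terms, and a nonzero
   coefficient absorbs the error. For p <= 1 the critical exponent comes from the far field of an
   atom: at distance 2^m times the scale of its cube the image has size 2^(-m eta) over the volume
   of the ball, and volumes grow by at most Cmu = 2^omega per step. The p-th powers form a geometric
   series of ratio Cmu^(1-p) 2^(-eta p), which is below 1 when p > omega/(omega+eta). For
   distributions the obstacle is that wavelet expansions are given only in L^2, whereas continuity
   refers to a norm with weighted size and Hoelder conditions. The margins b < eta and g < eta allow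
   a weight tending to infinity along the indices to be inserted in the sums; this makes tails small
   in that norm, and completeness in L^2 identifies the limit. *)
Create HintDb pos.

Ltac pos :=
  first
  [ assumption
  | lazymatch goal with
    | |- is_true (0 < 1) => exact: ltr01
    | |- is_true (0 < _ * _) => apply: mulr_gt0; pos
    | |- is_true (0 < _ + _) => apply: addr_gt0; pos
    | |- is_true (0 < _^-1) => rewrite invr_gt0; pos
    | |- is_true (0 < _ ^+ _) => apply: exprn_gt0; pos
    | |- is_true (0 < _ ^ _) => apply: exprz_gt0; pos
    | |- is_true (0 < _ `^ _) => apply: powR_gt0; pos
    | |- is_true (0 < expR _) => exact: expR_gt0
    | |- is_true (0 < Num.sqrt _) => rewrite sqrtr_gt0; pos
    | |- is_true (0 < _%:R) => by rewrite ltr0n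
    | |- is_true (0 <= _ * _) => apply: mulr_ge0; pos
    | |- is_true (0 <= _ + _) => apply: addr_ge0; pos
    | |- is_true (0 <= _^-1) => rewrite invr_ge0; pos
    | |- is_true (0 <= _ ^+ 2) => exact: sqr_ge0
    | |- is_true (0 <= _ ^+ _) => apply: exprn_ge0; pos
    | |- is_true (0 <= _ `^ _) => exact: powR_ge0
    | |- is_true (0 <= `|_|) => exact: normr_ge0
    | |- is_true (0 <= Num.sqrt _) => exact: sqrtr_ge0
    | |- is_true (0 <= \sum_(_ <- _ | _) _) => apply: sumr_ge0 => ? _; pos
    | |- is_true (0 <= \1__ _) => by rewrite indicE ler0n
    | |- is_true (0 <= dist _ _ _) => exact: dist_ge0
    | |- is_true (0 <= _) => apply: ltW; pos
    end
  | by eauto with pos ].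

(** * Sums of real numbers *)

Section FiniteSums.
Context (R : realType).

Lemma eqle (a b : R) : a = b -> a <= b.
Proof. by move->. Qed.

Lemma lerXn_le (a b : R) n : 0 <= a -> a <= b -> a ^+ n <= b ^+ n.
Proof. by move=> a0 ab; apply: lerXn2r; rewrite ?nnegrE// (le_trans a0). Qed.

Lemma inv_le_scale (k a b : R) : 0 < a -> 0 < b -> a <= k * b ->
  b^-1 <= k * a^-1.
Proof.
move=> a0 b0 ab; rewrite -(ler_pM2l b0) divff ?gt_eqF// mulrA.
by rewrite ler_pdivlMr// mul1r mulrC.
Qed.

(** Since [eta <= 1] and P^-2 <= 1, one has P^-2 <= (P^-2)^eta. A bound on scale ratios can thus be
    raised to the power [eta] while the decay keeps its full exponent. *)
Lemma powR_decay (q P m eta : R) : 0 < eta <= 1 -> 0 <= q -> 1 <= P ->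
  q * P ^- 2 <= m -> q `^ eta * P ^- 2 <= m `^ eta.
Proof.
move=> /andP[eta0 eta1] q0 P1 qm.
have P0 : 0 < P by lra.
have i0 : 0 < P ^- 2 by pos.
have i1 : P ^- 2 <= 1 by rewrite invf_le1 ?exprn_ege1//; pos.
apply: (@le_trans _ _ ((q * P ^- 2) `^ eta)).
  rewrite powRM//; last exact: ltW.
  by apply: ler_wpM2l; [pos|rewrite ger1_powR// i0].
apply: ge0_ler_powR => //; rewrite ?nnegrE; [pos|by pos|].
by apply: le_trans qm; pos.
Qed.

Lemma inv_sq_decay (rho s : R) : 0 < rho -> 0 < s ->
  (1 + rho / s) ^- 2 <= (s / rho) ^+ 2 /\ (1 + rho / s) ^- 2 <= 1.
Proof.
move=> r0 s0; have rs : 0 < rho / s by pos.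
split; last by rewrite invf_le1 ?exprn_ege1//; [lra|pos].
rewrite -exprVn; apply: lerXn_le; first by pos.
rewrite -[s / rho]invf_div lef_pV2 ?posrE; [lra|pos|pos].
Qed.

Lemma sum_uniq_sub_le (T : eqType) (s t : seq T) (f : T -> R) :
  uniq s -> uniq t -> {subset s <= t} -> (forall i, 0 <= f i) ->
  \sum_(i <- s) f i <= \sum_(i <- t) f i.
Proof.
move=> us ut st f0; rewrite [leRHS](bigID (mem s) predT)/=.
rewrite -[X in _ <= X + _]big_filter.
rewrite [X in _ <= X + _](perm_big s) ?lerDl ?sumr_ge0//=.
apply: uniq_perm => //; first exact: filter_uniq.
by move=> i; rewrite mem_filter; case: (boolP (i \in s)) => // /st ->.
Qed.

Lemma sum_by_key (T K : eqType) (s : seq T) (key : T -> K) (f : T -> R) :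
  \sum_(i <- s) f i =
  \sum_(k <- undup [seq key i | i <- s]) \sum_(i <- s | key i == k) f i.
Proof.
rewrite (exchange_big_dep predT)//=.
rewrite big_seq [RHS]big_seq; apply: eq_bigr => i si.
rewrite (eq_bigl (pred1 (key i))); last by move=> k; rewrite /= eq_sym.
rewrite -big_filter filter_pred1_uniq ?undup_uniq ?mem_undup ?map_f//.
by rewrite big_seq1.
Qed.

Lemma sum_geom_nat (q : R) (s : seq nat) : 0 <= q < 1 -> uniq s ->
  \sum_(n <- s) q ^+ n <= (1 - q)^-1.
Proof.
move=> /andP[q0 q1] us.
apply: (@le_trans _ _ (\sum_(n <- iota 0 (\max_(i <- s) i).+1) q ^+ n)).
  apply: sum_uniq_sub_le => //; first exact: iota_uniq.
    by move=> i si; rewrite mem_iota add0n ltnS leq0n/= leq_bigmax_seq.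
  by move=> i; exact: exprn_ge0.
move: (_.+1) => N; rewrite -[X in iota 0 X]subn0 -/(index_iota 0 N).
have q1' : 0 < 1 - q by lra.
rewrite -[leRHS]div1r ler_pdivlMr//.
suff -> : (\sum_(0 <= n < N) q ^+ n) * (1 - q) = 1 - q ^+ N.
  by rewrite gerDl oppr_le0 exprn_ge0.
elim: N => [|N IH]; first by rewrite big_nil expr0; lra.
by rewrite big_nat_recr//= mulrDl IH exprS; ring.
Qed.

Lemma sum_geom_int (q : R) (s : seq int) (m : int) : 0 <= q < 1 -> uniq s ->
  \sum_(k <- s) q ^+ `|k - m|%N <= 2 * (1 - q)^-1.
Proof.
move=> q01 us; rewrite (bigID (fun k : int => m <= k))/=.
rewrite [leRHS]mulrDl !mul1r.
have aux (P : pred int) : {in P &, injective (fun k : int => `|k - m|%N)} ->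
    \sum_(k <- s | P k) q ^+ `|k - m|%N <= (1 - q)^-1.
  move=> inj; rewrite -big_filter -(big_map (fun k : int => `|k - m|%N) predT
    (fun n => q ^+ n)).
  apply: sum_geom_nat => //; rewrite map_inj_in_uniq ?filter_uniq//.
  move=> i j; rewrite !mem_filter => /andP[Pi _] /andP[Pj _].
  exact: inj.
apply: lerD; apply: aux => i j hi hj hij.
  by have {}hi : m <= i := hi; have {}hj : m <= j := hj; lia.
have {}hi : i < m by rewrite ltNge; exact: hi.
have {}hj : j < m by rewrite ltNge; exact: hj.
by lia.

Qed.

(** The hypothesis h^2 <= f g avoids square roots of the weights. The induction step is the mean
    inequality 2 h M <= f G + g F, where F, G and M are the sums over the tail. *)
Lemma cauchy_schwarz_sum (T : eqType) (s : seq T) (f g h : T -> R) :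
  (forall i, i \in s -> [/\ 0 <= f i, 0 <= g i, 0 <= h i &
     h i ^+ 2 <= f i * g i]) ->
  (\sum_(i <- s) h i) ^+ 2 <= (\sum_(i <- s) f i) * (\sum_(i <- s) g i).
Proof.
elim: s => [|i s IH] H; first by rewrite !big_nil expr0n mul0r.
have H' j : j \in s -> [/\ 0 <= f j, 0 <= g j, 0 <= h j & h j ^+ 2 <= f j * g j].
  by move=> js; apply: H; rewrite in_cons js orbT.
have [fi gi hi hfg] := H i (mem_head _ _); have {}IH := IH H'.
have F0 : 0 <= \sum_(i <- s) f i.
  by rewrite big_seq sumr_ge0// => j /H'[].
have G0 : 0 <= \sum_(i <- s) g i.
  by rewrite big_seq sumr_ge0// => j /H'[].
have S0 : 0 <= \sum_(i <- s) h i.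
  by rewrite big_seq sumr_ge0// => j /H'[].
rewrite !big_cons; move: F0 G0 S0 IH.
move: (\sum_(i <- s) f i) (\sum_(i <- s) g i) (\sum_(i <- s) h i) => F G M.
move=> F0 G0 M0 IH.
have key : 2 * (h i * M) <= f i * G + g i * F.
  rewrite -(@ler_pXn2r _ 2)// ?nnegrE ?addr_ge0 ?mulr_ge0//.
  have h1 : (h i * M) ^+ 2 <= (f i * G) * (g i * F).
    rewrite exprMn (_ : _ * _ * _ = f i * g i * (F * G)); last by ring.
    by rewrite ler_pM// sqr_ge0.
  have := sqr_ge0 (f i * G - g i * F); nra.
by move: hfg IH key; nra.
Qed.

Lemma powRXn (k e : R) m : 0 <= k -> (k ^+ m) `^ e = (k `^ e) ^+ m.
Proof.
move=> k0.
by rewrite -(powR_mulrn m (powR_ge0 k e)) -(powR_mulrn m k0) powRAC.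
Qed.

Lemma powR_inv (x e : R) : 0 <= x -> x^-1 `^ e = (x `^ e)^-1.
Proof. by move=> x0; rewrite -powRN -powR_inv1// -powRrM mulN1r. Qed.

(** Here [v] is the volume of the m-th dyadic ball. A function of size [h c] 2^(-m eta) / [v] on it
    contributes v^(1-q) to the integral of its q-th power, and v^(1-q) grows at most like
    k^(m(1-q)): this is the origin of the ratio k^(1-q) 2^(-eta q). *)
Lemma annulus_term (h c v w k eta q : R) m : 0 < h -> 0 < c -> 0 < v ->
  0 < w -> 0 < k -> 0 < q <= 1 -> v <= k ^+ m * w ->
  (h * c * ((2 ^+ m)^-1 `^ eta * v^-1)) `^ q * v <=
  h `^ q * c `^ q * w `^ (1 - q) * (k `^ (1 - q) * 2^-1 `^ (eta * q)) ^+ m.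
Proof.
move=> h0 c0 v0 w0 k0 /andP[q0 q1] vw.
have m0 : 0 < (2 ^+ m)^-1 :> R by pos.
have hc0 : 0 < h * c by pos.
have i0 : 0 < v^-1 by pos.
have y0 : 0 <= (2 ^+ m)^-1 `^ eta * v^-1 by pos.
rewrite (powRM _ (ltW hc0) y0) (powRM _ (ltW h0) (ltW c0)).
rewrite (powRM _ (powR_ge0 _ _) (ltW i0)).
have -> : v^-1 `^ q = v `^ (1 - q) / v.
  rewrite -(powR_inv1 (ltW v0)) -powRrM mulN1r powRN powR_inv1 ?(ltW v0)//.
  rewrite powRB; last by rewrite (gt_eqF v0) implybT.
  have vq : 0 < v `^ q by pos.
  by rewrite powRr1 ?(ltW v0)//; field; rewrite !gt_eqF.
rewrite -powRrM exprMn.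
have -> : (2 ^+ m)^-1 `^ (eta * q) = (2^-1 `^ (eta * q)) ^+ m :> R.
  by rewrite -exprVn powRXn// invr_ge0.
have -> : (k `^ (1 - q)) ^+ m = (k ^+ m) `^ (1 - q).
  by rewrite powRXn// ltW.
set z := 2^-1 `^ _ ^+ m.
rewrite [leLHS](_ : _ = h `^ q * c `^ q * z * v `^ (1 - q)); last first.
  by field; rewrite gt_eqF.
rewrite [leRHS](_ : _ = h `^ q * c `^ q * z *
  ((k ^+ m) `^ (1 - q) * w `^ (1 - q))); last by ring.
apply: ler_wpM2l; first by rewrite /z; pos.
rewrite -powRM ?(ltW w0) ?exprn_ge0 ?(ltW k0)//.
by apply: ge0_ler_powR; rewrite ?nnegrE//; [lra|exact: ltW|pos].
Qed.

(** This is exp(-|ln a - ln b|), the symmetric form of a ratio of scales: it decays geometrically in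
    the difference of generations whichever scale is larger. *)
Definition minratio (a b : R) : R := Num.min (a / b) (b / a).

Lemma minratioC a b : minratio a b = minratio b a.
Proof. by rewrite /minratio minC. Qed.

Lemma minratio_gt0 a b : 0 < a -> 0 < b -> 0 < minratio a b.
Proof. by move=> a0 b0; rewrite /minratio lt_min !divr_gt0. Qed.

Lemma minratio_le1 a b : 0 < a -> 0 < b -> minratio a b <= 1.
Proof.
move=> a0 b0; rewrite /minratio ge_min !ler_pdivrMr// !mul1r.
exact: le_total.
Qed.

Lemma minratioM_sqr_le a b c d eta : 0 < a -> 0 < b -> 0 < c -> 0 < d ->
  0 <= eta -> ((minratio a b * minratio c d) `^ eta) ^+ 2 <=
    minratio a b `^ eta * minratio c d `^ eta.
Proof.
move=> a0 b0 c0 d0 eta0.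
have m1 := minratio_gt0 a0 b0; have m2 := minratio_gt0 c0 d0.
rewrite powRM ?(ltW m1) ?(ltW m2)// expr2 ler_piMr//; first by pos.
have le1 m : 0 < m -> m <= 1 -> m `^ eta <= 1.
  move=> m0 mle; have <- : 1 `^ eta = 1 :> R by rewrite powR1.
  by apply: ge0_ler_powR => //; rewrite nnegrE ltW.
by apply: mulr_ile1; [pos|pos| |]; apply: le1 => //; exact: minratio_le1.
Qed.

Lemma minratio_le a b : 0 < a -> a <= b -> minratio a b = a / b.
Proof.
move=> a0 ab; have b0 := lt_le_trans a0 ab.
apply/min_idPl; apply: (@le_trans _ _ 1).
  by rewrite ler_pdivrMr// mul1r.
by rewrite ler_pdivlMr// mul1r.
Qed.

Lemma minratioE a b : 0 < a -> 0 < b ->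
  minratio a b = expR (- `|ln a - ln b|).
Proof.
move=> a0 b0; wlog ab : a b a0 b0 / a <= b.
  move=> H; case: (leP a b) => [ab|/ltW ab]; first exact: H.
  by rewrite minratioC distrC; exact: H.
rewrite minratio_le// ler0_norm ?subr_le0 ?ler_ln ?posrE// opprK.
by rewrite expRD expRN !lnK ?posrE.
Qed.

(** On a logarithmic scale the points q^k are equally spaced with gap -ln q, so the terms decay
    geometrically on both sides of the generation closest to [rho], and the bound is uniform in
    [rho]. *)
Lemma sum_minratio (q e : R) : 0 < q < 1 -> 0 < e ->
  exists2 C, 0 < C & forall (s : seq int) rho, uniq s -> 0 < rho ->
    \sum_(k <- s) minratio (q ^ k) rho `^ e <= C.
Proof.
move=> /andP[q0 q1] e0; pose L := - ln q.
have L0 : 0 < L by rewrite oppr_gt0 ln_lt0// q0.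
pose c := expR (- (e * L)).
have c1 : 0 <= c < 1.
  by rewrite expR_ge0/= expR_lt1 oppr_lt0 mulr_gt0.
exists (expR (e * L) * (2 * (1 - c)^-1)).
  by rewrite mulr_gt0 ?expR_gt0// mulr_gt0// invr_gt0 subr_gt0; case/andP: c1.
(* [t] is the real generation of [rho], that is rho = q^t; rounding it down to [m] costs the factor
   exp(e L). *)
move=> s rho us r0; pose t := - ln rho / L; pose m := Num.floor t.
apply: le_trans (ler_wpM2l (expR_ge0 _) (sum_geom_int m c1 us)).
rewrite mulr_sumr; apply: ler_sum => k _.
have qk0 : 0 < q ^ k by rewrite exprz_gt0.
rewrite minratioE// -powR_intmul ?(ltW q0)// ln_powR.
rewrite /powR gt_eqF ?expR_gt0// expRK -expRM_natl -expRD ler_expR.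
have -> : k%:~R * ln q - ln rho = - (L * (k%:~R - t)).
  rewrite /t mulrBr mulrCA divff ?gt_eqF// mulr1 /L; ring.
rewrite normrN normrM (gtr0_norm L0).
have /andP[h1 h2] : (m%:~R <= t < m%:~R + 1) 
  by rewrite floor_le/= -intrD1 floorD1_gt.
have h : `|k%:~R - m%:~R| - 1 <= `|k%:~R - t| :> R.
  have : `|k%:~R - m%:~R| <= `|k%:~R - t| + `|t - m%:~R| :> R.
    by exact: ler_distD.
  by rewrite (ger0_norm (_ : 0 <= t - _)); lra.
have -> : (`|k - m|%N%:R : R) = `|k%:~R - m%:~R|.
  by rewrite natr_absz intr_norm rmorphB.
have : e * L * (`|k%:~R - m%:~R| - 1) <= e * L * `|k%:~R - t|.
  by rewrite ler_pM2l// mulr_gt0.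
by nra.
Qed.

End FiniteSums.

(** * Geometry of spaces of homogeneous type *)

Section Geometry.
Context (R : realType) (disp : measure_display) (X : measurableType disp).
Variable S : sht R X.
Local Notation d := (dist S).
Local Notation B := (qball (dist S)).
Local Notation V := (vol S).
Local Notation A := (A0 S).
Local Notation K := (Cmu S).

Lemma distxx x : d x x = 0.
Proof. by apply/dist_eq0. Qed.

Lemma A0_gt0 : 0 < A.
Proof. exact: lt_le_trans ltr01 (A0_ge1 S). Qed.

Lemma mu_ball_gt0 x r : 0 < r -> (0 < mu S (B x r))%E.
Proof.
move=> r0; have r20 : 0 < r / 2 by lra.
by have [] := sht_doubling S x r20; rewrite (_ : 2 * (r / 2) = r)//; field.
Qed.

Lemma mu_ball_lty x r : 0 < r -> (mu S (B x r) < +oo)%E.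
Proof. by move=> r0; have [] := sht_doubling S x r0. Qed.

Lemma mu_ballE x r : 0 < r -> mu S (B x r) = (V r x)%:E.
Proof.
move=> r0; rewrite /vol fineK// ge0_fin_numE ?measure_ge0//.
exact: mu_ball_lty.
Qed.

Lemma vol_gt0 r x : 0 < r -> 0 < V r x.
Proof. by move=> r0; rewrite -lte_fin -mu_ballE// mu_ball_gt0. Qed.

Lemma vol_ge0 r x : 0 <= V r x.
Proof. by rewrite /vol fine_ge0// measure_ge0. Qed.

Lemma vol_sub r s x y : 0 < r -> 0 < s -> B x r `<=` B y s -> V r x <= V s y.
Proof.
move=> r0 s0 rs; rewrite -lee_fin -!mu_ballE//.
by apply: le_measure => //; rewrite inE; apply: sht_ball_measurable.
Qed.

Lemma vol_mono r s x : 0 < r -> r <= s -> V r x <= V s x.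
Proof.
move=> r0 rs; apply: vol_sub => //; first exact: lt_le_trans rs.
by move=> y /= /lt_le_trans; apply.
Qed.

Lemma vol_double r x : 0 < r -> V (2 * r) x <= K * V r x.
Proof.
move=> r0; have r20 : 0 < 2 * r by lra.
rewrite -lee_fin EFinM -!mu_ballE//.
by have [] := sht_doubling S x r0.
Qed.

Lemma Cmu_ge1 : 1 <= K.
Proof.
have [E [_ muE]] := sht_nonzero S.
have [x _] : E !=set0.
  by apply/set0P/eqP => E0; apply: muE; rewrite E0 measure0.
have := vol_double x (@ltr01 R); have := @vol_mono 1 (2 * 1) x ltr01.
have -> : (1 <= 2 * 1 :> R) by lra.
move=> /(_ isT) h1 h2; have := le_trans h1 h2.
by rewrite -{1}(mul1r (V 1 x)) ler_pM2r// vol_gt0.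
Qed.

Lemma Cmu_gt0 : 0 < K.
Proof. exact: lt_le_trans ltr01 Cmu_ge1. Qed.

(* an integer at least the upper dimension *)
Definition dimN : nat := locked (Num.bound K).

Lemma Cmu_le_exp : K <= 2 ^+ dimN.
Proof.
have /ltW/le_trans := archi_boundP (ltW Cmu_gt0); apply.
by rewrite -natrX ler_nat /dimN -lock ltnW// ltn_expl.
Qed.

Lemma vol_pow2 m r x : 0 < r -> V (2 ^+ m * r) x <= K ^+ m * V r x.
Proof.
move=> r0; elim: m => [|m IH]; first by rewrite !expr0 !mul1r.
rewrite exprS -mulrA (le_trans (vol_double _ _))//.
  by rewrite mulr_gt0// exprn_gt0.
by rewrite exprS -mulrA ler_pM2l// Cmu_gt0.
Qed.

Lemma pow2_between (lam : R) : 1 <= lam ->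
  exists m : nat, 2 ^+ m <= lam < 2 ^+ m.+1.
Proof.
move=> l1; have l0 : 0 <= lam by lra.
have ex : exists m, lam < 2 ^+ m.
  exists (Num.bound lam); apply: (lt_le_trans (archi_boundP l0)).
  by rewrite -natrX ler_nat ltnW// ltn_expl.
case: (ex_minnP ex) => -[|m] hm hmin.
  by move: hm; rewrite expr0 => /lt_le_trans/(_ l1); rewrite ltxx.
exists m; rewrite hm andbT leNgt; apply/negP => /hmin.
by rewrite ltnn.
Qed.

Lemma vol_scale lam r x : 1 <= lam -> 0 < r ->
  V (lam * r) x <= K * lam ^+ dimN * V r x.
Proof.
move=> l1 r0; have [m /andP[ml lm]] := pow2_between l1.
apply: (@le_trans _ _ (V (2 ^+ m.+1 * r) x)).
  by apply: vol_mono; [rewrite mulr_gt0//; lra|rewrite ler_pM2r// ltW].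
apply: (le_trans (vol_pow2 _ _ r0)).
rewrite ler_wpM2r ?vol_ge0// exprS ler_wpM2l ?(ltW Cmu_gt0)//.
apply: (@le_trans _ _ ((2 ^+ dimN) ^+ m)).
  by rewrite lerXn2r ?nnegrE ?exprn_ge0 ?(ltW Cmu_gt0)// Cmu_le_exp.
by rewrite -exprM mulnC exprM lerXn2r ?nnegrE ?exprn_ge0//; lra.
Qed.

(** Being at least 1, this relative distance can be raised to negative powers without a singularity,
    and the quasi-triangle inequality becomes multiplicative for it. *)
Definition reldist (rho : R) (x y : X) : R := 1 + d x y / rho.
Local Notation E := reldist.

Lemma reldist_ge1 rho x y : 0 < rho -> 1 <= E rho x y.
Proof. by move=> r0; rewrite /E lerDl divr_ge0 ?dist_ge0// ltW. Qed.

Lemma reldist_gt0 rho x y : 0 < rho -> 0 < E rho x y.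
Proof. by move=> r0; apply: lt_le_trans (reldist_ge1 _ _ r0). Qed.

Lemma reldist_sym rho x y : E rho x y = E rho y x.
Proof. by rewrite /E dist_sym. Qed.

Lemma reldist_tri rho x y z : 0 < rho -> E rho x z <= A * E rho x y * E rho y z.
Proof.
move=> r0; have A1 := A0_ge1 S.
have hq : d x z / rho <= A * (d x y / rho + d y z / rho).
  by rewrite -mulrDl mulrA ler_pM2r ?invr_gt0// dist_quasi.
have a0 : 0 <= d x y / rho by rewrite divr_ge0 ?dist_ge0// ltW.
have b0 : 0 <= d y z / rho by rewrite divr_ge0 ?dist_ge0// ltW.
rewrite /E; move: (d x y / rho) (d y z / rho) (d x z / rho) a0 b0 hq.
move=> a b c a0 b0 hc; have ab : 0 <= a * b by rewrite mulr_ge0.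
by have := ler_wpM2r ab (le_trans ler01 A1); rewrite mul0r; nra.
Qed.

Lemma reldist_anti rho sig x y : 0 < rho -> rho <= sig -> E sig x y <= E rho x y.
Proof.
move=> r0 rs; rewrite lerD2l ler_wpM2l ?dist_ge0// lef_pV2// posrE//.
exact: lt_le_trans rs.
Qed.

Lemma vol_change rho x y : 0 < rho ->
  V rho x <= K * (A * E rho x y) ^+ dimN * V rho y.
Proof.
move=> r0; have E1 := reldist_ge1 x y r0; have A1 := A0_ge1 S.
have AE1 : 1 <= A * E rho x y by nra.
apply: le_trans (vol_scale y AE1 r0); apply: vol_sub => //.
  by rewrite mulr_gt0//; lra.
move=> z /= xz; apply: (le_lt_trans (dist_quasi S y z x)).
rewrite -mulrA ltr_pM2l ?A0_gt0// /E mulrDl mul1r divfK ?gt_eqF//.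
by rewrite (dist_sym S y) addrC ltrD2r.
Qed.

Lemma reldist_inv_tri N rho x y z : 0 < rho ->
  E rho y z ^- N <= (A * E rho x y) ^+ N * E rho x z ^- N.
Proof.
move=> r0; rewrite -ler_pdivrMr ?invr_gt0 ?exprn_gt0 ?reldist_gt0// invrK.
rewrite mulrC ler_pdivrMr ?exprn_gt0 ?reldist_gt0//.
rewrite -exprMn lerXn2r ?nnegrE//; try exact: ltW (reldist_gt0 _ _ _).
  by rewrite !mulr_ge0// ?(ltW A0_gt0)//; exact: ltW (reldist_gt0 _ _ _).
exact: reldist_tri.
Qed.

Lemma reldist_expN_le1 N rho x y : 0 < rho -> E rho x y ^- N <= 1.
Proof. by move=> r0; rewrite invf_le1 ?exprn_gt0 ?reldist_gt0// exprn_ege1// reldist_ge1. Qed.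

Lemma reldist_expN_anti N M rho x y : 0 < rho -> (N <= M)%N ->
  E rho x y ^- M <= E rho x y ^- N.
Proof.
move=> r0 NM; rewrite lef_pV2 ?posrE ?exprn_gt0 ?reldist_gt0//.
by rewrite ler_weXn2l// reldist_ge1.
Qed.

Lemma measurable_dist x : measurable_fun setT (d x).
Proof.
move=> mD; apply: (measurability _ (RGenInftyO.measurableE R)) => //.
move=> _ [_ [r ->] <-]; rewrite setTI.
rewrite (_ : _ @^-1` _ = B x r); first exact: sht_ball_measurable.
by apply/seteqP; split => y /=; rewrite in_itv.
Qed.

Lemma measurable_reldist rho x : measurable_fun setT (E rho x).
Proof.
apply: measurable_funD => //; apply: measurable_funM => //.
exact: measurable_dist.
Qed.

Lemma measurable_reldist_expN N rho x : 0 < rho ->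
  measurable_fun setT (fun y => E rho x y ^- N).
Proof.
move=> r0.
rewrite (_ : (fun y => _) = (@powR R)^~ (- N%:R) \o E rho x); last first.
  apply/funext => y /=.
  by rewrite powR_invn// ltW// reldist_gt0.
exact: measurableT_comp (measurable_powR _) (measurable_reldist _ _).
Qed.

(** [f] is dominated by the sum of the [a m] times the indicators of the dyadic balls. Full balls
    may replace annuli because the [a m] are nonnegative. *)
Lemma integral_annuli (f : X -> R) (a : nat -> R) (M rho : R) (z : X) :
  0 < rho -> measurable_fun setT f -> (forall x, 0 <= f x) ->
  (forall m, 0 <= a m) ->
  (forall x, exists2 m, d z x < 2 ^+ m * rho & f x <= a m) ->
  (forall n, \sum_(0 <= m < n) a m * V (2 ^+ m * rho) z <= M) ->
  (\int[mu S]_x (f x)%:E <= M%:E)%E.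
Proof.
move=> r0 mf f0 a0 fa aM.
have mB m : measurable (B z (2 ^+ m * rho)) by exact: sht_ball_measurable.
pose g m x := ((a m)%:E * (\1_(B z (2 ^+ m * rho)) x)%:E)%E.
have g0 m x : (0 <= g m x)%E.
  by rewrite /g mule_ge0 ?lee_fin ?a0// indicE ler0n.
have mg m : measurable_fun setT (g m).
  apply: measurable_funeM => //; apply/measurable_EFinP.
  exact: measurable_indic.
apply: (@le_trans _ _ (\int[mu S]_x (\sum_(0 <= m <oo) g m x))%E).
  apply: ge0_le_integral => //.
  - by move=> x _; rewrite lee_fin.
  - exact/measurable_EFinP.
  - exact: ge0_emeasurable_sum.
  - move=> x _; have [m zx fm] := fa x.
    apply: (@le_trans _ _ (g m x)).
      by rewrite /g indicE mem_set//= mule1 lee_fin.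
    have := @nneseries_lim_ge _ (g^~ x) predT 0 m.+1.
    move/(_ (fun n _ _ => g0 n x)); apply: le_trans.
    rewrite big_nat_recr//= leeDr// sume_ge0// => i _; exact: g0.
rewrite integral_nneseries//.
apply: lime_le.
  by apply: is_cvg_nneseries => n _ _; rewrite integral_ge0.
apply: nearW => n.
rewrite (eq_bigr (fun m => (a m * V (2 ^+ m * rho) z)%:E)) ?sumEFin ?lee_fin//.
move=> m _; rewrite ge0_integralZl ?lee_fin//.
- rewrite integral_indic// setIT EFinM; congr (_ * _)%E.
  by apply: mu_ballE; rewrite mulr_gt0// exprn_gt0.
- exact/measurable_EFinP/measurable_indic.
Qed.

Lemma sum_half_le n : \sum_(0 <= m < n) (2^-1 : R) ^+ m <= 2.
Proof.
suff -> : \sum_(0 <= m < n) (2^-1 : R) ^+ m = 2 - 2 * 2^-1 ^+ n.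
  by rewrite gerDl oppr_le0 mulr_ge0// exprn_ge0// invr_ge0.
elim: n => [|n IH]; first by rewrite big_nil expr0; lra.
by rewrite big_nat_recr//= IH exprS; field.
Qed.

Lemma dist_annulus rho z x : 0 < rho ->
  exists2 m, d z x < 2 ^+ m * rho & 2 ^+ m <= 2 * E rho x z.
Proof.
move=> r0; have [m /andP[m1 m2]] := pow2_between (reldist_ge1 x z r0).
exists m.+1; last by rewrite exprS ler_pM2l.
rewrite -ltr_pdivrMr//; apply: le_lt_trans m2.
by rewrite dist_sym lerDr.
Qed.

(** One power more than the growth exponent [dimN] of volumes, so that the ball of radius 2^m [rho]
    contributes at most a multiple of 2^-m to the integral of the decay. *)
Definition decayN : nat := locked dimN.+1.

Lemma decayNE : decayN = dimN.+1.
Proof. by rewrite /decayN -lock. Qed.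

Lemma integral_reldist N rho z : 0 < rho -> (decayN <= N)%N ->
  (\int[mu S]_x (E rho x z ^- N)%:E <= (2 ^+ decayN.+1 * V rho z)%:E)%E.
Proof.
move=> r0 hN.
pose a m : R := 2 ^+ decayN * (2 ^+ m)^-1 ^+ decayN.
have p2 m : 0 < 2 ^+ m :> R by rewrite exprn_gt0.
apply: (@integral_annuli _ a _ rho z) => //.
- rewrite (_ : (fun x => _) = (fun x => E rho z x ^- N)).
    exact: measurable_reldist_expN.
  by apply/funext => x; rewrite reldist_sym.
- by move=> x; rewrite invr_ge0 exprn_ge0// ltW// reldist_gt0.
- by move=> m; rewrite mulr_ge0 ?invr_ge0 ?exprn_ge0// ltW.
- move=> x; have [m h1 h2] := dist_annulus z x r0; exists m => //.
  apply: (le_trans (reldist_expN_anti x z r0 hN)).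
  rewrite /a -(exprVn (E rho x z)) -exprMn lerXn2r ?nnegrE//.
  + by rewrite invr_ge0 ltW// reldist_gt0.
  + by rewrite ler_pdivlMr// ler_pdivrMl ?reldist_gt0// mulrC.
- move=> n; apply: (@le_trans _ _
    (\sum_(0 <= m < n) 2 ^+ decayN * V rho z * 2^-1 ^+ m)).
    apply: ler_sum => m _; rewrite /a -!mulrA ler_pM2l//.
    apply: (@le_trans _ _ ((2 ^+ m)^-1 ^+ decayN * (K ^+ m * V rho z))).
      by rewrite ler_pM2l ?exprn_gt0 ?invr_gt0// vol_pow2.
    rewrite mulrA [leRHS]mulrC ler_pM2r ?vol_gt0//.
    rewrite -exprVn -exprM mulnC exprM -exprMn lerXn2r ?nnegrE//.
      by rewrite mulr_ge0 ?exprn_ge0 ?invr_ge0// ltW// Cmu_gt0.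
    rewrite decayNE exprS -mulrA ler_piMr ?invr_ge0//.
    rewrite exprVn mulrC ler_pdivrMr ?exprn_gt0//.
    by rewrite mul1r Cmu_le_exp.
  rewrite -mulr_sumr exprSr -!mulrA ler_pM2l// [leRHS]mulrC.
  by rewrite ler_pM2l ?sum_half_le// vol_gt0.
Qed.

End Geometry.

#[global] Hint Resolve A0_gt0 Cmu_gt0 : pos.
#[global] Hint Extern 1 (is_true (0 < vol _ _ _)) => apply: vol_gt0; pos : pos.
#[global] Hint Extern 1 (is_true (0 < reldist _ _ _ _)) =>
  apply: reldist_gt0; pos : pos.
#[global] Hint Extern 1 (is_true (0 <= vol _ _ _)) => exact: vol_ge0 : pos.

(** * Integrals of nonnegative real-valued functions *)

Section NonnegIntegral.
Context (d : measure_display) (T : measurableType d) (R : realType).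
Variable m : {measure set T -> \bar R}.

Lemma measurable_sum_seq (I : eqType) (s : seq I) (P : pred I) (g : I -> T -> R) :
  (forall i, i \in s -> measurable_fun setT (g i)) ->
  measurable_fun setT (fun x => \sum_(i <- s | P i) g i x).
Proof.
move=> mg; elim: s mg => [|i s IH] mg.
  by under eq_fun do rewrite big_nil; exact: measurable_cst.
have ms : measurable_fun setT (fun x => \sum_(i <- s | P i) g i x).
  by apply: IH => j js; apply: mg; rewrite in_cons js orbT.
under eq_fun do rewrite big_cons.
case: (P i) => //.
by apply: measurable_funD => //; apply: mg; rewrite mem_head.
Qed.

Lemma integral_sumr (I : eqType) (s : seq I) (g : I -> T -> R) :
  (forall i, i \in s -> measurable_fun setT (g i)) ->
  (forall i x, i \in s -> 0 <= g i x) ->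
  (\int[m]_x (\sum_(i <- s) g i x)%:E = \sum_(i <- s) \int[m]_x (g i x)%:E)%E.
Proof.
elim: s => [|i s IH] mg g0.
  by under eq_integral do rewrite big_nil; rewrite integral0 big_nil.
under eq_integral do rewrite big_cons EFinD.
rewrite big_cons ge0_integralD//=.
- rewrite IH// => j; first by move=> js; apply: mg; rewrite in_cons js orbT.
  by move=> x js; apply: g0; rewrite in_cons js orbT.
- by move=> x _; rewrite lee_fin g0// mem_head.
- by apply/measurable_EFinP; apply: mg; rewrite mem_head.
- move=> x _; rewrite lee_fin big_seq sumr_ge0// => j js.
  by rewrite g0// in_cons js orbT.
- apply/measurable_EFinP/measurable_sum_seq => j js.
  by apply: mg; rewrite in_cons js orbT.
Qed.

Lemma integralZr_ge0 (k : R) (f : T -> R) : 0 <= k ->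
  measurable_fun setT f -> (forall x, 0 <= f x) ->
  (\int[m]_x (k * f x)%:E = k%:E * \int[m]_x (f x)%:E)%E.
Proof.
move=> k0 mf f0; under eq_integral do rewrite EFinM.
by rewrite ge0_integralZl ?lee_fin//; [exact/measurable_EFinP|move=> x _; rewrite lee_fin].
Qed.

Lemma le_integral_ge0 (f g : T -> R) :
  measurable_fun setT f -> measurable_fun setT g -> (forall x, 0 <= f x) ->
  (forall x, f x <= g x) ->
  (\int[m]_x (f x)%:E <= \int[m]_x (g x)%:E)%E.
Proof.
move=> mf mg f0 fg; apply: ge0_le_integral => //.
- by move=> x _; rewrite lee_fin.
- exact/measurable_EFinP.
- exact/measurable_EFinP.
- by move=> x _; rewrite lee_fin.
Qed.

Lemma integralD_ge0 (f g : T -> R) :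
  measurable_fun setT f -> measurable_fun setT g -> (forall x, 0 <= f x) ->
  (forall x, 0 <= g x) ->
  (\int[m]_x (f x + g x)%:E = \int[m]_x (f x)%:E + \int[m]_x (g x)%:E)%E.
Proof.
move=> mf mg f0 g0; under eq_integral do rewrite EFinD.
rewrite ge0_integralD//.
- by move=> x _; rewrite lee_fin.
- exact/measurable_EFinP.
- by move=> x _; rewrite lee_fin.
- exact/measurable_EFinP.
Qed.

End NonnegIntegral.

(** * Scales, volumes and cubes of a reference grid *)

Section Grid.
Context (R : realType) (disp : measure_display) (X : measurableType disp).
Variables (S : sht R X) (D : reference_grid S).
Local Notation d := (dist S).
Local Notation B := (qball (dist S)).
Local Notation V := (vol S).
Local Notation A := (A0 S).
Local Notation K := (Cmu S).
Local Notation E := (reldist S).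
Local Notation del := (delta D).
Local Notation W := (wav_index D).
Local Notation Q := (wav_cube D).

Definition wscale (i : int * X) : R := del ^ i.1.
Definition wvol (i : int * X) : R := V (wscale i) i.2.
Definition cubem (i : int * X) : R := fine (mu S (Q i)).

Lemma delta_lt1 : del < 1.
Proof.
apply: (le_lt_trans (delta_small D)).
have A10 : A ^- 10 <= 1.
  by rewrite invf_le1 ?exprn_gt0 ?A0_gt0// exprn_ege1// A0_ge1.
apply: (le_lt_trans (ler_wpM2l _ A10)); first by rewrite invr_ge0 exprn_ge0.
by rewrite mulr1 invf_lt1 ?exprn_gt0//; lra.
Qed.

Lemma wscale_gt0 i : 0 < wscale i.
Proof. by rewrite exprz_gt0 ?delta_gt0. Qed.

Lemma wvol_gt0 i : 0 < wvol i.
Proof. by rewrite vol_gt0 ?wscale_gt0. Qed.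

Lemma deltaD k l : del ^ (k + l) = del ^ k * del ^ l.
Proof. by rewrite exprzDr// unitfE gt_eqF// delta_gt0. Qed.

Lemma wscale_anti i j : i.1 <= j.1 -> wscale j <= wscale i.
Proof.
move=> ij; rewrite /wscale; have -> : j.1 = i.1 + `|j.1 - i.1|%N by lia.
rewrite deltaD ler_piMr ?(ltW (wscale_gt0 i))//.
by rewrite exprn_ile1 ?(ltW (delta_gt0 D)) ?(ltW delta_lt1).
Qed.

Lemma c1_gt0 : 0 < c1 S.
Proof. by rewrite /c1 divr_gt0// invr_gt0 exprn_gt0// A0_gt0. Qed.

Lemma C1_ge1 : 1 <= C1 S.
Proof.
have : 1 <= A ^+ 4 by rewrite exprn_ege1// A0_ge1.
by rewrite /C1; lra.
Qed.

Lemma C1_gt0 : 0 < C1 S.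
Proof. exact: lt_le_trans ltr01 C1_ge1. Qed.

Lemma c1_le1 : c1 S <= 1.
Proof.
have : A ^- 5 <= 1.
  by rewrite invf_le1 ?exprn_gt0 ?A0_gt0// exprn_ege1// A0_ge1.
have : 0 <= A ^- 5 by rewrite invr_ge0 exprn_ge0// ltW// A0_gt0.
by rewrite /c1; lra.
Qed.

Opaque C1 c1.

Lemma wav_pts i : W i -> pts D (i.1 + 1) i.2.
Proof. by case. Qed.

Lemma wav_cube_measurable i : W i -> measurable (Q i).
Proof. by move=> /wav_pts; exact: cube_measurable. Qed.

Lemma ball_sub_cube i : W i -> B i.2 (c1 S * (del * wscale i)) `<=` Q i.
Proof.
move=> /wav_pts /cube_ball[+ _]; by rewrite /Q deltaD expr1z [del ^ _ * _]mulrC.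
Qed.

Lemma cube_sub_ball i : W i -> Q i `<=` B i.2 (C1 S * wscale i).
Proof.
move=> /wav_pts /cube_ball[_ +] x Qx => /(_ x Qx)/= /lt_le_trans; apply.
rewrite ler_pM2l ?C1_gt0// deltaD expr1z.
by rewrite ler_piMr ?(ltW (wscale_gt0 i)) ?(ltW delta_lt1).
Qed.

Lemma cube_center i : W i -> Q i i.2.
Proof.
move=> Wi; apply: (ball_sub_cube Wi); rewrite /qball /= distxx.
exact: mulr_gt0 c1_gt0 (mulr_gt0 (delta_gt0 D) (wscale_gt0 _)).
Qed.

Lemma mu_cubeE i : W i -> mu S (Q i) = (cubem i)%:E.
Proof.
move=> Wi; rewrite /cubem fineK// ge0_fin_numE ?measure_ge0//.
apply: (@le_lt_trans _ _ (mu S (B i.2 (C1 S * wscale i)))).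
  apply: le_measure; rewrite ?inE; last exact: cube_sub_ball.
    exact: wav_cube_measurable.
  exact: sht_ball_measurable.
by rewrite mu_ball_lty// mulr_gt0 ?C1_gt0 ?wscale_gt0.
Qed.

Lemma cubem_wvol : exists2 C, 1 <= C & forall i, W i ->
  wvol i <= C * cubem i /\ cubem i <= C * wvol i.
Proof.
(* The cube attached to an index of level k has generation k + 1, so its inner ball has radius c1
   delta^(k+1); [lam] dilates it to the scale delta^k. *)
pose lam : R := (c1 S * del)^-1.
have cd0 : 0 < c1 S * del by rewrite mulr_gt0 ?c1_gt0 ?delta_gt0.
have lam1 : 1 <= lam.
  rewrite /lam -div1r ler_pdivlMr// mul1r.
  apply: mulr_ile1; rewrite ?c1_le1 ?(ltW delta_lt1)//.
    exact: ltW c1_gt0.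
  exact: ltW (delta_gt0 D).
have K1 := Cmu_ge1 S.
have l1 : 1 <= lam ^+ dimN S by rewrite exprn_ege1.
have c1' : 1 <= C1 S ^+ dimN S by rewrite exprn_ege1// C1_ge1.
exists (K * lam ^+ dimN S * C1 S ^+ dimN S); first by rewrite !mulr_ege1.
move=> i Wi; have s0 := wscale_gt0 i.
have bs : 0 < c1 S * (del * wscale i).
  exact: mulr_gt0 c1_gt0 (mulr_gt0 (delta_gt0 D) s0).
have c0 : 0 <= cubem i by rewrite fine_ge0// measure_ge0.
split.
  rewrite /wvol (_ : wscale i = lam * (c1 S * (del * wscale i))); last first.
    by rewrite /lam; field; rewrite !gt_eqF ?delta_gt0 ?c1_gt0.
  apply: (le_trans (vol_scale S _ lam1 bs)).
  have Kl0 : 0 < K * lam ^+ dimN S.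
    by rewrite mulr_gt0 ?Cmu_gt0// (lt_le_trans ltr01).
  apply: (@le_trans _ _ (K * lam ^+ dimN S * cubem i)); last first.
    by rewrite [leRHS]mulrAC ler_peMr// mulr_ge0// ltW.
  rewrite ler_pM2l// -lee_fin -mu_cubeE// -mu_ballE//.
  apply: le_measure; rewrite ?inE; first exact: sht_ball_measurable.
    exact: wav_cube_measurable.
  exact: ball_sub_cube.
apply: (@le_trans _ _ (V (C1 S * wscale i) i.2)).
  rewrite -lee_fin -mu_cubeE// -mu_ballE; last exact: mulr_gt0 C1_gt0 s0.
  apply: le_measure; rewrite ?inE; last exact: cube_sub_ball.
    exact: wav_cube_measurable.
  exact: sht_ball_measurable.
apply: (le_trans (vol_scale S _ C1_ge1 s0)).
rewrite ler_pM2r ?wvol_gt0// -mulrA ler_pM2l ?Cmu_gt0//.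
by rewrite ler_peMl// (le_trans ler01).
Qed.

Lemma cubem_gt0 i : W i -> 0 < cubem i.
Proof.
move=> Wi; have [C C1 /(_ i Wi)[h _]] := cubem_wvol.
have := lt_le_trans (wvol_gt0 i) h.
by rewrite pmulr_rgt0// (lt_le_trans ltr01).
Qed.

Lemma cube_nest i j x : W i -> W j -> i.1 <= j.1 -> Q i x -> Q j x ->
  Q j `<=` Q i.
Proof.
move=> /wav_pts pi /wav_pts pj ij Qi Qj.
have ij' : i.1 + 1 <= j.1 + 1 by lia.
have [//|] := cube_nested ij' pi pj.
by move=> /seteqP[+ _] => /(_ x); case.
Qed.

Lemma cube_inj i j x : W i -> W j -> i.1 = j.1 -> Q i x -> Q j x -> i = j.
Proof.
case: i j => [k y] [l z] /wav_pts/= pi /wav_pts/= pj kl; rewrite -kl in pj *.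
rewrite /wav_cube/= => Qi Qj; congr pair.
by apply: (cube_disjoint pi pj); exists x.
Qed.

Lemma cube_reldist i x rho : W i -> Q i x -> wscale i <= rho ->
  E rho x i.2 <= 1 + C1 S.
Proof.
move=> Wi Qx sr; have r0 := lt_le_trans (wscale_gt0 i) sr.
rewrite lerD2l ler_pdivrMr// dist_sym.
apply: ltW; apply: (lt_le_trans (cube_sub_ball Wi Qx)).
by rewrite ler_pM2l ?C1_gt0.
Qed.

(** Finite sets of wavelet indices as duplicate-free sequences. The constants below are uniform in
    them, which leaves only monotone limits for the passage to infinite sums. *)
Definition windices (J : seq (int * X)) := uniq J /\ (forall i, i \in J -> W i).

Definition gens (J : seq (int * X)) : seq int := undup [seq i.1 | i <- J].

Lemma sum_gens (J : seq (int * X)) (f : int * X -> R) :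
  \sum_(i <- J) f i = \sum_(k <- gens J) \sum_(i <- J | i.1 == k) f i.
Proof. exact: sum_by_key. Qed.

(** The cubes of one generation are disjoint, so at most one term is nonzero at [x]. *)
Lemma gen_sum_le (J : seq (int * X)) k x (f : int * X -> R) M :
  windices J -> 0 <= M ->
  (forall i, i \in J -> i.1 = k -> Q i x -> f i <= M) ->
  \sum_(i <- J | i.1 == k) \1_(Q i) x * f i <= M.
Proof.
move=> [uJ WJ] M0 fM.
have [[i iJ [ik Qi]]|nex] :=
  pselect (exists2 i, i \in J & i.1 = k /\ Q i x).
  rewrite big_mkcond (bigD1_seq i)//= ik eqxx.
  rewrite big1_seq => [|j /andP[ji jJ]].
    by rewrite addr0 indicE mem_set// mul1r fM.
  case: ifP => // /eqP jk; rewrite indicE memNset ?mul0r// => Qj.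
  by move/eqP: ji; apply; apply: (cube_inj (WJ _ jJ) (WJ _ iJ) _ Qj Qi); rewrite jk.
rewrite big1_seq// => i /andP[/eqP ik iJ]; rewrite indicE memNset ?mul0r//.
by move=> Qi; apply: nex; exists i.
Qed.

Lemma measurable_cube_indic i : W i ->
  measurable_fun setT (\1_(Q i) : X -> R).
Proof. by move=> Wi; apply/measurable_indic/wav_cube_measurable. Qed.

Lemma integral_cube i : W i -> (\int[mu S]_x (\1_(Q i) x)%:E = (cubem i)%:E)%E.
Proof.
move=> Wi; rewrite integral_indic ?setIT//; last exact: wav_cube_measurable.
exact: mu_cubeE.
Qed.

Lemma integral_cube_sum (J : seq (int * X)) (P : pred (int * X))
    (f : int * X -> R) :
  (forall i, i \in J -> W i) -> (forall i, 0 <= f i) ->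
  (\int[mu S]_x (\sum_(i <- J | P i) \1_(Q i) x * f i)%:E =
   (\sum_(i <- J | P i) cubem i * f i)%:E)%E.
Proof.
move=> WJ f0; rewrite -sumEFin.
under eq_integral do rewrite -big_filter.
rewrite -big_filter integral_sumr.
- rewrite big_seq [RHS]big_seq; apply: eq_bigr => i.
  rewrite mem_filter => /andP[_ /WJ Wi].
  under eq_integral do rewrite mulrC.
  rewrite integralZr_ge0//; last exact: measurable_cube_indic.
  by rewrite integral_cube// -EFinM mulrC.
- move=> i; rewrite mem_filter => /andP[_ /WJ Wi].
  by apply: measurable_funM => //; exact: measurable_cube_indic.
- by move=> i x _; rewrite mulr_ge0// indicE ler0n.
Qed.

(* Discrete form of [integral_reldist]: the cubes of one generation tile [X]. *)
Lemma sum_wvol_reldist N : (decayN S <= N)%N ->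
  exists2 C, 0 < C & forall (J : seq (int * X)) k rho z, windices J ->
    del ^ k <= rho ->
    \sum_(i <- J | i.1 == k) wvol i * E rho i.2 z ^- N <= C * V rho z.
Proof.
move=> hN; have [Cm Cm1 hCm] := cubem_wvol.
have Cm0 := lt_le_trans ltr01 Cm1.
pose a : R := (A * (1 + C1 S)) ^+ N.
have a0 : 0 < a by rewrite exprn_gt0// mulr_gt0 ?A0_gt0// addr_gt0// C1_gt0.
exists (Cm * (a * 2 ^+ (decayN S).+1)); first by rewrite !mulr_gt0// exprn_gt0.
move=> J k rho z [uJ WJ] kr.
have r0 : 0 < rho by apply: lt_le_trans kr; rewrite exprz_gt0// delta_gt0.
have Ep x y : 0 < E rho x y by exact: reldist_gt0.
apply: (@le_trans _ _ (Cm * \sum_(i <- J | i.1 == k) cubem i * E rho i.2 z ^- N)).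
  rewrite mulr_sumr big_seq_cond [leRHS]big_seq_cond.
  apply: ler_sum => i /andP[/WJ/hCm[h _] _].
  by rewrite mulrA ler_pM2r// invr_gt0 exprn_gt0.
rewrite -mulrA ler_pM2l// -lee_fin -integral_cube_sum//; last first.
  by move=> i; rewrite invr_ge0 exprn_ge0// ltW.
apply: (@le_trans _ _ (\int[mu S]_x (a * E rho x z ^- N)%:E)%E).
  apply: le_integral_ge0.
  - apply: measurable_sum_seq => i /WJ Wi.
    by apply: measurable_funM => //; exact: measurable_cube_indic.
  - apply: measurable_funM => //.
    under eq_fun do rewrite reldist_sym; exact: measurable_reldist_expN.
  - move=> x; rewrite sumr_ge0// => i _.
    by rewrite mulr_ge0 ?indicE ?ler0n// invr_ge0 exprn_ge0// ltW.
  - move=> x; apply: gen_sum_le => //.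
      by rewrite mulr_ge0 ?ltW// invr_gt0 exprn_gt0.
    move=> i /WJ Wi ik Qx; apply: (le_trans (reldist_inv_tri S N x _ z r0)).
    rewrite ler_pM2r ?invr_gt0 ?exprn_gt0//.
    apply: lerXn2r; rewrite ?nnegrE.
    + by rewrite mulr_ge0 ?ltW ?A0_gt0.
    + by rewrite mulr_ge0 ?ltW ?A0_gt0// addr_gt0// C1_gt0.
    + by rewrite ler_pM2l ?A0_gt0// (cube_reldist Wi Qx)// /wscale ik.
rewrite integralZr_ge0 ?(ltW a0)//.
- rewrite -mulrA [leRHS]EFinM lee_pmul2l ?lte_fin//.
  exact: integral_reldist.
- under eq_fun do rewrite reldist_sym; exact: measurable_reldist_expN.
- by move=> x; rewrite invr_ge0 exprn_ge0// ltW.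
Qed.

(** The volumes of the preceding sum are divided out. Exchanging the volume around [i.2] for the one
    around [z] costs [dimN] powers of the decay, whence the larger exponent. *)
Lemma sum_reldist N : (decayN S + dimN S <= N)%N ->
  exists2 C, 0 < C & forall (J : seq (int * X)) k z, windices J ->
    \sum_(i <- J | i.1 == k) E (del ^ k) i.2 z ^- N <= C.
Proof.
move=> hN; have [C C0 hC] := sum_wvol_reldist (leqnn (decayN S)).
have A0p := A0_gt0 S; have K0 := Cmu_gt0 S.
exists (K * A ^+ dimN S * C); first by rewrite !mulr_gt0 ?exprn_gt0.
move=> J k z WJ; have r0 : 0 < del ^ k by rewrite exprz_gt0// delta_gt0.
rewrite -(ler_pM2l (vol_gt0 S z r0)) [leRHS]mulrC -[leRHS]mulrA.
apply: le_trans (ler_wpM2l _ (hC J k _ z WJ (lexx _))); last first.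
  by rewrite mulr_ge0 ?exprn_ge0// ltW.
rewrite !mulr_sumr; apply: ler_sum => i /eqP ik.
have Ep : 0 < E (del ^ k) i.2 z by exact: reldist_gt0.
apply: (@le_trans _ _ (K * (A * E (del ^ k) z i.2) ^+ dimN S * V (del ^ k) i.2 *
    E (del ^ k) i.2 z ^- (decayN S + dimN S))).
  apply: ler_pM; rewrite ?vol_ge0 ?invr_ge0 ?exprn_ge0 ?(ltW Ep) ?vol_change//.
  exact: reldist_expN_anti.
rewrite /wvol /wscale ik exprMn reldist_sym exprD invfM le_eqVlt; apply/orP; left.
by apply/eqP; field; rewrite !expf_neq0 ?gt_eqF.
Qed.

Lemma sum_wvol_sub : exists2 C, 0 < C & forall (J : seq (int * X)) k g,
  windices J -> W g -> (forall i, i \in J -> i.1 = k -> Q i `<=` Q g) ->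
  \sum_(i <- J | i.1 == k) wvol i <= C * cubem g.
Proof.
have [Cm Cm1 hCm] := cubem_wvol; have Cm0 := lt_le_trans ltr01 Cm1.
exists Cm => // J k g WJ Wg sub.
apply: (@le_trans _ _ (Cm * \sum_(i <- J | i.1 == k) cubem i * 1)).
  rewrite mulr_sumr big_seq_cond [leRHS]big_seq_cond.
  by apply: ler_sum => i /andP[/(proj2 WJ)/hCm[h _] _]; rewrite mulr1.
rewrite ler_pM2l// -lee_fin -integral_cube_sum//; last by case: WJ.
rewrite -integral_cube//; apply: le_integral_ge0.
- apply: measurable_sum_seq => i /(proj2 WJ) Wi.
  by apply: measurable_funM => //; exact: measurable_cube_indic.
- exact: measurable_cube_indic.
- by move=> x; rewrite sumr_ge0// => i _; rewrite mulr1 indicE ler0n.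
- move=> x; apply: gen_sum_le => //.
  by move=> i iJ ik Qx; rewrite indicE mem_set//; exact: (sub i).
Qed.

End Grid.

#[global] Hint Resolve delta_gt0 wscale_gt0 wvol_gt0 c1_gt0 C1_gt0 cubem_gt0 : pos.

(** * Almost diagonal matrices *)

Section AlmostDiagonal.
Context (R : realType) (disp : measure_display) (X : measurableType disp).
Variables (S : sht R X).
Local Notation E := (reldist S).

(** Rows are indexed by [D'], columns by [D]. In both cases the ratios are those of the finer index
    to the coarser one, and distances are measured at the coarser scale; the square root reflects
    the normalization of the wavelets in L^2. *)
Definition almost_diagonal (D D' : reference_grid S) (eta : R) (N : nat)
    (a : int * X -> int * X -> R) := exists2 C, 0 < C &
  forall j i, wav_index D' j -> wav_index D i ->
  [/\ 0 <= a j i,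
    wscale D i <= wscale D' j ->
      a j i <= C * (wscale D i / wscale D' j) `^ eta *
        Num.sqrt (wvol D i / wvol D' j) * E (wscale D' j) i.2 j.2 ^- N
  & wscale D' j <= wscale D i ->
      a j i <= C * (wscale D' j / wscale D i) `^ eta *
        Num.sqrt (wvol D' j / wvol D i) * E (wscale D i) i.2 j.2 ^- N].

Lemma almost_diagonal_tr D D' eta N a : almost_diagonal D D' eta N a ->
  almost_diagonal D' D eta N (fun i j => a j i).
Proof.
move=> [C C0 H]; exists C => // j i Wj Wi; have [a0 h1 h2] := H i j Wi Wj.
by split => //; rewrite reldist_sym.
Qed.

(** The row is tested against the square roots of the volumes. In a generation finer than [j] the
    terms become volumes times decay, a Riemann sum for the integral of the decay; in a coarser one
    the volumes cancel and only the decay is summed. Both leave a power of the scale ratio, summable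
    over generations. *)
Lemma schur_row D D' eta N a : (decayN S + dimN S <= N)%N -> 0 < eta ->
  almost_diagonal D D' eta N a ->
  exists2 C, 0 < C & forall J j, windices D J -> wav_index D' j ->
    \sum_(i <- J) a j i * Num.sqrt (wvol D i) <= C * Num.sqrt (wvol D' j).
Proof.
move=> hN eta0 [C C0 aC].
have hN' : (decayN S <= N)%N by rewrite (leq_trans _ hN)// leq_addr.
have [C1 C10 H1] := sum_wvol_reldist D hN'.
have [C2 C20 H2] := sum_reldist D hN.
have d01 : 0 < delta D < 1 by rewrite delta_gt0 delta_lt1.
have [C3 C30 H3] := sum_minratio d01 eta0.
exists (C * (C1 + C2) * C3); first by rewrite !mulr_gt0// addr_gt0.
move=> J j WJ Wj; have vj := wvol_gt0 D' j; have sj := wscale_gt0 D' j.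
pose w : R := Num.sqrt (wvol D' j).
have w0 : 0 < w by rewrite sqrtr_gt0.
apply: (@le_trans _ _ (\sum_(k <- gens J) C * (C1 + C2) * w *
    minratio (delta D ^ k) (wscale D' j) `^ eta)); last first.
  rewrite -mulr_sumr -[leRHS]mulrA [C3 * _]mulrC mulrA.
  by rewrite ler_pM2l ?mulr_gt0 ?addr_gt0// H3// undup_uniq.
rewrite sum_gens; apply: ler_sum => k _.
pose m := minratio (delta D ^ k) (wscale D' j) `^ eta; rewrite -/m.
have m0 : 0 <= m by exact: powR_ge0.
have dk : 0 < delta D ^ k by rewrite exprz_gt0// delta_gt0.
have [kj|/ltW kj] := leP (delta D ^ k) (wscale D' j).
  apply: (@le_trans _ _ (\sum_(i <- J | i.1 == k)
      C * m / w * (wvol D i * E (wscale D' j) i.2 j.2 ^- N))).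
    rewrite big_seq_cond [leRHS]big_seq_cond.
    apply: ler_sum => i /andP[/(proj2 WJ) Wi /eqP ik].
    have [_ + _] := aC j i Wj Wi; rewrite /wscale ik => /(_ kj) h.
    have vi := wvol_gt0 D i.
    apply: (le_trans (ler_wpM2r (sqrtr_ge0 _) h)).
    rewrite /m minratio_le// sqrtrM ?(ltW vi)// sqrtrV ?(ltW vj)// -/w.
    have := sqr_sqrtr (ltW vi); set v := Num.sqrt (wvol D i) => <-.
    by rewrite le_eqVlt; apply/orP; left; apply/eqP; rewrite expr2 /wscale; ring.
  rewrite -mulr_sumr; apply: (le_trans (ler_wpM2l _ (H1 J k _ j.2 WJ kj))).
    by rewrite !mulr_ge0 ?invr_ge0 ?(ltW C0) ?(ltW w0).
  rewrite -/(wvol D' j) -(sqr_sqrtr (ltW vj)) -/w.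
  rewrite (_ : C * m / w * _ = C * C1 * w * m); last by field; rewrite gt_eqF.
  by rewrite ler_wpM2r// ler_pM2r// ler_pM2l// lerDl ltW.
apply: (@le_trans _ _ (\sum_(i <- J | i.1 == k)
      C * m * w * E (delta D ^ k) i.2 j.2 ^- N)).
  rewrite big_seq_cond [leRHS]big_seq_cond.
  apply: ler_sum => i /andP[/(proj2 WJ) Wi /eqP ik].
  have [_ _] := aC j i Wj Wi; rewrite {1 2}/wscale ik => /(_ kj) h.
  have vi := wvol_gt0 D i.
  apply: (le_trans (ler_wpM2r (sqrtr_ge0 _) h)).
  rewrite /m minratioC minratio_le// sqrtrM ?(ltW vj)// sqrtrV ?(ltW vi)// -/w.
  have v0 : 0 < Num.sqrt (wvol D i) by rewrite sqrtr_gt0.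
  rewrite /wscale ik le_eqVlt; apply/orP; left.
  by apply/eqP; field; rewrite ?expf_neq0 ?gt_eqF// reldist_gt0.
rewrite -mulr_sumr; apply: (le_trans (ler_wpM2l _ (H2 J k j.2 WJ))).
  by rewrite !mulr_ge0 ?(ltW C0) ?(ltW w0).
rewrite (_ : C * m * w * _ = C * C2 * w * m); last by ring.
by rewrite ler_wpM2r// ler_pM2r// ler_pM2l// lerDr ltW.
Qed.

(** The same square roots of volumes serve as weights on both sides; almost diagonal matrices are
    stable under transposition, which supplies the column bound. *)
Lemma schur_test D D' eta N a : (decayN S + dimN S <= N)%N -> 0 < eta ->
  almost_diagonal D D' eta N a ->
  exists2 C, 0 < C & forall J L t, windices D J -> windices D' L ->
    (forall i, 0 <= t i) ->
    \sum_(j <- L) (\sum_(i <- J) a j i * t i) ^+ 2 <=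
      C * \sum_(i <- J) t i ^+ 2.
Proof.
move=> hN eta0 ad; have [C C0 H] := schur_row hN eta0 ad.
have [C' C'0 H'] := schur_row hN eta0 (almost_diagonal_tr ad).
have [Ca Ca0 Ha] := ad.
exists (C * C'); first exact: mulr_gt0.
move=> J L t WJ WL t0.
pose w i := Num.sqrt (wvol D i); pose w' i := Num.sqrt (wvol D' i).
have w0 i : 0 < w i by rewrite sqrtr_gt0 wvol_gt0.
have w'0 i : 0 < w' i by rewrite sqrtr_gt0 wvol_gt0.
apply: (@le_trans _ _ (\sum_(j <- L) C * w' j *
    \sum_(i <- J) a j i * (t i ^+ 2 / w i))).
  rewrite big_seq [leRHS]big_seq; apply: ler_sum => j /(proj2 WL) Wj.
  have a0 i : i \in J -> 0 <= a j i by move=> /(proj2 WJ) /(Ha j i Wj)[].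
  apply: (@le_trans _ _ ((\sum_(i <- J) a j i * w i) *
      \sum_(i <- J) a j i * (t i ^+ 2 / w i))).
    apply: cauchy_schwarz_sum => i iJ; have a0' := a0 i iJ; have wi := w0 i.
    have ti : 0 <= t i ^+ 2 / w i by rewrite divr_ge0 ?sqr_ge0 ?ltW.
    split; [exact: mulr_ge0 a0' (ltW wi)|exact: mulr_ge0|exact: mulr_ge0|].
    rewrite le_eqVlt; apply/orP; left; apply/eqP; field.
    by rewrite gt_eqF.
  rewrite ler_wpM2r ?H// big_seq sumr_ge0// => i iJ.
  by rewrite mulr_ge0 ?a0// divr_ge0 ?sqr_ge0 ?ltW.
under eq_bigr do rewrite mulr_sumr.
rewrite exchange_big/= mulr_sumr big_seq [leRHS]big_seq.
apply: ler_sum => i /(proj2 WJ) Wi.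
rewrite (eq_bigr (fun j => C * (t i ^+ 2 / w i) * (a j i * w' j))); last first.
  by move=> j _; ring.
rewrite -mulr_sumr; have h := H' L i WL Wi.
apply: (le_trans (ler_wpM2l _ h)).
  by rewrite mulr_ge0 ?divr_ge0 ?sqr_ge0 ?ltW.
rewrite -/(w i) le_eqVlt; apply/orP; left; apply/eqP; field.
by rewrite gt_eqF.
Qed.

Lemma vol_dist_le rho s x : 0 < s -> 0 < rho ->
  vol S rho x <= Cmu S * (1 + rho / s) ^+ dimN S * vol S s x.
Proof.
move=> s0 r0; have P1 : 1 <= 1 + rho / s by rewrite lerDl divr_ge0 ?ltW.
apply: le_trans (vol_scale S x P1 s0); apply: vol_mono => //.
by rewrite mulrDl mul1r divfK ?gt_eqF// lerDr ltW.
Qed.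

(** * Matrix entries seen from a point far from an atom *)

Section FarPair.
Variables (D D' : reference_grid S) (g i j : int * X) (x : X).
Hypotheses (Wg : wav_index D g) (Wi : wav_index D i) (Wj : wav_index D' j).
Hypothesis sub : wav_cube D i `<=` wav_cube D g.
Hypothesis Qx : wav_cube D' j x.
Let rho := dist S x g.2.
Hypothesis far : 2 * A0 S * C1 S * wscale D g <= rho.

Let b : R := A0 S * (1 + C1 S).
Let c : R := 2 * A0 S * b.
Let n := dimN S.

Let b_gt0 : 0 < b. Proof. by rewrite /b; pos. Qed.
Let c_gt0 : 0 < c. Proof. by rewrite /c; pos. Qed.

Lemma far_scale : wscale D g <= rho.
Proof.
have A1 := A0_ge1 S; have C11 := C1_ge1 S.
apply: le_trans far; rewrite ler_peMl//; first by pos.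
by rewrite mulr_ege1// mulr_ege1//; lra.
Qed.

Let rho_gt0 : 0 < rho. Proof. by apply: lt_le_trans far_scale; pos. Qed.

Lemma far_reldist_sub s : 0 < s -> wscale D' j <= s ->
  E s x i.2 <= b * E s i.2 j.2.
Proof.
move=> s0 js; apply: (le_trans (reldist_tri S x j.2 i.2 s0)).
rewrite [E s j.2 _]reldist_sym ler_pM2r; last by pos.
by rewrite /b ler_pM2l; [exact: (cube_reldist Wj)|pos].
Qed.

(** The center of [i] is within [C1 S * wscale D g] of that of [g], and the assumption on [rho]
    makes [A0] times this distance at most rho/2. Hence [x] is at distance at least rho/(2 A0) from
    [i.2]. *)
Lemma far_reldist s : 0 < s -> wscale D' j <= s ->
  1 + rho / s <= c * E s i.2 j.2.
Proof.
move=> s0 js; have A1 := A0_ge1 S; have C11 := C1_ge1 S.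
have e1 : 1 + rho / s <= 2 * A0 S * E s x i.2.
  rewrite /reldist mulrDr mulr1; apply: lerD; first by lra.
  rewrite mulrA ler_pM2r ?invr_gt0//.
  have h1 := dist_quasi S x g.2 i.2.
  have h2 := cube_sub_ball Wg (sub (cube_center Wi)); rewrite /qball /= in h2.
  have h3 : A0 S * dist S i.2 g.2 <= A0 S * (C1 S * wscale D g).
    by rewrite ler_pM2l ?A0_gt0// dist_sym ltW.
  move: far h1 h3; rewrite -/rho mulrDr -!mulrA.
  by move: (A0 S * dist S x i.2) (A0 S * dist S i.2 g.2) (A0 S * (_ * _)) => *; lra.
apply: (@le_trans _ _ (2 * A0 S * (b * E s i.2 j.2))); last by rewrite /c mulrA.
by apply: (le_trans e1); rewrite ler_pM2l; [exact: far_reldist_sub|pos].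
Qed.

Let c3 : R := Cmu S * c ^+ n * (Cmu S * (A0 S * b) ^+ n).

(** Of the 2N powers of decay, 4n pay for exchanging [v] for the volume of the ball of radius [rho]
    around [x], 2n for each of the two factors, and 4 are kept as decay in rho/s; hence 2n + 2 <=
    N. *)
Lemma far_vol s v N : (2 * n + 2 <= N)%N ->
  0 < s -> wscale D' j <= s -> 0 < v ->
  vol S s x <= Cmu S * (A0 S * b) ^+ n * E s i.2 j.2 ^+ n * v ->
  v ^- 2 * E s i.2 j.2 ^- (2 * N) <=
    c3 ^+ 2 * c ^+ 4 * (vol S rho x ^- 2 * (1 + rho / s) ^- 4).
Proof.
move=> hN s0 js v0 hv; have Pe := far_reldist s0 js.
have e1 : 1 <= E s i.2 j.2 by exact: reldist_ge1.
have vr : 0 < vol S rho x by pos.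
have P0 : 0 < 1 + rho / s by pos.
move: hv Pe e1; set e := E s i.2 j.2; set P := 1 + rho / s in P0 *.
move=> hv Pe e1; have e0 : 0 < e by lra.
have hV : vol S rho x <= c3 * e ^+ (2 * n) * v.
  apply: (le_trans (vol_dist_le x s0 rho_gt0)).
  apply: (@le_trans _ _ (Cmu S * (c * e) ^+ n *
      (Cmu S * (A0 S * b) ^+ n * e ^+ n * v))).
    apply: ler_pM => //; [pos|pos|].
    by rewrite ler_pM2l; [apply: lerXn_le => //; pos|pos].
  by apply: eqle; rewrite /c3 !exprMn mul2n -addnn exprD; ring.
rewrite -!invfM; apply: inv_le_scale; [pos|pos|].
apply: (@le_trans _ _ ((c3 * e ^+ (2 * n) * v) ^+ 2 * (c * e) ^+ 4)).
  by apply: ler_pM; [pos|pos|apply: lerXn_le => //; pos|apply: lerXn_le => //; pos].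
have c30 : 0 < c3 by rewrite /c3; pos.
apply: (@le_trans _ _ (c3 ^+ 2 * c ^+ 4 * (v ^+ 2 * e ^+ (4 * n + 4)))).
  have -> : e ^+ (4 * n + 4) = (e ^+ (2 * n)) ^+ 2 * e ^+ 4.
    by rewrite -exprM -exprD [(2 * n * 2)%N]mulnC mulnA.
  by apply: eqle; ring.
rewrite ler_pM2l; last by pos.
rewrite ler_pM2l; last by pos.
rewrite ler_weXn2l// (_ : 4 * n + 4 = 2 * (2 * n + 2))%N ?leq_mul2l//.
by rewrite mulnDr mulnA.
Qed.

End FarPair.

(** The factor (l/rho)^eta, [l] the scale of [g], is what makes the image of an atom small at
    distance [rho]. It is extracted from the scale ratio of the entry and the decay (1 + rho/s)^-2,
    [s] the larger scale, so that what remains is summable over both generations. The two summands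
    on the right belong to the case where [j] is coarser and to the case where [i] is coarser. *)
Lemma far_pair D D' eta N a : (2 * dimN S + 2 <= N)%N -> 0 < eta <= 1 ->
  almost_diagonal D D' eta N a ->
  exists2 C, 0 < C & forall g i j x, wav_index D g -> wav_index D i ->
    wav_index D' j -> g.1 <= i.1 -> wav_cube D i `<=` wav_cube D g ->
    wav_cube D' j x -> 2 * A0 S * C1 S * wscale D g <= dist S x g.2 ->
    a j i ^+ 2 / cubem D' j <= C * wvol D i *
      (((wscale D g / dist S x g.2) `^ eta) ^+ 2 * vol S (dist S x g.2) x ^- 2) *
      (((minratio (wscale D i) (wscale D g) *
         minratio (wscale D' j) (dist S x g.2)) `^ eta) ^+ 2 +
       ((minratio (wscale D' j) (wscale D i) *
         minratio (wscale D i) (dist S x g.2)) `^ eta) ^+ 2).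
Proof.
move=> hN eta01 [C C0 aC].
have [Cm Cm1 hCm] := cubem_wvol D'; have Cm0 := lt_le_trans ltr01 Cm1.
have A1 := A0_ge1 S; have A0p := A0_gt0 S; have K0 := Cmu_gt0 S.
have C10 := C1_gt0 S.
pose b : R := A0 S * (1 + C1 S); have b0 : 0 < b by rewrite /b; pos.
pose c : R := 2 * A0 S * b; have c0 : 0 < c by rewrite /c; pos.
pose n := dimN S.
pose c3 : R := Cmu S * c ^+ n * (Cmu S * (A0 S * b) ^+ n).
have c30 : 0 < c3 by rewrite /c3; pos.
exists (C ^+ 2 * Cm * (c3 ^+ 2 * c ^+ 4)); first by pos.
move=> g i j x Wg Wi Wj gi sub Qx far.
have l0 := wscale_gt0 D g; have r0 := wscale_gt0 D i.
have r'0 := wscale_gt0 D' j; have rl := wscale_anti D gi.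
have vi := wvol_gt0 D i; have vj := wvol_gt0 D' j; have mj := cubem_gt0 Wj.
have lrho := far_scale far.
have fv := far_vol Wg Wi Wj sub Qx far hN.
have fr := far_reldist_sub i Wj Qx.
move: far lrho fv; set rho := dist S x g.2.
move: l0 r0 r'0 rl fr.
set l := wscale D g; set r := wscale D i; set r' := wscale D' j.
move=> l0 r0 r'0 rl fr far lrho fv; have rho0 : 0 < rho by lra.
have vrho : 0 < vol S rho x by pos.
have P1 s : 0 < s -> 1 <= 1 + rho / s.
  by move=> s0; rewrite lerDl; pos.
have mrho s : 0 < s -> 0 <= minratio s rho.
  by move=> s0; apply/ltW/minratio_gt0.
have mpos (s s' : R) : 0 < s -> 0 < s' -> 0 <= minratio s s'.
  by move=> s0 s'0; apply/ltW/minratio_gt0.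
(* [s] is the larger of the two scales, [q] their ratio and [v] the volume of
   the corresponding ball *)
have main s q v m : 0 < s -> 0 < v -> 0 <= q -> 0 <= m ->
    a j i ^+ 2 / cubem D' j <= C ^+ 2 * Cm * (q `^ eta) ^+ 2 * wvol D i *
      (v ^- 2 * E s i.2 j.2 ^- (2 * N)) ->
    v ^- 2 * E s i.2 j.2 ^- (2 * N) <=
      c3 ^+ 2 * c ^+ 4 * (vol S rho x ^- 2 * (1 + rho / s) ^- 4) ->
    q * (1 + rho / s) ^- 2 <= (l / rho) * m ->
    a j i ^+ 2 / cubem D' j <= C ^+ 2 * Cm * (c3 ^+ 2 * c ^+ 4) * wvol D i *
      (((l / rho) `^ eta) ^+ 2 * vol S rho x ^- 2) * (m `^ eta) ^+ 2.
  move=> s0 v0 q0 m0 h1 h2 h3; apply: (le_trans h1).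
  have k0 : 0 <= C ^+ 2 * Cm * (q `^ eta) ^+ 2 * wvol D i by pos.
  apply: (le_trans (ler_wpM2l k0 h2)).
  rewrite [leLHS](_ : _ = C ^+ 2 * Cm * (c3 ^+ 2 * c ^+ 4) * wvol D i *
    vol S rho x ^- 2 * ((q `^ eta) * (1 + rho / s) ^- 2) ^+ 2); last first.
    rewrite -(exprVn (1 + rho / s) 4) -(exprVn (1 + rho / s) 2).
    set z := (1 + rho / s)^-1; set y := vol S rho x ^- 2.
    by rewrite (_ : z ^+ 4 = (z ^+ 2) ^+ 2); [ring|rewrite -exprM].
  rewrite [leRHS](_ : _ = C ^+ 2 * Cm * (c3 ^+ 2 * c ^+ 4) * wvol D i *
    vol S rho x ^- 2 * ((l / rho) `^ eta * m `^ eta) ^+ 2); last by ring.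
  apply: ler_wpM2l; first by pos.
  apply: lerXn_le; first by pos.
  by rewrite -powRM//; [apply: powR_decay => //; exact: P1|pos].
have sq q s v : 0 <= q -> 0 < s -> 0 < v ->
    a j i <= C * q `^ eta * Num.sqrt v * E s i.2 j.2 ^- N ->
    a j i ^+ 2 <= C ^+ 2 * (q `^ eta) ^+ 2 * v * E s i.2 j.2 ^- (2 * N).
  move=> q0 s0 v0 h; have [a0 _ _] := aC j i Wj Wi.
  apply: (le_trans (lerXn_le 2 a0 h)).
  rewrite !exprMn sqr_sqrtr ?(ltW v0)// exprVn -exprM [(N * 2)%N]mulnC.
  exact: lexx.
have [_ h1 h2] := aC j i Wj Wi; have [hv hv'] := hCm j Wj.
have Z0 : 0 <= C ^+ 2 * Cm * (c3 ^+ 2 * c ^+ 4) * wvol D i *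
      (((l / rho) `^ eta) ^+ 2 * vol S rho x ^- 2) by pos.
have divj y : 0 <= y -> y * wvol D' j / cubem D' j <= Cm * y.
  by move=> y0; rewrite ler_pdivrMr// mulrAC [leRHS]mulrC ler_wpM2l.
have en s : 0 < s -> 0 < E s i.2 j.2 by move=> s0; pos.
have [rr'|/ltW r'r] := leP r r'.
  rewrite mulrDr -[leLHS]addr0; apply: lerD; last by pos.
  apply: (main r' (r / r') (wvol D' j)) => //; first by pos.
  - by apply: mulr_ge0; [exact: mpos|exact: mrho].
  - have hs : 0 <= r / r' by pos.
    have hvv : 0 < wvol D i / wvol D' j by pos.
    have := sq _ _ _ hs r'0 hvv (h1 rr').
    rewrite -(ler_pM2r (_ : 0 < (cubem D' j)^-1)) ?invr_gt0// => /le_trans; apply.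
    have en' := en _ r'0.
    set e := E r' i.2 j.2 ^- (2 * N); have e0 : 0 < e by rewrite /e; pos.
    pose y := C ^+ 2 * ((r / r') `^ eta) ^+ 2 * wvol D i * (wvol D' j ^- 2 * e).
    rewrite [leLHS](_ : _ = y * wvol D' j / cubem D' j); last first.
      by rewrite /y; field; rewrite ?gt_eqF.
    rewrite [leRHS](_ : _ = Cm * y); last by rewrite /y; ring.
    by apply: divj; rewrite /y; pos.
  - apply: fv => //; apply: (le_trans (vol_change S x j.2 r'0)).
    have e1 := reldist_ge1 S i.2 j.2 r'0.
    rewrite ler_pM2r// -mulrA ler_pM2l//.
    apply: (@le_trans _ _ ((A0 S * b) ^+ n)).
      apply: lerXn_le; first by pos.
      have := cube_reldist Wj Qx (lexx r') => /= hh.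
      rewrite ler_pM2l// (le_trans hh)// /b ler_peMl//; pos.
    by rewrite ler_peMr ?exprn_ege1//; pos.
  - have [i1 i2] := inv_sq_decay rho0 r'0.
    rewrite minratio_le//.
    rewrite (_ : l / rho * _ = r / r' * (r' / rho * minratio r' rho)); last first.
      by field; rewrite !gt_eqF.
    rewrite ler_pM2l; last by pos.
    rewrite /minratio minr_pMr; last by pos.
    rewrite le_min -expr2 i1/= (_ : r' / rho * (rho / r') = 1)//.
    by field; rewrite !gt_eqF.
rewrite mulrDr -[leLHS]add0r; apply: lerD; first by pos.
apply: (main r (r' / r) (wvol D i)) => //; first by pos.
- by apply: mulr_ge0; [exact: mpos|exact: mrho].
- have hs : 0 <= r' / r by pos.
  have hvv : 0 < wvol D' j / wvol D i by pos.
  have := sq _ _ _ hs r0 hvv (h2 r'r).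
  rewrite -(ler_pM2r (_ : 0 < (cubem D' j)^-1)) ?invr_gt0// => /le_trans; apply.
  have en' := en _ r0.
  set e := E r i.2 j.2 ^- (2 * N); have e0 : 0 < e by rewrite /e; pos.
  pose y := C ^+ 2 * ((r' / r) `^ eta) ^+ 2 * wvol D i * (wvol D i ^- 2 * e).
  rewrite [leLHS](_ : _ = y * wvol D' j / cubem D' j); last first.
    by rewrite /y; field; rewrite ?gt_eqF.
  rewrite [leRHS](_ : _ = Cm * y); last by rewrite /y; ring.
  by apply: divj; rewrite /y; pos.
- apply: fv => //; apply: (le_trans (vol_change S x i.2 r0)).
  rewrite ler_pM2r// -mulrA ler_pM2l// -exprMn.
  have ex : 0 < E r x i.2 by pos.
  apply: lerXn_le; first by pos.
  by rewrite -mulrA ler_pM2l//; apply: fr.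
- have [i1 i2] := inv_sq_decay rho0 r0.
  rewrite (minratio_le r'0 r'r) (minratio_le r0 (le_trans rl lrho)).
  rewrite (_ : l / rho * _ = r' / r * (l / rho * (r / rho))); last first.
    by field; rewrite !gt_eqF.
  rewrite ler_pM2l; last by pos.
  apply: (le_trans i1); rewrite expr2 ler_pM2r; last by pos.
  by rewrite ler_pM2r// invr_gt0.
Qed.

(** Cauchy-Schwarz in [i] separates coefficients from entries. Within one generation the volumes of
    the subcubes add up to at most a multiple of the measure of the cube of [g]; over pairs of
    generations the factor from [far_pair] is summable. *)
Lemma far_square D D' eta N a : (2 * dimN S + 2 <= N)%N -> 0 < eta <= 1 ->
  almost_diagonal D D' eta N a ->
  exists2 C, 0 < C & forall g J L t x, windices D J -> windices D' L ->
    wav_index D g ->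
    (forall i, i \in J -> g.1 <= i.1 /\ wav_cube D i `<=` wav_cube D g) ->
    (forall i, 0 <= t i) ->
    2 * A0 S * C1 S * wscale D g <= dist S x g.2 ->
    \sum_(j <- L) \1_(wav_cube D' j) x *
        ((\sum_(i <- J) a j i * t i) ^+ 2 / cubem D' j) <=
      C * (\sum_(i <- J) t i ^+ 2) * cubem D g *
      (((wscale D g / dist S x g.2) `^ eta) ^+ 2 * vol S (dist S x g.2) x ^- 2).
Proof.
move=> hN eta01 ad; have [C C0 H] := far_pair hN eta01 ad.
have [Ca _ Ha] := ad; have [Cs Cs0 Hs] := sum_wvol_sub D.
move/andP: (eta01) => [eta0 _].
have d01 : 0 < delta D < 1 by rewrite delta_gt0 delta_lt1.
have d01' : 0 < delta D' < 1 by rewrite delta_gt0 delta_lt1.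
have [C1 C10 H1] := sum_minratio d01 eta0.
have [C2 C20 H2] := sum_minratio d01' eta0.
exists (C * Cs * (2 * (C1 * C2))); first by pos.
move=> g J L t x WJ WL Wg sub t0 far.
have l0 := wscale_gt0 D g; have lrho := far_scale far.
move: far lrho H; set rho := dist S x g.2 => far lrho H.
have rho0 : 0 < rho by apply: lt_le_trans lrho.
have mg := cubem_gt0 Wg.
set F := ((wscale D g / rho) `^ eta) ^+ 2 * vol S rho x ^- 2.
have F0 : 0 <= F by rewrite /F; pos.
set T := \sum_(i <- J) t i ^+ 2; have T0 : 0 <= T by rewrite /T; pos.
pose G k k' := minratio (delta D ^ k) (wscale D g) `^ eta *
    minratio (delta D' ^ k') rho `^ eta +
  minratio (delta D' ^ k') (delta D ^ k) `^ eta *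
    minratio (delta D ^ k) rho `^ eta.
have dk k : 0 < delta D ^ k by pos.
have dk' k : 0 < delta D' ^ k by pos.
have G0 k k' : 0 <= G k k' by rewrite /G; pos.
apply: (@le_trans _ _ (\sum_(k' <- gens L) T * (\sum_(k <- gens J)
    C * F * G k k' * (Cs * cubem D g)))).
  rewrite sum_gens; apply: ler_sum => k' _; apply: gen_sum_le => //.
    apply: mulr_ge0 => //; apply: sumr_ge0 => k _.
    by have := G0 k k' => ?; pos.
  move=> j /(proj2 WL) Wj jk' Qx.
  have mj := cubem_gt0 Wj.
  have hcs : (\sum_(i <- J) a j i * t i) ^+ 2 <=
      (\sum_(i <- J) a j i ^+ 2) * T.
    apply: cauchy_schwarz_sum => i /(proj2 WJ) Wi.
    have [a0 _ _] := Ha j i Wj Wi; split; [pos|pos|exact: mulr_ge0|].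
    by rewrite exprMn.
  rewrite ler_pdivrMr//; apply: (le_trans hcs).
  rewrite [leLHS]mulrC -mulrA; apply: ler_wpM2l => //.
  rewrite -ler_pdivrMr// mulr_suml sum_gens; apply: ler_sum => k _.
  apply: (@le_trans _ _ (C * F * G k k' * \sum_(i <- J | i.1 == k) wvol D i)).
    rewrite mulr_sumr big_seq_cond [leRHS]big_seq_cond.
    apply: ler_sum => i /andP[iJ /eqP ik].
    have [gi si] := sub i iJ.
    apply: (le_trans (H g i j x Wg (proj2 WJ i iJ) Wj gi si Qx far)).
    rewrite -/F (_ : C * F * G k k' * wvol D i = C * wvol D i * F * G k k'); last by ring.
    apply: ler_wpM2l; first by pos.
    rewrite /G -ik -jk' -!/(wscale _ _); apply: lerD.
      by apply: minratioM_sqr_le; try pos; exact: ltW.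
    by apply: minratioM_sqr_le; try pos; exact: ltW.
  apply: ler_wpM2l; first by have := G0 k k' => ?; pos.
  by apply: Hs => // i iJ _; have [] := sub i iJ.
rewrite -mulr_sumr.
under eq_bigr do rewrite -mulr_suml -mulr_sumr.
rewrite -mulr_suml -mulr_sumr.
rewrite [leLHS](_ : _ = C * Cs * T * cubem D g * F *
  (\sum_(k' <- gens L) \sum_(k <- gens J) G k k')); last by ring.
rewrite [leRHS](_ : _ = C * Cs * T * cubem D g * F * (2 * (C1 * C2))); last by ring.
apply: ler_wpM2l; first by pos.
rewrite exchange_big/= /G; under eq_bigr do rewrite big_split/= -mulr_sumr -mulr_suml.
rewrite big_split/= mulrDl mul1r; apply: lerD.
  rewrite -mulr_suml; apply: ler_pM; [pos|pos| |].
    by apply: H1; rewrite ?undup_uniq.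
  by apply: H2; rewrite ?undup_uniq.
apply: (@le_trans _ _ (\sum_(k <- gens J) C2 * minratio (delta D ^ k) rho `^ eta)).
  apply: ler_sum => k _; apply: ler_wpM2r; first by pos.
  by apply: H2; rewrite ?undup_uniq.
rewrite -mulr_sumr [leRHS]mulrC; apply: ler_wpM2l; first exact: ltW.
by apply: H1; rewrite ?undup_uniq.
Qed.

(** The square of the square function: the root is moved into the exponents, which become p / 2, and
    the case p = 2 is then a plain sum of squares. *)
Definition sqf (D : reference_grid S) (L : seq (int * X)) (b : int * X -> R)
  (x : X) : R := \sum_(j <- L) \1_(wav_cube D j) x * (b j ^+ 2 / cubem D j).

Lemma sqf_ge0 D L b x : windices D L -> 0 <= sqf D L b x.
Proof.
move=> WL; rewrite /sqf big_seq; apply: sumr_ge0 => j /(proj2 WL) Wj.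
by have := cubem_gt0 Wj => m0; apply: mulr_ge0; pos.
Qed.

Lemma measurable_sqf D L b : windices D L -> measurable_fun setT (sqf D L b).
Proof.
move=> WL; apply: measurable_sum_seq => j /(proj2 WL) Wj.
by apply: measurable_funM => //; exact: measurable_cube_indic.
Qed.

Lemma integral_sqf D L b : windices D L ->
  (\int[mu S]_x (sqf D L b x)%:E = (\sum_(j <- L) b j ^+ 2)%:E)%E.
Proof.
move=> WL; pose f j := b j ^+ 2 / `|cubem D j|.
rewrite (eq_integral (fun x => (\sum_(j <- L) \1_(wav_cube D j) x * f j)%:E)).
  rewrite integral_cube_sum; [|exact: (proj2 WL)|by move=> j; rewrite /f; pos].
  congr EFin; rewrite big_seq [RHS]big_seq; apply: eq_bigr => j /(proj2 WL) Wj.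
  have m0 := cubem_gt0 Wj.
  by rewrite /f gtr0_norm// mulrC divfK// gt_eqF.
move=> x _; congr EFin; rewrite /sqf big_seq [RHS]big_seq.
apply: eq_bigr => j /(proj2 WL) Wj.
by rewrite /f gtr0_norm// cubem_gt0.
Qed.

(** With Cmu = 2^omega the left side is 2^(omega (1-q) - eta q), whose exponent is negative exactly
    when q > omega/(omega+eta). *)
Lemma critical_ratio eta q : 0 < eta -> 0 < q ->
  upper_dim S / (upper_dim S + eta) < q ->
  Cmu S `^ (1 - q) * 2^-1 `^ (eta * q) < 1.
Proof.
move=> eta0 q0; have l2 : 0 < ln (2 : R) by rewrite ln_gt0// ltr1n.
have w0 : 0 <= upper_dim S.
  by rewrite divr_ge0 ?(ltW l2)// ln_ge0// Cmu_ge1.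
rewrite ltr_pdivrMr; last by lra.
move=> h; rewrite /powR !gt_eqF ?invr_gt0 ?Cmu_gt0// -expRD expR_lt1 lnV ?posrE//.
have -> : ln (Cmu S) = upper_dim S * ln 2.
  by rewrite /upper_dim divfK// gt_eqF.
have : 0 < (q * (upper_dim S + eta) - upper_dim S) * ln 2.
  by rewrite mulr_gt0// subr_gt0.
by move: (ln 2) => c; lra.
Qed.

Lemma powR_sqr_half (s q : R) : 0 <= s -> (s ^+ 2) `^ (q / 2) = s `^ q.
Proof.
move=> s0; rewrite -powR_mulrn// -powRrM; congr (_ `^ _).
by rewrite mulrC divfK.
Qed.

(** This stands in for Hoelder's inequality on a ball: with [lam] the height of an atom, the first
    term integrates to a multiple of the measure of the ball and the second is controlled by the L^2
    bound. *)
Lemma powR_young (s lam q : R) : 0 <= s -> 0 < lam -> 0 < q <= 2 ->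
  s `^ (q / 2) <= lam `^ q + lam `^ (q - 2) * s.
Proof.
move=> s0 lam0 /andP[q0 q2].
have lamq c : (lam ^+ 2) `^ (c / 2) = lam `^ c by exact/powR_sqr_half/ltW.
have [sl|sl] := leP s (lam ^+ 2).
  rewrite -[leLHS]addr0; apply: lerD; last by pos.
  rewrite -lamq; apply: ge0_ler_powR => //; rewrite ?nnegrE//; last by pos.
  by lra.
have s0' : 0 < s by apply: le_lt_trans sl; pos.
rewrite -[leLHS]add0r; apply: lerD; first by pos.
have -> : s `^ (q / 2) = s `^ ((q - 2) / 2) * s.
  rewrite -[X in _ = _ * X](powRr1 s0) -powRD; first by congr (_ `^ _); lra.
  by rewrite (gt_eqF s0') implybT.
apply: ler_wpM2r => //; rewrite -lamq.
have -> : (q - 2) / 2 = - ((2 - q) / 2) by lra.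
rewrite !powRN lef_pV2 ?posrE; [|pos|pos].
by apply: ge0_ler_powR; rewrite ?nnegrE ?(ltW sl) ?s0//; [lra|pos].
Qed.

Lemma measurable_sqf_powR D L b p : windices D L ->
  measurable_fun setT (fun x => sqf D L b x `^ p).
Proof.
move=> WL; apply: (measurableT_comp (measurable_powR p)).
exact: measurable_sqf.
Qed.

(** [lam] is the height of the atom: the l^2 norm of its coefficients is at most the L^2 norm of the
    constant [lam] on the cube of [g]. The conclusion has the same homogeneity in L^q. *)
Lemma atom_bound D D' eta q N a : (2 * dimN S + 2 <= N)%N ->
  (decayN S + dimN S <= N)%N -> 0 < eta <= 1 -> 0 < q <= 1 ->
  Cmu S `^ (1 - q) * 2^-1 `^ (eta * q) < 1 ->
  almost_diagonal D D' eta N a ->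
  exists2 C, 0 < C & forall g J L t lam, windices D J -> windices D' L ->
    wav_index D g ->
    (forall i, i \in J -> g.1 <= i.1 /\ wav_cube D i `<=` wav_cube D g) ->
    (forall i, 0 <= t i) -> 0 < lam ->
    \sum_(i <- J) t i ^+ 2 <= lam ^+ 2 * cubem D g ->
    (\int[mu S]_x (sqf D' L (fun j => (\sum_(i <- J) a j i * t i)%R) x `^ (q / 2))%:E
      <= (C * lam `^ q * cubem D g)%:E)%E.
Proof.
move=> hN hN' eta01 /andP[q0 q1] kappa1 ad; have /andP[eta0 eta1] := eta01.
have [Cf Cf0 Hf] := far_square hN eta01 ad.
have [Cs Cs0 Hs] := schur_test hN' eta0 ad.
have [Cm Cm1 hCm] := cubem_wvol D; have Cm0 := lt_le_trans ltr01 Cm1.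
have A0p := A0_gt0 S; have A1 := A0_ge1 S; have K0 := Cmu_gt0 S.
have C10 := C1_gt0 S; have C11 := C1_ge1 S.
pose n := dimN S.
pose K1 : R := 2 * A0 S * C1 S.
have K11 : 1 <= K1 by rewrite mulr_ege1// mulr_ege1//; lra.
have K10 : 0 < K1 by lra.
pose c4 : R := Cmu S * K1 ^+ n * Cm.
have c40 : 0 < c4 by rewrite /c4; pos.
(* The 4 comes from 2^m l <= 4 rho on the m-th annulus, the 5 from the inclusion of the ball of
   radius 2^m l around [g.2] in the ball of radius 5 A0 rho around [x]. *)
pose c5 : R := 4 `^ eta * (Cmu S * (5 * A0 S) ^+ n).
have c50 : 0 < c5 by rewrite /c5; pos.
pose kappa := Cmu S `^ (1 - q) * 2^-1 `^ (eta * q).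
have kappa0 : 0 < kappa by rewrite /kappa; pos.
have ik0 : 0 < (1 - kappa)^-1 by rewrite invr_gt0 subr_gt0.
pose H0 := Num.sqrt Cf * c5; have H00 : 0 < H0 by rewrite /H0; pos.
exists (H0 `^ q * Cm `^ (1 - q) * (1 - kappa)^-1 + c4 + Cs).
  by apply: addr_gt0 => //; apply: addr_gt0; pos.
move=> g J L t lam WJ WL Wg sub t0 lam0 tlam.
pose b j := \sum_(i <- J) a j i * t i; rewrite -/b.
have l0 := wscale_gt0 D g; set l := wscale D g in l0.
have mg := cubem_gt0 Wg.
pose Bn := qball (dist S) g.2 (K1 * l).
have mBn : measurable Bn by exact: sht_ball_measurable.
have lamq : 0 < lam `^ q by pos.
have lamq2 : 0 < lam `^ (q - 2) by pos.
have q2 : 0 < q <= 2 by rewrite q0; lra.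
pose f x := sqf D' L b x `^ (q / 2) * \1_(~` Bn) x.
have mf : measurable_fun setT f.
  apply: measurable_funM; first exact: measurable_sqf_powR.
  by apply: measurable_indic; exact: measurableC.
have f0 x : 0 <= f x by rewrite /f; pos.
have hpt x : sqf D' L b x `^ (q / 2) <=
    f x + (lam `^ q * \1_Bn x + lam `^ (q - 2) * sqf D' L b x).
  rewrite /f !indicE; have s0 := sqf_ge0 b x WL.
  have [xB|xB] := pselect (Bn x).
    have -> : (x \in ~` Bn) = false by apply: memNset => /(_ xB).
    by rewrite mem_set// mulr0 add0r mulr1; exact: powR_young.
  rewrite mem_set// memNset// mulr1 mulr0 add0r lerDl.
  by apply: mulr_ge0 => //; exact: ltW.
have m1 : measurable_fun setT (fun x => lam `^ q * \1_Bn x).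
  by apply: measurable_funM => //; exact: measurable_indic.
have m2 : measurable_fun setT (fun x => lam `^ (q - 2) * sqf D' L b x).
  by apply: measurable_funM => //; exact: measurable_sqf.
have p2 x : 0 <= lam `^ (q - 2) * sqf D' L b x.
  by apply: mulr_ge0; [exact: ltW|exact: sqf_ge0].
apply: (le_trans (le_integral_ge0 _ _ _ (fun x => powR_ge0 _ _) hpt)).
- exact: measurable_sqf_powR.
- by apply: measurable_funD => //; exact: measurable_funD.
rewrite integralD_ge0//; last 2 first.
- exact: measurable_funD.
- by move=> x; apply: addr_ge0 => //; pos.
rewrite integralD_ge0//; last by move=> x; pos.
have b0 x : 0 <= \1_Bn x :> R by pos.
have mi : measurable_fun setT (\1_Bn : X -> R) by exact: measurable_indic.
rewrite (integralZr_ge0 _ (ltW lamq) mi b0).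
rewrite (integralZr_ge0 _ (ltW lamq2) (measurable_sqf b WL) (fun x => sqf_ge0 b x WL)).
rewrite integral_sqf// integral_indic// setIT.
have -> : (mu S : {measure set X -> \bar R}) Bn = (vol S (K1 * l) g.2)%:E.
  by apply: mu_ballE; pos.
rewrite -!EFinM -EFinD.
have near1 : lam `^ q * vol S (K1 * l) g.2 <= c4 * lam `^ q * cubem D g.
  rewrite [leRHS](_ : _ = lam `^ q * (c4 * cubem D g)); last by ring.
  rewrite ler_pM2l//; apply: (le_trans (vol_scale S g.2 K11 l0)).
  rewrite [leRHS](_ : _ = Cmu S * K1 ^+ n * (Cm * cubem D g)); last first.
    by rewrite /c4; ring.
  apply: ler_wpM2l; first by pos.
  by have [] := hCm g Wg.
have near2 : lam `^ (q - 2) * (\sum_(j <- L) b j ^+ 2) <= Cs * lam `^ q * cubem D g.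
  apply: (@le_trans _ _ (lam `^ (q - 2) * (Cs * (lam ^+ 2 * cubem D g)))).
    rewrite ler_pM2l//; apply: (le_trans (Hs J L t WJ WL t0)).
    by rewrite ler_pM2l.
  apply: eqle; rewrite (_ : lam `^ q = lam `^ (q - 2) * lam ^+ 2); first by ring.
  rewrite -(powR_mulrn 2 (ltW lam0)) -powRD; first by congr (_ `^ _); lra.
  by rewrite (gt_eqF lam0) implybT.
have far1 : (\int[mu S]_x (f x)%:E <=
    (H0 `^ q * Cm `^ (1 - q) * (1 - kappa)^-1 * lam `^ q * cubem D g)%:E)%E.
  pose Vm m := vol S (2 ^+ m * l) g.2.
  have Vm0 m : 0 < Vm m by rewrite /Vm; pos.
  pose y m := (2 ^+ m)^-1 `^ eta * (Vm m)^-1.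
  have y0 m : 0 < y m by rewrite /y; have := Vm0 m => ?; pos.
  (* The bound on the m-th annulus; times the volume of the ball it is a term of a geometric series
     of ratio [kappa]. *)
  pose am m := (H0 * lam * cubem D g * y m) `^ q.
  apply: (@integral_annuli _ _ _ S f am _ l g.2) => //.
  - by move=> m; rewrite /am; pos.
  - move=> x; have [m dm m2E] := dist_annulus S g.2 x l0; exists m => //.
    rewrite /f indicE; have [xB|xB] := pselect (Bn x).
      have -> : (x \in ~` Bn) = false by apply: memNset => /(_ xB).
      by rewrite mulr0 /am; pos.
    rewrite mem_set// mulr1.
    have far : K1 * l <= dist S x g.2.
      by rewrite dist_sym leNgt; apply/negP => h; apply: xB.
    have lrho := far_scale far; rewrite -/l in lrho.
    have := Hf g J L t x WJ WL Wg sub t0 far.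
    rewrite -/l; set rho := dist S x g.2 in far lrho *.
    have rho0 : 0 < rho by exact: lt_le_trans lrho.
    have vr0 : 0 < vol S rho x by pos.
    have m4 : 2 ^+ m * l <= 4 * rho.
      apply: (le_trans (ler_wpM2r (ltW l0) m2E)).
      rewrite [leLHS](_ : _ = 2 * (l + rho)); first by lra.
      by rewrite /reldist -/rho; field; rewrite gt_eqF.
    have h1 : (l / rho) `^ eta <= 4 `^ eta * (2 ^+ m)^-1 `^ eta.
      have m0 : 0 < (2 ^+ m)^-1 :> R by pos.
      rewrite -powRM ?(ltW m0)//.
      apply: ge0_ler_powR; rewrite ?nnegrE; [exact: ltW|pos|pos|].
      by rewrite ler_pdivrMr// mulrAC ler_pdivlMr ?exprn_gt0// mulrC.
    have h2 : (vol S rho x)^-1 <= (Cmu S * (5 * A0 S) ^+ n) * (Vm m)^-1.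
      apply: inv_le_scale => //; rewrite /Vm.
      have A5 : 1 <= 5 * A0 S by lra.
      apply: le_trans (vol_scale S x A5 rho0); apply: vol_sub; [pos|pos|].
      move=> z /= zg; apply: (le_lt_trans (dist_quasi S x z g.2)).
      rewrite [ltRHS](_ : _ = A0 S * (5 * rho)); last by ring.
      rewrite ltr_pM2l// (_ : 5 * rho = rho + 4 * rho); last by ring.
      by rewrite ltrD2l; exact: lt_le_trans zg m4.
    have h3 : (l / rho) `^ eta * (vol S rho x)^-1 <= c5 * y m.
      apply: (le_trans (ler_pM _ _ h1 h2)); [pos|pos|].
      by apply: eqle; rewrite /c5 /y; ring.
    move=> hsq.
    rewrite /am; have ym := y0 m.
    rewrite -(@powR_sqr_half (H0 * lam * cubem D g * y m)); last by pos.
    apply: ge0_ler_powR; rewrite ?nnegrE; [lra|exact: sqf_ge0|pos|].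
    apply: (le_trans hsq).
    apply: (@le_trans _ _ (Cf * (lam ^+ 2 * cubem D g) * cubem D g * (c5 * y m) ^+ 2)).
      apply: ler_pM; [pos|pos| |].
        by rewrite ler_pM2r// ler_pM2l.
      rewrite -exprVn -exprMn; apply: lerXn_le => //; pos.
    apply: eqle; rewrite /H0 -{1}(sqr_sqrtr (ltW Cf0)); ring.
  - move=> N'; apply: (@le_trans _ _ (\sum_(0 <= m < N') (H0 * lam) `^ q *
        cubem D g `^ q * (wvol D g) `^ (1 - q) * kappa ^+ m)).
      apply: ler_sum => m _; rewrite /am /y /kappa; apply: annulus_term => //.
      - by pos.
      - exact: wvol_gt0.
      - by rewrite q0.
      - exact: vol_pow2.
    rewrite (powRM _ (ltW H00) (ltW lam0)).
    rewrite -mulr_sumr.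
    have hk : \sum_(0 <= m < N') kappa ^+ m <= (1 - kappa)^-1.
      by apply: sum_geom_nat; rewrite ?iota_uniq// (ltW kappa0).
    apply: (le_trans (ler_wpM2l _ hk)); first by pos.
    rewrite [leLHS](_ : _ = H0 `^ q * (1 - kappa)^-1 * lam `^ q *
      (cubem D g `^ q * wvol D g `^ (1 - q))); last by ring.
    rewrite [leRHS](_ : _ = H0 `^ q * (1 - kappa)^-1 * lam `^ q *
      (Cm `^ (1 - q) * cubem D g)); last by ring.
    apply: ler_wpM2l; first by pos.
    have [hv _] := hCm g Wg.
    apply: (@le_trans _ _ (cubem D g `^ q * (Cm * cubem D g) `^ (1 - q))).
      apply: ler_wpM2l; first by pos.
      by apply: ge0_ler_powR; rewrite ?nnegrE//; [lra|pos|pos].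
    rewrite powRM ?(ltW Cm0) ?(ltW mg)// mulrCA -powRD; last first.
      by rewrite (gt_eqF mg) implybT.
    by rewrite (_ : q + (1 - q) = 1) ?powRr1 ?(ltW mg)//; ring.
apply: (@le_trans _ _ (_ + _)%E); first by apply: leeD; [exact: far1|exact: lexx].
rewrite -EFinD lee_fin !mulrDl -addrA; apply: lerD; first exact: lexx.
exact: lerD.
Qed.

End AlmostDiagonal.

(** * Inequalities for powers and for running sums *)

Section PowerSums.
Context (R : realType).

Lemma sum_minkowski (I G : eqType) (L : seq I) (H : seq G) (w : I -> R)
    (b : G -> I -> R) :
  (forall i, i \in L -> 0 <= w i) -> (forall g i, g \in H -> i \in L -> 0 <= b g i) ->
  Num.sqrt (\sum_(i <- L) w i * (\sum_(g <- H) b g i) ^+ 2) <=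
  \sum_(g <- H) Num.sqrt (\sum_(i <- L) w i * b g i ^+ 2).
Proof.
move=> w0; elim: H => [|g H IH] b0.
  rewrite big_nil big1 ?sqrtr0// => i _.
  by rewrite big_nil expr0n/= mulr0.
have b0' h i : h \in H -> i \in L -> 0 <= b h i.
  by move=> hH; apply: b0; rewrite in_cons hH orbT.
rewrite big_cons; apply: le_trans (lerD (lexx _) (IH b0')).
pose c i := \sum_(g <- H) b g i.
have c0 i : i \in L -> 0 <= c i.
  by move=> iL; rewrite /c big_seq; apply: sumr_ge0 => h /b0' ->.
set F := \sum_(i <- L) w i * b g i ^+ 2; set K := \sum_(i <- L) w i * c i ^+ 2.
have bg i : i \in L -> 0 <= b g i by apply: b0; rewrite mem_head.
have F0 : 0 <= F by rewrite /F big_seq; apply: sumr_ge0 => i /w0 ?; pos.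
have K0 : 0 <= K by rewrite /K big_seq; apply: sumr_ge0 => i /w0 ?; pos.
pose M := \sum_(i <- L) w i * (b g i * c i).
have M0 : 0 <= M.
  rewrite /M big_seq; apply: sumr_ge0 => i iL.
  by apply: mulr_ge0; [exact: w0|apply: mulr_ge0; [exact: bg|exact: c0]].
have MFK : M ^+ 2 <= F * K.
  apply: cauchy_schwarz_sum => i iL.
  have wi := w0 i iL; have bi := bg i iL; have ci := c0 i iL.
  by split; [pos|pos|pos|apply: eqle; ring].
have -> : \sum_(i <- L) w i * (\sum_(h <- g :: H) b h i) ^+ 2 = F + 2 * M + K.
  rewrite /F /M /K mulr_sumr -!big_split/=; apply: eq_bigr => i _.
  by rewrite big_cons -/(c i); ring.
rewrite -(@ler_pXn2r _ 2) ?nnegrE ?addr_ge0 ?sqrtr_ge0//.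
rewrite sqr_sqrtr; last by pos.
have MK : M <= Num.sqrt F * Num.sqrt K.
  rewrite -(@ler_pXn2r _ 2) ?nnegrE ?mulr_ge0 ?sqrtr_ge0//.
  by rewrite exprMn !sqr_sqrtr.
by rewrite sqrrD !sqr_sqrtr// mulr2n; lra.
Qed.

(** For a fraction c/(a+b) in [0, 1] the power q <= 1 only increases it; the two fractions add up to
    1. *)
Lemma powR_subadd (a b q : R) : 0 <= a -> 0 <= b -> 0 < q <= 1 ->
  (a + b) `^ q <= a `^ q + b `^ q.
Proof.
move=> a0 b0 /andP[q0 q1]; have [ab0|] := eqVneq (a + b) 0.
  by rewrite ab0 powR0 ?gt_eqF//; pos.
move=> ab; have {ab} ab : 0 < a + b by rewrite lt_def ab addr_ge0.
have key c : 0 <= c <= a + b -> c / (a + b) * (a + b) `^ q <= c `^ q.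
  move=> /andP[c0 cab]; have [->|cn] := eqVneq c 0.
    by rewrite mul0r mul0r; pos.
  have {}c0 : 0 < c by rewrite lt_def cn.
  have -> : c `^ q = (c / (a + b)) `^ q * (a + b) `^ q.
    by rewrite -powRM ?divfK ?gt_eqF//; pos.
  apply: ler_wpM2r; first by pos.
  apply: ger1_powR => //; apply/andP; split; first by pos.
  by rewrite ler_pdivrMr// mul1r.
apply: le_trans (lerD (key a _) (key b _)).
- by rewrite -mulrDl -mulrDl divff ?gt_eqF// mul1r.
- by rewrite a0 lerDl.
- by rewrite b0 lerDr.
Qed.

Lemma powR_sum_le (I : eqType) (s : seq I) (f : I -> R) q : 0 < q <= 1 ->
  (forall i, 0 <= f i) ->
  (\sum_(i <- s) f i) `^ q <= \sum_(i <- s) f i `^ q.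
Proof.
move=> q01 f0; elim: s => [|i s IH].
  by rewrite !big_nil powR0// gt_eqF//; case/andP: q01.
rewrite !big_cons; apply: le_trans (powR_subadd _ _ q01) _ => //.
  by apply: sumr_ge0.
by rewrite lerD2l.
Qed.

Lemma exists_min_seq (I : eqType) (s : seq I) (f : I -> int) i : i \in s ->
  exists2 j, j \in s & forall k, k \in s -> f j <= f k.
Proof.
elim: s i => // i0 s IH i; rewrite in_cons => _.
case: s IH => [|i1 s] IH.
  by exists i0; rewrite ?mem_head// => k; rewrite inE => /eqP ->.
have [j js jmin] := IH i1 (mem_head _ _).
have [h|h] := leP (f i0) (f j).
  exists i0; rewrite ?mem_head// => k; rewrite in_cons => /orP[/eqP->//|/jmin].
  exact: le_trans.
exists j; first by rewrite in_cons js orbT.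
by move=> k; rewrite in_cons => /orP[/eqP->|/jmin//]; exact: ltW.
Qed.

(** A sum of powers of distinct dyadic numbers is comparable to its largest term. *)
Lemma sum_exp2_le (q : R) (s : seq int) (y : R) : 0 < q -> uniq s -> 0 <= y ->
  (forall z, z \in s -> (2 ^ z) <= y) ->
  \sum_(z <- s) (2 ^ z) `^ q <= 2 * (1 - 2 `^ (- q))^-1 * y `^ q.
Proof.
move=> q0 us y0 sy; have r1 : 0 <= (2 : R) `^ (- q) < 1.
  rewrite powR_ge0/= powRN invf_lt1; last by pos.
  have := @ltr_expR R 0 (q * ln 2); rewrite expR0 mulr_gt0 ?ln_gt0 ?ltr1n//.
  by rewrite /powR pnatr_eq0/= => ->.
case: s us sy => [|z0 s'] us sy.
  rewrite big_nil; apply: mulr_ge0; last by pos.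
  by rewrite mulr_ge0// invr_ge0 subr_ge0 ltW//; case/andP: r1.
move: us sy; set s := z0 :: s' => us sy.
have [m' ms mmin] := exists_min_seq (fun z => - z) (mem_head z0 s').
have mmax z : z \in s -> z <= m' by move=> /mmin; lia.
apply: (@le_trans _ _ ((2 ^ m') `^ q *
    \sum_(z <- s) (2 `^ (- q)) ^+ `|z - m'|%N)).
  rewrite mulr_sumr big_seq [leRHS]big_seq; apply: ler_sum => z zs.
  have zE : z = m' - Posz `|z - m'|%N by have := mmax z zs; lia.
  apply: eqle; rewrite {1}zE exprzDr ?unitfE ?pnatr_eq0//.
  rewrite -exprnN powRM; [|pos|pos].
  by rewrite -exprVn powRXn// -(powR_inv1 (_ : 0 <= 2))// -powRrM mulN1r.
rewrite [leRHS]mulrC; apply: ler_pM; [pos|by apply: sumr_ge0 => z _; pos| |].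
  by apply: ge0_ler_powR; rewrite ?nnegrE ?(ltW q0) ?sy//; pos.
exact: sum_geom_int.
Qed.

(** Base 4 because [u] will be a squared quantity: 2^lev is then the dyadic size of its root. *)
Definition lev (u : R) : int := Num.floor (ln u / ln 4).

Lemma lev_spec u : 0 < u -> (2 ^ lev u) ^+ 2 <= u /\ u <= (2 * 2 ^ lev u) ^+ 2.
Proof.
move=> u0; have l2 : 0 < ln (2 : R) by rewrite ln_gt0// ltr1n.
have l4 : ln (4 : R) = 2 * ln 2.
  by rewrite (_ : 4 = 2 ^+ 2)//; [rewrite lnXn ?mulr_natl|rewrite expr2; ring].
have E z : (2 ^ z) ^+ 2 = expR (z%:~R * ln 4) :> R.
  rewrite -powR_intmul// -powR_mulrn ?powR_ge0// -powRrM /powR pnatr_eq0/=.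
  by rewrite l4; congr expR; ring.
have uE : u = expR (ln u / ln 4 * ln 4).
  by rewrite divfK ?l4 ?mulf_neq0 ?gt_eqF// lnK.
have l40 : 0 < ln (4 : R) by rewrite l4; pos.
split; first by rewrite E {2}uE ler_expR ler_pM2r// floor_le.
have -> : 2 * 2 ^ lev u = 2 ^ (lev u + 1) :> R.
  by rewrite exprzDr ?unitfE ?pnatr_eq0// expr1z mulrC.
rewrite E {1}uE ler_expR ler_pM2r// intrD.
by apply: ltW; rewrite -intrD1 floorD1_gt.
Qed.

Lemma powR_tangent (y s : R) : 0 <= y -> 0 < s <= 1 -> y `^ s <= 1 + s * (y - 1).
Proof.
move=> y0 /andP[s0 s1]; have [->|yn] := eqVneq y 0.
  by rewrite powR0 ?gt_eqF//; lra.
have {yn} y0' : 0 < y by rewrite lt_def yn.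
rewrite /powR (gt_eqF y0'); set a := ln y; have ya : y = expR a by rewrite lnK.
(* Both are instances of 1 + x <= exp x, multiplied below by y^s; [s] times the first plus 1 - s
   times the second eliminates [a]. *)
have h1 := expR_ge1Dx ((1 - s) * a); have h2 := expR_ge1Dx (- s * a).
have e0 := expR_gt0 (s * a).
have {}h1 : expR (s * a) * (1 + (1 - s) * a) <= y.
  have -> : y = expR (s * a) * expR ((1 - s) * a).
    by rewrite ya -expRD; congr expR; ring.
  by rewrite ler_pM2l.
have {}h2 : expR (s * a) * (1 + - s * a) <= 1.
  have e1 : expR (s * a) * expR (- s * a) = 1.
    by rewrite -expRD -expR0; congr expR; ring.
  by rewrite -[leRHS]e1; apply: ler_wpM2l h2; exact: ltW.
by move: e0 h1 h2; move: (expR _) => e e0 h1 h2; nra.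
Qed.

Lemma powR_bernoulli (y s : R) : 0 <= y -> 1 <= s -> 1 + s * (y - 1) <= y `^ s.
Proof.
move=> y0 s1; have s0 : 0 < s by lra.
have := @powR_tangent (y `^ s) s^-1 (powR_ge0 _ _).
rewrite invr_gt0 s0 invf_le1// s1 => /(_ isT).
rewrite -powRrM divff ?gt_eqF// powRr1// -(ler_pM2l s0).
by rewrite mulrDr mulrA divff ?gt_eqF//; lra.
Qed.

Lemma powR_pred (b s : R) : 0 < b -> b `^ (s - 1) = b `^ s / b.
Proof.
move=> b0; rewrite powRB; last by rewrite (gt_eqF b0) implybT.
by rewrite powRr1// ltW.
Qed.

(** A substitute for the mean value theorem with the derivative at the larger endpoint: after
    division by b^s, this bound and the next are tangent-line inequalities at a/b. *)
Lemma powR_increment_ge (a b s : R) : 0 <= a -> a <= b -> 1 <= s ->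
  b `^ s - a `^ s <= s * ((b - a) * b `^ (s - 1)).
Proof.
move=> a0 ab s1; have s0 : 0 < s by lra.
have [b0|bn] := eqVneq b 0.
  have -> : a = 0 by lra.
  by rewrite b0 subr0 mul0r mulr0 powR0 ?subrr// gt_eqF.
have b0 : 0 < b by rewrite lt_def bn; lra.
have bs : 0 < b `^ s by pos.
have aE : a `^ s = (a / b) `^ s * b `^ s.
  by rewrite -powRM ?divfK ?gt_eqF//; pos.
have -> : (b - a) * b `^ (s - 1) = (1 - a / b) * b `^ s.
  by rewrite powR_pred//; field; rewrite gt_eqF.
have := @powR_bernoulli (a / b) s _ s1; rewrite divr_ge0 ?(ltW b0)// => /(_ isT).
rewrite -(ler_pM2r bs) -aE; move: (a / b) => y; lra.
Qed.

Lemma powR_increment_le (a b s : R) : 0 <= a -> a <= b -> 0 < s <= 1 -> 0 < b ->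
  s * ((b - a) * b `^ (s - 1)) <= b `^ s - a `^ s.
Proof.
move=> a0 ab s01 b0; have /andP[s0 s1] := s01.
have bs : 0 < b `^ s by pos.
have aE : a `^ s = (a / b) `^ s * b `^ s.
  by rewrite -powRM ?divfK ?gt_eqF//; pos.
have -> : (b - a) * b `^ (s - 1) = (1 - a / b) * b `^ s.
  by rewrite powR_pred//; field; rewrite gt_eqF.
have := @powR_tangent (a / b) s _ s01; rewrite divr_ge0 ?(ltW b0)// => /(_ isT).
rewrite -(ler_pM2r bs) -aE; move: (a / b) => y; lra.
Qed.

Section Chains.
Variables (T : eqType) (key : T -> int) (c : T -> R).
Hypothesis c0 : forall k, 0 < c k.

Let u (s : seq T) k := \sum_(j <- s | key j <= key k) c j.

(** The element of largest key has the full sum as its partial sum and, keys being distinct, enters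
    no other partial sum; its removal drives both inductions below. *)
Let chain_rec (s : seq T) : uniq [seq key j | j <- s] -> s != [::] ->
  exists k s', [/\ perm_eq s (k :: s'), uniq [seq key j | j <- s'],
    (size s' < size s)%N, u s k = c k + \sum_(j <- s') c j &
    forall j, j \in s' -> u s j = u s' j].
Proof.
move=> us sn0.
have [i is_] : exists i, i \in s by case: s sn0 {us} => // i s _; exists i; exact: mem_head.
have [k ks kmin] := exists_min_seq (fun j => - key j) is_.
have kmax j : j \in s -> key j <= key k by move=> /kmin; rewrite lerN2.
have pk := perm_to_rem ks.
have us' : uniq (key k :: [seq key j | j <- rem k s]).
  by rewrite -(perm_uniq (perm_map key pk)).
exists k, (rem k s); split => //.
- by case/andP: us'.
- by rewrite size_rem// ltn_predL; case: (s) sn0.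
- rewrite /u (perm_big _ pk)/= big_cons lexx; congr (_ + _).
  rewrite big_seq_cond [RHS]big_seq; apply: eq_bigl => j.
  by case: (boolP (j \in rem k s)) => //= /mem_rem/kmax ->.
- move=> j js; rewrite /u (perm_big _ pk)/= big_cons.
  have := kmax j (mem_rem js); case: ifP => // kj jk.
  have kjE : key k = key j by apply/eqP; rewrite eq_le kj jk.
  by move: us' => /= /andP[]; rewrite kjE map_f.
Qed.

Lemma chain_sum_ge s (e : R) : uniq [seq key j | j <- s] -> 0 <= e ->
  (\sum_(k <- s) c k) `^ (e + 1) <= (e + 1) * \sum_(k <- s) c k * u s k `^ e.
Proof.
move=> us e0; have [n] := ubnP (size s); elim: n s us => // n IH s us sn.
have [->|sn0] := eqVneq s [::].
  by rewrite !big_nil mulr0 powR0// gt_eqF//; lra.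
have [k [s' [pk us' ss' uk uj]]] := chain_rec us sn0.
have := IH s' us' (leq_trans ss' _) => /(_ sn) {}IH.
rewrite (perm_big _ pk)/= big_cons [in leRHS](perm_big _ pk)/= big_cons uk.
have -> : \sum_(j <- s') c j * u s j `^ e = \sum_(j <- s') c j * u s' j `^ e.
  by rewrite big_seq [RHS]big_seq; apply: eq_bigr => j /uj ->.
move: IH; set U := \sum_(j <- s') c j => IH.
have U0 : 0 <= U by apply: sumr_ge0 => j _; exact: ltW.
have := @powR_increment_ge U (c k + U) (e + 1) U0; rewrite lerDr ltW//.
rewrite lerDr addrK addrK => /(_ isT e0) h.
by rewrite -[leLHS](subrK (U `^ (e + 1))) mulrDr; exact: lerD h IH.
Qed.

Lemma chain_sum_le s (e : R) : uniq [seq key j | j <- s] -> -1 < e <= 0 ->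
  (e + 1) * \sum_(k <- s) c k * u s k `^ e <= (\sum_(k <- s) c k) `^ (e + 1).
Proof.
move=> us /andP[e1 e0]; have [n] := ubnP (size s); elim: n s us => // n IH s us sn.
have [->|sn0] := eqVneq s [::].
  by rewrite !big_nil mulr0 powR_ge0.
have [k [s' [pk us' ss' uk uj]]] := chain_rec us sn0.
have := IH s' us' (leq_trans ss' _) => /(_ sn) {}IH.
rewrite [in leRHS](perm_big _ pk)/= big_cons (perm_big _ pk)/= big_cons uk.
have -> : \sum_(j <- s') c j * u s j `^ e = \sum_(j <- s') c j * u s' j `^ e.
  by rewrite big_seq [RHS]big_seq; apply: eq_bigr => j /uj ->.
move: IH; set U := \sum_(j <- s') c j => IH.
have U0 : 0 <= U by apply: sumr_ge0 => j _; exact: ltW.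
have ck := c0 k.
have := @powR_increment_le U (c k + U) (e + 1) U0; rewrite lerDr ltW//.
have e01 : 0 < e + 1 <= 1 by apply/andP; split; lra.
have cU : 0 < c k + U by exact: ltr_wpDr.
move=> /(_ isT e01 cU); rewrite addrK addrK => h.
by rewrite -[leRHS](subrK (U `^ (e + 1))) mulrDr; exact: lerD h IH.
Qed.

End Chains.

End PowerSums.

(** * Partial square functions along nested cubes *)

Section ChainSums.
Context (R : realType) (disp : measure_display) (X : measurableType disp).
Variables (S : sht R X) (D : reference_grid S) (J : seq (int * X)).
Variable t : int * X -> R.
Hypotheses (WJ : windices D J) (t0 : forall k, k \in J -> 0 < t k).
Local Notation Q := (wav_cube D).
Local Notation W := (wav_index D).

(* Constant on the cube of [i]: the part of [sqf D J t] coming from the cubes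
   that contain it. *)
Definition csum (i : int * X) : R :=
  \sum_(k <- J | k.1 <= i.1) \1_(Q k) i.2 * (t k ^+ 2 / cubem D k).

Let WJ2 k : k \in J -> W k. Proof. exact: (proj2 WJ). Qed.

(** A cube of generation at most that of [i] contains all of the cube of [i] or none of it, so the
    center can be replaced by any point of that cube. *)
Lemma csumE i x : W i -> Q i x ->
  csum i = \sum_(k <- J | k.1 <= i.1) \1_(Q k) x * (t k ^+ 2 / cubem D k).
Proof.
move=> Wi Qx; rewrite /csum big_seq_cond [RHS]big_seq_cond.
apply: eq_bigr => k /andP[/WJ2 Wk ki]; congr (_ * _); rewrite !indicE.
have Qi := cube_center Wi.
have [Qkx|nQkx] := pselect (Q k x).
  by rewrite !mem_set//; exact: (cube_nest Wk Wi ki Qkx Qx).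
rewrite !memNset// => Qki; apply: nQkx.
exact: (cube_nest Wk Wi ki Qki Qi).
Qed.

Let c_ge0 k : k \in J -> 0 < t k ^+ 2 / cubem D k.
Proof. by move=> kJ; have := t0 kJ; have := cubem_gt0 (WJ2 kJ) => ? ?; pos. Qed.

Lemma csum_le_sqf k x : k \in J -> Q k x -> csum k <= sqf D J t x.
Proof.
move=> kJ Qx; rewrite (csumE (WJ2 kJ) Qx) /sqf big_mkcond.
rewrite big_seq [leRHS]big_seq; apply: ler_sum => j jJ.
by have := c_ge0 jJ => ?; case: ifP => // _; pos.
Qed.

Lemma csum_gt0 k : k \in J -> 0 < csum k.
Proof.
move=> kJ; rewrite /csum big_mkcond (bigD1_seq k)//=; last by case: WJ.
have := c_ge0 kJ; rewrite lexx indicE mem_set ?mul1r; last exact/cube_center/WJ2.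
move=> c0; apply: ltr_wpDr => //; rewrite big_seq_cond; apply: sumr_ge0.
by move=> j /andP[/c_ge0 ? _]; case: ifP => // _; pos.
Qed.

Let chain x := [seq k <- J | x \in Q k].
(** The chain inequalities take weights positive at every index; the value 1 off [J] is never
    summed. *)
Let c k := if k \in J then t k ^+ 2 / cubem D k else 1.

Let c0 k : 0 < c k.
Proof. by rewrite /c; case: ifP => // /c_ge0. Qed.

Let chain_uniq x : uniq [seq k.1 | k <- chain x].
Proof.
rewrite map_inj_in_uniq; first by apply: filter_uniq; case: WJ.
move=> i j; rewrite !mem_filter => /andP[/set_mem Qi /WJ2 Wi].
by move=> /andP[/set_mem Qj /WJ2 Wj] ij; exact: (cube_inj Wi Wj ij Qi Qj).
Qed.

Let chain_sum x (f : int * X -> R) :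
  \sum_(k <- chain x) c k * f k =
  \sum_(k <- J) \1_(Q k) x * (t k ^+ 2 / cubem D k * f k).
Proof.
rewrite big_filter big_mkcond big_seq [RHS]big_seq; apply: eq_bigr => k kJ.
by rewrite indicE /c kJ; case: ifP => _; rewrite ?mul1r ?mul0r.
Qed.

Let chain_sqf x : sqf D J t x = \sum_(k <- chain x) c k.
Proof.
rewrite (eq_bigr (fun k => c k * 1)); last by move=> k _; rewrite mulr1.
by rewrite chain_sum /sqf; apply: eq_bigr => k _; rewrite mulr1.
Qed.

Let chain_csum x k : k \in chain x ->
  \sum_(j <- chain x | j.1 <= k.1) c j = csum k.
Proof.
rewrite mem_filter => /andP[/set_mem Qk kJ]; rewrite (csumE (WJ2 kJ) Qk).
rewrite big_filter_cond big_seq_cond big_mkcond [RHS]big_mkcond.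
rewrite big_seq_cond [RHS]big_seq_cond big_mkcond [RHS]big_mkcond.
apply: eq_bigr => j _; case: (boolP (j \in J)) => //= jJ.
rewrite indicE /c jJ; case: (x \in Q j) => /=; last by case: ifP => // _; rewrite mul0r.
by case: ifP => // _; rewrite mul1r.
Qed.

(** The cubes of [J] containing [x] have distinct generations, and [csum] is their running sum.
    Together with its reverse, this exchanges a power of the square function for a sum of squared
    coefficients weighted by powers of [csum], which can be integrated cube by cube. *)
Lemma sqf_chain_ge x e : 0 <= e -> sqf D J t x `^ (e + 1) <=
  (e + 1) * \sum_(k <- J) \1_(Q k) x * (t k ^+ 2 / cubem D k * csum k `^ e).
Proof.
move=> e0; have := chain_sum_ge c0 (chain_uniq x) e0.
rewrite -chain_sqf => /le_trans; apply; rewrite -chain_sum.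
apply: eqle; congr (_ * _); rewrite big_seq [RHS]big_seq.
by apply: eq_bigr => k kx; rewrite chain_csum.
Qed.

Lemma sqf_chain_le x e : -1 < e <= 0 ->
  (e + 1) * (\sum_(k <- J) \1_(Q k) x * (t k ^+ 2 / cubem D k * csum k `^ e))
  <= sqf D J t x `^ (e + 1).
Proof.
move=> e0; have := chain_sum_le c0 (chain_uniq x) e0.
rewrite -chain_sqf; apply: le_trans; rewrite -chain_sum.
apply: eqle; congr (_ * _); rewrite big_seq [RHS]big_seq.
by apply: eq_bigr => k kx; rewrite chain_csum.
Qed.

End ChainSums.

(** * Boundedness on square functions *)

Section SquareFunctionBound.
Context (R : realType) (disp : measure_display) (X : measurableType disp).
Variables (S : sht R X).

Definition apply_mx (a : int * X -> int * X -> R) (J : seq (int * X))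
  (t : int * X -> R) (j : int * X) : R := \sum_(i <- J) a j i * t i.

(** Integrals of p-th powers rather than norms, so that exponents below 1 are treated alike. The
    sequences are nonnegative because only absolute values of coefficients will be inserted. *)
Definition sq_bounded (D D' : reference_grid S) (p : R)
    (a : int * X -> int * X -> R) := exists2 C, 0 < C &
  forall J L t, windices D J -> windices D' L -> (forall i, 0 <= t i) ->
    (\int[mu S]_x (sqf D' L (apply_mx a J t) x `^ (p / 2))%:E <=
     C%:E * \int[mu S]_x (sqf D J t x `^ (p / 2))%:E)%E.

(** Deleting the indices with zero coefficient changes neither side. On the remaining ones [csum] is
    positive, so that its logarithmic level and its negative powers make sense. *)
Lemma sq_bounded_pos (D D' : reference_grid S) p a :
  (exists2 C, 0 < C & forall J L t, windices D J -> windices D' L ->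
    (forall i, 0 <= t i) -> (forall i, i \in J -> 0 < t i) ->
    (\int[mu S]_x (sqf D' L (apply_mx a J t) x `^ (p / 2))%:E <=
     C%:E * \int[mu S]_x (sqf D J t x `^ (p / 2))%:E)%E) ->
  sq_bounded D D' p a.
Proof.
move=> [C C0 H]; exists C => // J L t WJ WL t0.
pose J' := [seq i <- J | 0 < t i].
have WJ' : windices D J'.
  split; first by apply: filter_uniq; case: WJ.
  by move=> i; rewrite mem_filter => /andP[_]; case: WJ => _; apply.
have tE (f : int * X -> R) : (forall i, t i = 0 -> f i = 0) ->
    \sum_(i <- J) f i = \sum_(i <- J') f i.
  move=> f0; rewrite big_filter [RHS]big_mkcond; apply: eq_bigr => i _.
  by case: ifPn => //; rewrite -leNgt => ti; apply: f0; apply/le_anti/andP.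
have := H J' L t WJ' WL t0.
have -> : apply_mx a J' t = apply_mx a J t.
  by apply/funext => j; rewrite /apply_mx -tE// => i ->; rewrite mulr0.
have -> : sqf D J' t = sqf D J t.
  apply/funext => x; rewrite /sqf -tE// => i ->.
  by rewrite expr0n/= mul0r mulr0.
by apply => i; rewrite mem_filter => /andP[].
Qed.

Lemma sq_bounded_2 D D' eta N a : (decayN S + dimN S <= N)%N -> 0 < eta ->
  almost_diagonal D D' eta N a -> sq_bounded D D' 2 a.
Proof.
move=> hN eta0 ad; have [C C0 H] := schur_test hN eta0 ad.
exists C => // J L t WJ WL t0.
have e1 (D1 : reference_grid S) L1 b : windices D1 L1 -> (\int[mu S]_x (sqf D1 L1 b x `^ (2 / 2))%:E =
    (\sum_(j <- L1) b j ^+ 2)%:E)%E.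
  move=> W1; rewrite -(integral_sqf b W1); apply: eq_integral => x _.
  by rewrite divff// powRr1// sqf_ge0.
by rewrite !e1// -EFinM lee_fin; exact: H.
Qed.

Lemma sqf_sqrt_le (D' : reference_grid S) (G : eqType) (H : seq G) L b
    (bg : G -> int * X -> R) x : windices D' L ->
  (forall j, j \in L -> 0 <= b j <= \sum_(g <- H) bg g j) ->
  (forall g j, g \in H -> j \in L -> 0 <= bg g j) ->
  Num.sqrt (sqf D' L b x) <= \sum_(g <- H) Num.sqrt (sqf D' L (bg g) x).
Proof.
move=> WL bb bg0.
have w0 j : j \in L -> 0 <= \1_(wav_cube D' j) x / cubem D' j.
  by move=> /(proj2 WL)/cubem_gt0 m0; pos.
have E c : sqf D' L c x =
    \sum_(j <- L) (\1_(wav_cube D' j) x / cubem D' j) * c j ^+ 2.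
  by apply: eq_bigr => j _; ring.
under eq_bigr do rewrite E.
apply: le_trans (sum_minkowski w0 bg0); rewrite E; apply: ler_wsqrtr.
rewrite big_seq [leRHS]big_seq; apply: ler_sum => j jL.
apply: ler_wpM2l; first exact: w0.
by have /andP[b0 bj] := bb j jL; apply: lerXn_le.
Qed.

Lemma sqf_powR_sqrt (D' : reference_grid S) L b x p : windices D' L ->
  sqf D' L b x `^ (p / 2) = Num.sqrt (sqf D' L b x) `^ p.
Proof.
move=> WL; rewrite -[in LHS](sqr_sqrtr (sqf_ge0 b x WL)).
by rewrite powR_sqr_half// sqrtr_ge0.
Qed.

(** * Atomic decomposition for exponents at most 1 *)

Section Atoms.
Variables (D : reference_grid S) (J : seq (int * X)) (t : int * X -> R).
Hypotheses (WJ : windices D J) (t0 : forall k, k \in J -> 0 < t k).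
Local Notation Q := (wav_cube D).

Let u := csum D J t.
Let lv i := lev (u i).

(* [i] belongs to the atom of [g] if [Q i] is contained in [Q g] and [u] has the
   same order of magnitude at [i] and [g]; the heads are the maximal cubes of
   their level set. *)
Let below (g i : int * X) := [&& g.1 <= i.1, i.2 \in Q g & lv i == lv g].
Let heads := [seq g <- J | all (fun k => (k.1 < g.1) ==> ~~ below k g) J].
Let atom g := [seq i <- J | below g i].
(** The upper end of the level: u i <= (lam g)^2 throughout the atom of [g]. *)
Let lam g : R := 2 * 2 ^ lv g.

Let WJ2 k : k \in J -> wav_index D k. Proof. exact: (proj2 WJ). Qed.

Let headsJ g : g \in heads -> g \in J.
Proof. by rewrite mem_filter => /andP[]. Qed.

Let lam_gt0 g : 0 < lam g. Proof. by rewrite /lam; pos. Qed.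

Let windices_atom g : windices D (atom g).
Proof.
split; first by apply: filter_uniq; case: WJ.
by move=> i; rewrite mem_filter => /andP[_ /WJ2].
Qed.

Let atom_sub g i : g \in J -> i \in atom g ->
  g.1 <= i.1 /\ wav_cube D i `<=` wav_cube D g.
Proof.
move=> gJ; rewrite mem_filter => /andP[/and3P[gi /set_mem ig _] iJ].
by split => //; apply: (cube_nest (WJ2 gJ) (WJ2 iJ) gi ig); exact/cube_center/WJ2.
Qed.

(** The coarsest element of [J] whose atom contains [i] is a head: an element disqualifying it
    would, by transitivity, be a coarser choice for [i]. *)
Let atom_cover i : i \in J -> exists2 g, g \in heads & below g i.
Proof.
move=> iJ; pose s := [seq g <- J | below g i].
have bii : below i i.
  by rewrite /below lexx eqxx andbT/=; apply/mem_set/cube_center/WJ2.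
have [g gs gmin] : exists2 g, g \in s & forall k, k \in s -> g.1 <= k.1.
  by apply: (@exists_min_seq _ _ fst i); rewrite mem_filter bii.
move: gs; rewrite mem_filter => /andP[bgi gJ]; exists g => //.
rewrite mem_filter gJ andbT; apply/allP => k kJ; apply/implyP => kg.
apply/negP => /and3P[kg' /set_mem gk /eqP lkg].
move: (bgi) => /and3P[gi /set_mem ig /eqP lgi].
suff /gmin : k \in s by rewrite leNgt kg.
rewrite mem_filter kJ andbT /below (le_trans kg' gi)/= lgi lkg eqxx andbT.
apply/mem_set; apply: (cube_nest (WJ2 kJ) (WJ2 gJ) kg' gk) => //.
exact/cube_center/WJ2.
Qed.

(** At a point of the cube of [g], take the smallest cube [i] of the atom containing it. The square
    function of the atom there is part of the sum [u i], which is at most lam^2; it remains to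
    integrate over the cube of [g]. *)
Let atom_norm g : g \in J ->
  \sum_(i <- atom g) t i ^+ 2 <= lam g ^+ 2 * cubem D g.
Proof.
move=> gJ; rewrite mulrC -lee_fin -(integral_sqf t (windices_atom g)).
have := @integral_cube_sum _ _ _ S D [:: g] predT (fun=> lam g ^+ 2).
rewrite !big_seq1 => <-; last 2 first.
- by move=> i; rewrite inE => /eqP ->; exact: WJ2.
- by move=> _; pos.
under [leRHS]eq_integral do rewrite big_seq1.
apply: le_integral_ge0.
- exact: measurable_sqf.
- by apply: measurable_funM => //; exact/measurable_cube_indic/WJ2.
- by move=> x; exact: sqf_ge0.
move=> x.
have [[i iax imax]|ax0] : (exists2 i, i \in [seq i <- atom g | x \in Q i] &
    forall k, k \in [seq i <- atom g | x \in Q i] -> k.1 <= i.1) \/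
    [seq i <- atom g | x \in Q i] = [::].
- case E : [seq i <- atom g | x \in Q i] => [|i0 s]; first by right.
  have [i si imin] := exists_min_seq (fun j : int * X => - j.1) (mem_head i0 s).
  by left; exists i => // k /imin; rewrite lerN2.
- move: iax; rewrite mem_filter => /andP[/set_mem Qix iat].
  have [_ /(_ x Qix) Qgx] := atom_sub gJ iat.
  move: iat; rewrite mem_filter => /andP[/and3P[_ _ /eqP lig] iJ].
  rewrite indicE mem_set// mul1r.
  apply: (@le_trans _ _ (u i)); last first.
    by rewrite /lam -lig; have [] := lev_spec (csum_gt0 WJ t0 iJ).
  rewrite /u (csumE t WJ (WJ2 iJ) Qix) /sqf big_filter.
  rewrite big_mkcond [leRHS]big_mkcond big_seq [leRHS]big_seq.
  apply: ler_sum => k kJ; have c0 := cubem_gt0 (WJ2 kJ); have tk := t0 kJ.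
  case: ifP => bk; last by case: ifP => // _; pos.
  have [Qk|Qk] := boolP (x \in Q k).
    by rewrite (imax k)// mem_filter Qk mem_filter bk.
  by rewrite indicE (negbTE Qk) mul0r; case: ifP.
- rewrite /sqf big1_seq.
    by have := WJ2 gJ => _; pos.
  move=> k /andP[_ kat]; rewrite indicE; case: (boolP (x \in Q k)) => Qk.
    by have : k \in [seq i <- atom g | x \in Q i];
      [rewrite mem_filter Qk|rewrite ax0].
  by rewrite mul0r.
Qed.

(** Two heads of the same level cannot both contain [x]: their cubes would be nested and the larger
    one would disqualify the smaller. The levels are therefore distinct, with 2^lev at most the root
    of the square function at [x], and the sum is geometric. *)
Let heads_sum q x : 0 < q -> \sum_(g <- heads) \1_(Q g) x * lam g `^ q <=
  (2 `^ q * (2 * (1 - 2 `^ (- q))^-1)) * sqf D J t x `^ (q / 2).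
Proof.
move=> q0; rewrite sqf_powR_sqrt//.
pose s := [seq g <- heads | x \in Q g].
have -> : \sum_(g <- heads) \1_(Q g) x * lam g `^ q =
    2 `^ q * \sum_(z <- [seq lv g | g <- s]) (2 ^ z) `^ q.
  rewrite [in RHS]big_map [in RHS]big_filter [in RHS]big_mkcond mulr_sumr.
  apply: eq_bigr => g _.
  rewrite indicE; case: ifP => _; last by rewrite mul0r mulr0.
  by rewrite mul1r /lam powRM//; pos.
rewrite -mulrA; apply: ler_wpM2l; first by pos.
apply: sum_exp2_le => //; last first.
  move=> z /mapP[g]; rewrite mem_filter => /andP[/set_mem Qg /headsJ gJ] ->.
  have [h _] := lev_spec (csum_gt0 WJ t0 gJ).
  rewrite -(@ler_pXn2r _ 2) ?nnegrE ?sqrtr_ge0//; last by pos.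
  rewrite sqr_sqrtr ?sqf_ge0//; apply: (le_trans h).
  exact: csum_le_sqf.
rewrite map_inj_in_uniq; first by do 2 apply: filter_uniq; case: WJ.
have key g g' : g \in s -> g' \in s -> lv g = lv g' -> g.1 < g'.1 -> False.
  rewrite !mem_filter => /andP[/set_mem Qg /andP[_ gJ]].
  move=> /andP[/set_mem Qg' /andP[/allP hg' g'J]] ll gg'.
  have := hg' g gJ; rewrite gg'/= /below (ltW gg')/= ll eqxx andbT => /negP; apply.
  apply/mem_set; apply: (cube_nest (WJ2 gJ) (WJ2 g'J) (ltW gg') Qg Qg').
  exact/cube_center/WJ2.
move=> g g' gs g's ll; have [gg'|gg'|gg'] := ltgtP g.1 g'.1.
- by case: (key g g').
- by case: (key g' g).
- move: gs g's; rewrite !mem_filter => /andP[/set_mem Qg /andP[_ /WJ2 Wg]].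
  by move=> /andP[/set_mem Qg' /andP[_ /WJ2 Wg']]; exact: (cube_inj Wg Wg' gg' Qg Qg').
Qed.

Variables (D' : reference_grid S) (L : seq (int * X)) (a : int * X -> int * X -> R).
Hypotheses (WL : windices D' L)
  (a0 : forall j i, j \in L -> i \in J -> 0 <= a j i).

(** The atoms cover [J] and all terms are nonnegative, so Minkowski's inequality bounds the root of
    the square function by a sum over heads; the q-th power is subadditive. *)
Let atom_split q x : 0 < q <= 1 ->
  sqf D' L (apply_mx a J t) x `^ (q / 2) <=
  \sum_(g <- heads) sqf D' L (apply_mx a (atom g) t) x `^ (q / 2).
Proof.
move=> q01; have /andP[q0 _] := q01; rewrite sqf_powR_sqrt//.
under eq_bigr do rewrite sqf_powR_sqrt//.
apply: le_trans (powR_sum_le _ q01 _); last by move=> g; exact: sqrtr_ge0.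
apply: ge0_ler_powR; rewrite ?nnegrE ?(ltW q0) ?sqrtr_ge0 ?sumr_ge0//.
have a0' j i : j \in L -> i \in J -> 0 <= a j i * t i.
  by move=> jL iJ; apply: mulr_ge0; [exact: a0|exact/ltW/t0].
apply: sqf_sqrt_le => // [j jL|g j _ jL].
  apply/andP; split.
    by rewrite /apply_mx big_seq; apply: sumr_ge0 => i; exact: a0'.
  rewrite /apply_mx; under [leRHS]eq_bigr do rewrite big_filter.
  rewrite (exchange_big_dep predT)//= big_seq [leRHS]big_seq.
  apply: ler_sum => i iJ; have [g gH bgi] := atom_cover iJ.
  rewrite big_mkcond (bigD1_seq g)//=; last by do 1 apply: filter_uniq; case: WJ.
  rewrite bgi lerDl; apply: sumr_ge0 => g' _; case: ifP => // _; exact: a0'.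
rewrite /apply_mx big_seq; apply: sumr_ge0 => i.
by rewrite mem_filter => /andP[_]; exact: a0'.
Qed.

(** The bounds for the atoms add up to the integral of the left side of [heads_sum], which returns
    the square function of [t]. *)
Lemma atomic_bound C q : 0 < q <= 1 -> 0 <= C ->
  (forall g J' lam', windices D J' -> wav_index D g ->
    (forall i, i \in J' -> g.1 <= i.1 /\ wav_cube D i `<=` wav_cube D g) ->
    (forall i, i \in J' -> 0 <= t i) -> 0 < lam' ->
    \sum_(i <- J') t i ^+ 2 <= lam' ^+ 2 * cubem D g ->
    (\int[mu S]_x (sqf D' L (apply_mx a J' t) x `^ (q / 2))%:E
      <= (C * lam' `^ q * cubem D g)%:E)%E) ->
  (\int[mu S]_x (sqf D' L (apply_mx a J t) x `^ (q / 2))%:E <=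
   (C * (2 `^ q * (2 * (1 - 2 `^ (- q))^-1)))%:E *
     \int[mu S]_x (sqf D J t x `^ (q / 2))%:E)%E.
Proof.
move=> q01 C0 H; have /andP[q0 _] := q01.
apply: (le_trans (le_integral_ge0 _ _ _ (fun x => powR_ge0 _ _)
  (fun x => atom_split x q01))).
- exact: measurable_sqf_powR.
- by apply: measurable_sum_seq => g _; exact: measurable_sqf_powR.
rewrite integral_sumr; last 2 first.
- by move=> g _; exact: measurable_sqf_powR.
- by move=> g x _; pos.
apply: (@le_trans _ _ (\sum_(g <- heads) (C%:E * (cubem D g * lam g `^ q)%:E))%E).
  rewrite big_seq [leRHS]big_seq; apply: lee_sum => g /headsJ gJ.
  rewrite -EFinM [C * _](_ : _ = C * lam g `^ q * cubem D g); last by ring.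
  apply: H; [exact: windices_atom|exact: WJ2|by move=> i; exact: atom_sub| |
    exact: lam_gt0|exact: atom_norm].
  by move=> i; rewrite mem_filter => /andP[_ /t0/ltW].
have c2 : 0 < (1 - (2 : R) `^ (- q))^-1.
  have := @ltr_expR R 0 (q * ln 2); rewrite expR0 mulr_gt0 ?ln_gt0 ?ltr1n//.
  rewrite invr_gt0 subr_gt0 powRN invf_lt1; last by pos.
  by rewrite /powR pnatr_eq0/= => ->.
rewrite -ge0_sume_distrr; last first.
  by move=> g _; rewrite lee_fin; apply: mulr_ge0; [rewrite fine_ge0|pos].
rewrite EFinM -muleA; apply: lee_wpmul2l; first by rewrite lee_fin.
rewrite sumEFin -integral_cube_sum; last 2 first.
- by move=> g /headsJ; exact: WJ2.
- by move=> g; pos.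
rewrite -integralZr_ge0; [|by pos|exact: measurable_sqf_powR|by move=> x; pos].
apply: le_integral_ge0.
- apply: measurable_sum_seq => g /headsJ/WJ2 Wg.
  by apply: measurable_funM => //; exact: measurable_cube_indic.
- by apply: measurable_funM => //; exact: measurable_sqf_powR.
- by move=> x; apply: sumr_ge0 => g _; pos.
- by move=> x; exact: heads_sum.
Qed.

End Atoms.

Lemma sq_bounded_le1 D D' eta q N a : (2 * dimN S + 2 <= N)%N ->
  (decayN S + dimN S <= N)%N -> 0 < eta <= 1 -> 0 < q <= 1 ->
  upper_dim S / (upper_dim S + eta) < q ->
  almost_diagonal D D' eta N a -> sq_bounded D D' q a.
Proof.
move=> hN hN' eta01 q01 crit ad.
have /andP[eta0 _] := eta01; have /andP[q0 _] := q01.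
have [C C0 H] := atom_bound hN hN' eta01 q01 (critical_ratio eta0 q0 crit) ad.
have [Ca _ Ha] := ad; apply: sq_bounded_pos.
have c2 : 0 < (1 - (2 : R) `^ (- q))^-1.
  have := @ltr_expR R 0 (q * ln 2); rewrite expR0 mulr_gt0 ?ln_gt0 ?ltr1n//.
  rewrite invr_gt0 subr_gt0 powRN invf_lt1; last by pos.
  by rewrite /powR pnatr_eq0/= => ->.
exists (C * (2 `^ q * (2 * (1 - 2 `^ (- q))^-1))); first by pos.
move=> J L t WJ WL t0 tJ; apply: atomic_bound => //.
- by move=> j i /(proj2 WL) Wj /(proj2 WJ) Wi; have [] := Ha j i Wj Wi.
- exact: ltW.
- by move=> g J' lam WJ' Wg sub tJ' lam0; exact: H.
Qed.

(** [m] is the level at which coefficients are split. With z^p = x^q + y^2 one has x <= z^(p/q) and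
    y <= z^(p/2), and the exponents of [m] are such that m = z^2 makes each term at most [z]. *)
Lemma interpolate_powR (x y w p q : R) : 0 <= x -> 0 <= y -> 0 <= w ->
  0 < q -> q < p -> p < 2 ->
  (forall m, 0 < m ->
    w <= m `^ (- ((p - q) / (2 * q))) * x + m `^ (- ((p - 2) / 4)) * y) ->
  w `^ p <= 2 `^ p * (x `^ q + y `^ 2).
Proof.
move=> x0 y0 w0 q0 qp p2 H; have p0 : 0 < p by lra.
pose zp := x `^ q + y `^ 2; have zp0 : 0 <= zp by rewrite /zp; pos.
pose z := zp `^ p^-1; have z0 : 0 <= z by rewrite /z; pos.
have zE : z `^ p = zp by rewrite /z -powRrM mulVf ?gt_eqF// powRr1.
rewrite -/zp -zE -(powRM p (ler0n _ 2) z0).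
apply: ge0_ler_powR; rewrite ?nnegrE; [exact: ltW|by []|pos|].
have xz : x <= z `^ (p / q).
  have -> : x = (x `^ q) `^ q^-1 by rewrite -powRrM divff ?gt_eqF// powRr1.
  rewrite powRrM zE; apply: ge0_ler_powR; rewrite ?nnegrE; [pos|pos|pos|].
  by rewrite /zp lerDl; pos.
have yz : y <= z `^ (p / 2).
  have -> : y = (y `^ 2) `^ 2^-1 by rewrite -powRrM divff// powRr1.
  rewrite powRrM zE; apply: ge0_ler_powR; rewrite ?nnegrE; [pos|pos|pos|].
  by rewrite /zp lerDr; pos.
have [zn|zn] := eqVneq z 0.
  move: xz yz; rewrite zn !powR0; last 2 first.
  - by rewrite mulf_neq0// gt_eqF//; pos.
  - by rewrite mulf_neq0// gt_eqF//; pos.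
  move=> xz yz; have -> : 2 * 0 = 0 :> R by lra.
  have x00 : x = 0 by lra.
  have y00 : y = 0 by lra.
  by have := H 1 ltr01; rewrite x00 y00 !mulr0 addr0.
have {zn} z0' : 0 < z by rewrite lt_def zn.
have zD r s : z `^ (r + s) = z `^ r * z `^ s.
  by rewrite powRD// (gt_eqF z0') implybT.
have z2 e : (z ^+ 2) `^ e = z `^ (2 * e) by rewrite -(powR_mulrn 2 z0) -powRrM.
have z20 : 0 < z ^+ 2 by pos.
apply: (le_trans (H _ z20)); rewrite !z2.
rewrite [leRHS](_ : _ = z + z); last by ring.
apply: lerD.
  rewrite -[leRHS](powRr1 z0).
  have e : 2 * - ((p - q) / (2 * q)) + p / q = 1 by field; rewrite gt_eqF.
  by rewrite -[in leRHS]e zD; apply: ler_wpM2l => //; pos.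
rewrite -[leRHS](powRr1 z0).
have e : 2 * - ((p - 2) / 4) + p / 2 = 1 by lra.
by rewrite -[in leRHS]e zD; apply: ler_wpM2l => //; pos.
Qed.

Lemma sqrt_sqfZ (D : reference_grid S) L c b x : windices D L -> 0 <= c ->
  Num.sqrt (sqf D L (fun j => c * b j) x) = c * Num.sqrt (sqf D L b x).
Proof.
move=> WL c0; have -> : sqf D L (fun j => c * b j) x = c ^+ 2 * sqf D L b x.
  by rewrite /sqf mulr_sumr; apply: eq_bigr => j _; ring.
by rewrite sqrtrM ?sqr_ge0// sqrtr_sqr ger0_norm.
Qed.

(** With [u] the partial square function, t <= m^(-e1) t u^e1 + m^(-e2) t u^e2 for every level [m]:
    the first term suffices where u >= m, the second, as e2 < 0, where u < m. The matrix is applied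
    before the level is fixed, so [m] can be chosen separately at each point of the space. *)
Lemma sq_bounded_interpolate (D D' : reference_grid S) p q a :
  (forall j i, wav_index D' j -> wav_index D i -> 0 <= a j i) ->
  0 < q -> q < p -> p < 2 ->
  sq_bounded D D' q a -> sq_bounded D D' 2 a -> sq_bounded D D' p a.
Proof.
move=> a0 q0 qp p2 [Cq Cq0 Hq] [C2 C20 H2]; apply: sq_bounded_pos.
have p0 : 0 < p by lra.
exists (2 `^ p * (Cq + C2 * (p / 2)^-1)); first by pos.
move=> J L t WJ WL t0 tJ.
(* [e1] is such that u <= sqf(t) yields sqf(t1)^(q/2) <= sqf(t)^(p/2); [e2] is such that u^(2 e2) is
   the weight of [sqf_chain_le] for the power p/2. *)
pose u := csum D J t; pose e1 := (p - q) / (2 * q); pose e2 := (p - 2) / 4.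
have e10 : 0 <= e1 by rewrite /e1 divr_ge0//; [lra|pos].
pose t1 i := t i * u i `^ e1; pose t2 i := t i * u i `^ e2.
have t10 i : 0 <= t1 i by apply: mulr_ge0; [exact: t0|pos].
have t20 i : 0 <= t2 i by apply: mulr_ge0; [exact: t0|pos].
have WJ2 i : i \in J -> wav_index D i by exact: (proj2 WJ).
have u0 i : i \in J -> 0 < u i by exact: csum_gt0.
have A0 j (s : int * X -> R) : (forall i, 0 <= s i) -> j \in L -> 0 <= apply_mx a J s j.
  move=> s0 /(proj2 WL) Wj; rewrite /apply_mx big_seq; apply: sumr_ge0 => i iJ.
  by apply: mulr_ge0; [exact: a0 (WJ2 i iJ)|exact: s0].
pose x1 x := Num.sqrt (sqf D' L (apply_mx a J t1) x).
pose x2 x := Num.sqrt (sqf D' L (apply_mx a J t2) x).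
have hpt x : sqf D' L (apply_mx a J t) x `^ (p / 2) <=
    2 `^ p * (sqf D' L (apply_mx a J t1) x `^ (q / 2) +
              sqf D' L (apply_mx a J t2) x `^ (2 / 2)).
  rewrite !sqf_powR_sqrt//; apply: interpolate_powR => // m m0.
  rewrite -/e1 -/e2 -!sqrt_sqfZ//; [|pos|pos].
  pose bg (o : bool) j := if o then m `^ (- e1) * apply_mx a J t1 j
    else m `^ (- e2) * apply_mx a J t2 j.
  apply: (@le_trans _ _ (\sum_(o <- [:: true; false])
      Num.sqrt (sqf D' L (bg o) x))); last first.
    by rewrite !big_cons big_nil addr0.
  apply: sqf_sqrt_le => // [j jL|g j _ jL]; last first.
    have h1 := A0 j t1 t10 jL; have h2 := A0 j t2 t20 jL.
    by rewrite /bg; case: g; pos.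
  rewrite A0//= !big_cons big_nil addr0 /bg /apply_mx !mulr_sumr -big_split/=.
  rewrite big_seq [leRHS]big_seq; apply: ler_sum => i iJ.
  have aji : 0 <= a j i by apply: a0; [exact: (proj2 WL)|exact: WJ2].
  have ui := u0 i iJ.
  rewrite [leRHS](_ : _ = a j i * t i * (m `^ (- e1) * u i `^ e1 +
    m `^ (- e2) * u i `^ e2)); last by rewrite /t1 /t2; ring.
  rewrite -[leLHS]mulr1; apply: ler_wpM2l; first by have := t0 i => ?; pos.
  have [mu_|um] := leP m (u i).
    rewrite -[leLHS]addr0; apply: lerD; last by pos.
    rewrite powRN mulrC ler_pdivlMr; last by pos.
    by rewrite mul1r; apply: ge0_ler_powR; rewrite ?nnegrE ?(ltW m0) ?(ltW ui).
  rewrite -[leLHS]add0r; apply: lerD; first by pos.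
  have [s sE s0] : exists2 s, e2 = - s & 0 <= s.
    by exists (- e2); [rewrite opprK|rewrite /e2; lra].
  rewrite sE opprK powRN ler_pdivlMr; last by pos.
  by rewrite mul1r; apply: ge0_ler_powR; rewrite ?nnegrE ?(ltW m0) ?(ltW ui) ?(ltW um).
have m1 := @measurable_sqf_powR _ _ _ S D' L (apply_mx a J t1) (q / 2) WL.
have m2 := @measurable_sqf_powR _ _ _ S D' L (apply_mx a J t2) (2 / 2) WL.
have m12 := measurable_funD m1 m2.
have mt := @measurable_sqf_powR _ _ _ S D J t (p / 2) WJ.
apply: (le_trans (le_integral_ge0 _ _ _ (fun x => powR_ge0 _ _) hpt)).
- exact: measurable_sqf_powR.
- exact: measurable_funM.
rewrite (integralZr_ge0 _ (powR_ge0 _ _) m12); last by move=> x /=; pos.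
rewrite (integralD_ge0 _ m1 m2); [|by move=> x; pos|by move=> x; pos].
rewrite EFinM -muleA; apply: lee_wpmul2l; first by rewrite lee_fin; pos.
have I0 : (0 <= \int[mu S]_x (sqf D J t x `^ (p / 2))%:E)%E.
  by apply: integral_ge0 => x _; rewrite lee_fin; pos.
rewrite EFinD ge0_muleDl ?lee_fin; [|pos|pos].
apply: leeD.
  apply: (le_trans (Hq J L t1 WJ WL t10)).
  apply: lee_wpmul2l; first by rewrite lee_fin ltW.
  apply: le_integral_ge0 => //; first exact: measurable_sqf_powR.
    by move=> x; pos.
  move=> x; have s0 := sqf_ge0 t x WJ.
  have -> : p / 2 = (1 + 2 * e1) * (q / 2).
    by rewrite /e1; field; rewrite gt_eqF.
  rewrite [in leRHS]powRrM; apply: ge0_ler_powR; rewrite ?nnegrE; [pos|exact: sqf_ge0|pos|].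
  have [s00|sn] := eqVneq (sqf D J t x) 0.
    suff -> : sqf D J t1 x = 0 by pos.
    rewrite /sqf big1_seq// => i /andP[_ iJ]; rewrite indicE.
    case: (boolP (x \in wav_cube D i)) => [/set_mem Qx|]; last by rewrite mul0r.
    have := csum_le_sqf WJ tJ iJ Qx; rewrite s00 => h.
    by have := u0 i iJ; rewrite /u ltNge h.
  have {sn} sp : 0 < sqf D J t x by rewrite lt_def sn.
  rewrite powRD; last by rewrite (gt_eqF sp) implybT.
  rewrite powRr1// {1 2}/sqf mulr_suml big_seq [leRHS]big_seq.
  apply: ler_sum => i iJ; rewrite indicE.
  case: (boolP (x \in wav_cube D i)) => [/set_mem Qx|]; last by rewrite !mul0r.
  have ci := cubem_gt0 (WJ2 i iJ); have ti := tJ i iJ; have ui := u0 i iJ.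
  rewrite !mul1r /t1 exprMn [leRHS]mulrAC ler_pM2r ?invr_gt0//.
  rewrite ler_pM2l; last by pos.
  rewrite -(powR_mulrn 2 (powR_ge0 _ _)) -powRrM mulrC.
  apply: ge0_ler_powR; rewrite ?nnegrE ?(ltW ui)//; first by pos.
  exact: csum_le_sqf.
apply: (le_trans (H2 J L t2 WJ WL t20)).
rewrite EFinM -muleA; apply: lee_wpmul2l; first by rewrite lee_fin ltW.
rewrite -integralZr_ge0; [|by pos|exact: measurable_sqf_powR|by move=> x; pos].
apply: le_integral_ge0.
- exact: measurable_sqf_powR.
- exact: measurable_funM.
- by move=> x; pos.
move=> x; rewrite divff// powRr1; last exact: sqf_ge0.
have e : -1 < (p - 2) / 2 <= 0 by apply/andP; split; lra.
have := sqf_chain_le WJ tJ x e; rewrite (_ : (p - 2) / 2 + 1 = p / 2); last by lra.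
rewrite mulrC -ler_pdivlMr; last by pos.
rewrite [X in _ <= X -> _]mulrC; apply: le_trans.
rewrite /sqf big_seq [leRHS]big_seq; apply: ler_sum => i iJ; apply: eqle.
have ui := u0 i iJ.
rewrite /t2 -/u exprMn -(powR_mulrn 2 (powR_ge0 _ _)) -powRrM.
by rewrite (_ : e2 * 2%:R = (p - 2) / 2); [ring|rewrite /e2; lra].
Qed.

(** Young's inequality up to constants: whichever of k x and y^(1/(p-1)) is larger, one term alone
    dominates the product. A large [k] gives the second term a small coefficient. *)
Lemma young_powR (x y k p : R) : 0 <= x -> 0 <= y -> 0 < k -> 1 < p ->
  x * y <= k `^ (p - 1) * x `^ p + k^-1 * y `^ (p / (p - 1)).
Proof.
move=> x0 y0 k0 p1; have p0 : 0 < p - 1 by lra.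
have kx : 0 <= k * x by pos.
have [h|h] := leP (y `^ (p - 1)^-1) (k * x).
  rewrite -[leLHS]addr0; apply: lerD; last by pos.
  have [->|xn] := eqVneq x 0; first by rewrite mul0r; pos.
  have x0' : 0 < x by rewrite lt_def xn.
  have -> : x `^ p = x * x `^ (p - 1).
    rewrite -{2}(powRr1 x0) -powRD ?(gt_eqF x0') ?implybT//.
    by congr (_ `^ _); ring.
  rewrite mulrCA ler_pM2l// -powRM ?(ltW k0)//.
  have -> : y = (y `^ (p - 1)^-1) `^ (p - 1).
    by rewrite -powRrM mulVf ?gt_eqF// powRr1.
  by apply: ge0_ler_powR; rewrite ?nnegrE ?(ltW p0)//; pos.
rewrite -[leLHS]add0r; apply: lerD; first by pos.
have y0' : 0 < y.
  rewrite lt_def y0 andbT; apply/eqP => y00; move: h.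
  by rewrite y00 powR0 ?invr_eq0 ?gt_eqF// ltNge kx.
have -> : y `^ (p / (p - 1)) = y * y `^ (p - 1)^-1.
  rewrite -{2}(powRr1 y0) -powRD ?(gt_eqF y0') ?implybT//.
  by congr (_ `^ _); field; rewrite gt_eqF.
rewrite mulrC mulrCA ler_pM2l// mulrC ler_pdivlMr// mulrC.
exact: ltW.
Qed.

Lemma measurable_sqrt_sqf (D : reference_grid S) L b : windices D L ->
  measurable_fun setT (fun x => Num.sqrt (sqf D L b x)).
Proof.
move=> WL; have := measurable_sqf_powR b (1 / 2) WL.
rewrite (_ : (fun x => _ `^ _) = fun x => Num.sqrt (sqf D L b x))//.
by apply/funext => x; rewrite sqf_powR_sqrt// powRr1// sqrtr_ge0.
Qed.

(** Spreading each product evenly over its cube writes the pairing as an integral; Cauchy-Schwarz at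
    each point bounds the integrand. *)
Lemma sum_mul_sqf (D : reference_grid S) J t r : windices D J ->
  (forall i, i \in J -> 0 <= t i) -> (forall i, i \in J -> 0 <= r i) ->
  ((\sum_(i <- J) t i * r i)%:E <= \int[mu S]_x
    (Num.sqrt (sqf D J t x) * Num.sqrt (sqf D J r x))%:E)%E.
Proof.
move=> WJ t0 r0; have WJ2 i : i \in J -> wav_index D i by exact: (proj2 WJ).
pose f i := `|t i * r i| / `|cubem D i|.
have f0 i : 0 <= f i by rewrite /f; pos.
have -> : \sum_(i <- J) t i * r i = \sum_(i <- J) cubem D i * f i.
  rewrite big_seq [RHS]big_seq; apply: eq_bigr => i iJ.
  have mi := cubem_gt0 (WJ2 i iJ); rewrite /f (gtr0_norm mi) [RHS]mulrC divfK ?gt_eqF//.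
  by rewrite ger0_norm//; apply: mulr_ge0; [exact: t0|exact: r0].
rewrite -integral_cube_sum//; apply: le_integral_ge0.
- apply: measurable_sum_seq => i /WJ2 Wi.
  by apply: measurable_funM => //; exact: measurable_cube_indic.
- by apply: measurable_funM; exact: measurable_sqrt_sqf.
- by move=> x; have ? := f0; apply: sumr_ge0 => i _; apply: mulr_ge0 => //; pos.
move=> x; have s1 := sqf_ge0 t x WJ; have s2 := sqf_ge0 r x WJ.
rewrite -sqrtrM// -[leLHS]ger0_norm; last first.
  by apply: sumr_ge0 => i _; apply: mulr_ge0 => //; pos.
rewrite -sqrtr_sqr; apply: ler_wsqrtr; apply: cauchy_schwarz_sum => i iJ.
have mi := cubem_gt0 (WJ2 i iJ).
split; [pos|pos|by apply: mulr_ge0 => //; pos|].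
rewrite /f ger0_norm; last by apply: mulr_ge0; [exact: t0|exact: r0].
rewrite (gtr0_norm mi) indicE; apply: eqle.
by case: (x \in _); field; rewrite gt_eqF.
Qed.

(** [P] is finite because it is bounded by a real number, and this permits moving half of it to the
    left. [T] may be infinite. *)
Lemma absorb_half (P T : \bar R) (s k p : R) : 0 < p -> 0 < k ->
  (0 <= P)%E -> (0 <= T)%E -> (P <= (p / 2 * s)%:E)%E ->
  (s%:E <= k%:E * T + (p^-1)%:E * P)%E -> (P <= (p * k)%:E * T)%E.
Proof.
move=> p0 k0 P0 T0 h1 h2.
have pk0 : 0 < p * k by pos.
case: T T0 h2 => [T'| |]// T0 h2; last by rewrite gt0_muley ?leey// lte_fin.
case: P P0 h1 h2 => [P'| |]// P0 h1 h2.
move: P0 T0 h1 h2; rewrite -!EFinM -EFinD !lee_fin => P0 T0 h1 h2.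
have p20 : 0 < p / 2 by pos.
have h3 : p / 2 * s <= p / 2 * (k * T') + P' / 2.
  apply: (@le_trans _ _ (p / 2 * (k * T' + p^-1 * P'))).
    by rewrite ler_pM2l.
  by apply: eqle; field; rewrite gt_eqF.
have -> : p * k * T' = 2 * (p / 2 * (k * T')) by field.
by move: h1 h3; move: (p / 2 * s) (p / 2 * (k * T')) => ? ?; lra.
Qed.

(** Let b be the image and v its partial square function. The chain inequality linearizes the p-th
    power: it is at most p/2 times the pairing of b with c = b v^(p/2-1). The transposed matrix is
    then applied to c, and sqf(c) <= sqf(b)^(p-1) returns its conjugate norm to that of b. *)
Lemma sq_bounded_dual (D D' : reference_grid S) p a :
  (forall j i, wav_index D' j -> wav_index D i -> 0 <= a j i) -> 2 < p ->
  sq_bounded D' D (p / (p - 1)) (fun i j => a j i) -> sq_bounded D D' p a.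
Proof.
move=> a0 p2 [C C0 H]; have p0 : 0 < p by lra.
have p1 : 1 < p by lra.
have p10 : 0 < p - 1 by lra.
(* Then k^-1 C = 1/p, and the factor p/2 leaves exactly half of the left side to be absorbed. *)
pose k := p * C; have k0 : 0 < k by rewrite /k; pos.
exists (p * k `^ (p - 1)); first by pos.
move=> J L0 t WJ WL0 t0.
pose b := apply_mx a J t.
have b0' j : j \in L0 -> 0 <= b j.
  move=> /(proj2 WL0) Wj; rewrite /b /apply_mx big_seq; apply: sumr_ge0 => i iJ.
  by apply: mulr_ge0; [exact/a0/(proj2 WJ)|exact: t0].
pose L := [seq j <- L0 | 0 < b j].
have WL : windices D' L.
  split; first by apply: filter_uniq; case: WL0.
  by move=> j; rewrite mem_filter => /andP[_]; case: WL0 => _; apply.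
have WL2 j : j \in L -> wav_index D' j by exact: (proj2 WL).
have b0 j : j \in L -> 0 < b j by rewrite mem_filter => /andP[].
rewrite -/b; have -> : sqf D' L0 b = sqf D' L b.
  apply/funext => x; rewrite /sqf [RHS]big_filter [RHS]big_mkcond.
  rewrite big_seq [RHS]big_seq; apply: eq_bigr => j jL; case: ifPn => // bj.
  have -> : b j = 0 by apply/le_anti; rewrite b0'// andbT leNgt.
  by rewrite expr0n/= mul0r mulr0.
pose v := csum D' L b; pose e := p / 2 - 1.
have e0 : 0 <= e by rewrite /e; lra.
have v0 j : j \in L -> 0 < v j by exact: csum_gt0.
pose c j := `|b j| * v j `^ e.
have c0 j : 0 <= c j by rewrite /c; pos.
pose r := apply_mx (fun i j => a j i) L c.
have r0 i : i \in J -> 0 <= r i.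
  move=> /(proj2 WJ) Wi; rewrite /r /apply_mx big_seq; apply: sumr_ge0 => j jL.
  by apply: mulr_ge0; [exact/a0/Wi/WL2|exact: c0].
set P := (\int[mu S]_x (sqf D' L b x `^ (p / 2))%:E)%E.
set T := (\int[mu S]_x (sqf D J t x `^ (p / 2))%:E)%E.
have P0 : (0 <= P)%E by apply: integral_ge0 => x _; rewrite lee_fin; pos.
have T0 : (0 <= T)%E by apply: integral_ge0 => x _; rewrite lee_fin; pos.
have h1 : (P <= ((p / 2) * \sum_(j <- L) b j * c j)%:E)%E.
  pose f j := b j ^+ 2 / `|cubem D' j| * v j `^ e.
  have -> : \sum_(j <- L) b j * c j = \sum_(j <- L) cubem D' j * f j.
    rewrite big_seq [RHS]big_seq; apply: eq_bigr => j jL.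
    have mj := cubem_gt0 (WL2 j jL); rewrite /f /c (gtr0_norm mj).
    by rewrite gtr0_norm ?b0//; field; rewrite gt_eqF.
  rewrite EFinM -integral_cube_sum//; last by move=> j; rewrite /f; pos.
  have mf : measurable_fun setT
      (fun x => \sum_(i <- L) \1_(wav_cube D' i) x * f i).
    apply: measurable_sum_seq => j /WL2 Wj.
    by apply: measurable_funM => //; exact: measurable_cube_indic.
  have fx0 x : 0 <= \sum_(i <- L) \1_(wav_cube D' i) x * f i.
    by apply: sumr_ge0 => i _; rewrite /f; pos.
  rewrite -integralZr_ge0//; last by pos.
  apply: le_integral_ge0; [exact: measurable_sqf_powR|exact: measurable_funM|
    by move=> x; pos|].
  move=> x; have := sqf_chain_ge WL b0 x e0; rewrite /e subrK => /le_trans; apply.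
  apply: ler_wpM2l; first by pos.
  rewrite big_seq [leRHS]big_seq; apply: ler_sum => j jL.
  by rewrite /f gtr0_norm ?cubem_gt0//; exact: WL2.
have h2 : \sum_(j <- L) b j * c j = \sum_(i <- J) t i * r i.
  rewrite /b /r /apply_mx; under eq_bigr do rewrite mulr_suml.
  rewrite exchange_big/=; apply: eq_bigr => i _; rewrite mulr_sumr.
  by apply: eq_bigr => j _; ring.
have h3 : ((\sum_(i <- J) t i * r i)%:E <=
    (k `^ (p - 1))%:E * T + (k^-1 * C)%:E * P)%E.
  apply: (le_trans (sum_mul_sqf WJ (fun i _ => t0 i) r0)).
  have q2 : 0 < p / (p - 1) by pos.
  have ms1 : measurable_fun setT (fun x => sqf D J t x `^ (p / 2)).
    exact: measurable_sqf_powR.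
  have ms2 : measurable_fun setT (fun x => sqf D J r x `^ (p / (p - 1) / 2)).
    exact: measurable_sqf_powR.
  have m1 : measurable_fun setT (fun x => k `^ (p - 1) * sqf D J t x `^ (p / 2)).
    exact: measurable_funM.
  have m2 : measurable_fun setT (fun x => k^-1 * sqf D J r x `^ (p / (p - 1) / 2)).
    exact: measurable_funM.
  apply: (@le_trans _ _ (\int[mu S]_x (k `^ (p - 1) * sqf D J t x `^ (p / 2) +
      k^-1 * sqf D J r x `^ (p / (p - 1) / 2))%:E)%E).
    apply: le_integral_ge0.
    - by apply: measurable_funM; exact: measurable_sqrt_sqf.
    - exact: measurable_funD.
    - by move=> x; pos.
    - move=> x; rewrite !sqf_powR_sqrt//.
      by apply: young_powR => //; exact: sqrtr_ge0.
  rewrite integralD_ge0//; [|by move=> x; pos|by move=> x; pos].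
  have ki0 : 0 <= k^-1 by pos.
  rewrite (integralZr_ge0 _ (powR_ge0 _ _) ms1 (fun x => powR_ge0 _ _)).
  rewrite (integralZr_ge0 _ ki0 ms2 (fun x => powR_ge0 _ _)).
  apply: leeD; first exact: lexx.
  rewrite EFinM -muleA; apply: lee_wpmul2l; first by rewrite lee_fin.
  apply: (le_trans (H L J c WL WJ c0)).
  apply: lee_wpmul2l; first by rewrite lee_fin ltW.
  apply: le_integral_ge0; [exact: measurable_sqf_powR|exact: measurable_sqf_powR| |].
    by move=> x; pos.
  move=> x; have s0 := sqf_ge0 b x WL.
  have pe : p / 2 = (p - 1) * (p / (p - 1) / 2) by field; rewrite gt_eqF.
  rewrite [in leRHS]pe [in leRHS]powRrM.
  apply: ge0_ler_powR; rewrite ?nnegrE; [pos|exact: sqf_ge0|pos|].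
  have [s00|sn] := eqVneq (sqf D' L b x) 0.
    suff -> : sqf D' L c x = 0 by pos.
    rewrite /sqf big1_seq// => i /andP[_ iL]; rewrite indicE.
    case: (boolP (x \in wav_cube D' i)) => [/set_mem Qx|]; last by rewrite mul0r.
    have := csum_le_sqf WL b0 iL Qx; rewrite s00 => h.
    by have := v0 i iL; rewrite /v ltNge h.
  have {sn} sp : 0 < sqf D' L b x by rewrite lt_def sn.
  rewrite (_ : p - 1 = 1 + 2 * e); last by rewrite /e; lra.
  rewrite powRD; last by rewrite (gt_eqF sp) implybT.
  rewrite powRr1// {1 2}/sqf mulr_suml big_seq [leRHS]big_seq.
  apply: ler_sum => i iL; rewrite indicE.
  case: (boolP (x \in wav_cube D' i)) => [/set_mem Qx|]; last by rewrite !mul0r.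
  have ci := cubem_gt0 (WL2 i iL); have bi := b0 i iL; have vi := v0 i iL.
  rewrite !mul1r /c (gtr0_norm bi) exprMn [leRHS]mulrAC ler_pM2r ?invr_gt0//.
  rewrite ler_pM2l; last by pos.
  rewrite -(powR_mulrn 2 (powR_ge0 _ _)) -powRrM mulrC.
  apply: ge0_ler_powR; rewrite ?nnegrE ?(ltW vi)//; first by pos.
  exact: csum_le_sqf.
have kC : k^-1 * C = p^-1 by rewrite /k; field; rewrite !gt_eqF.
rewrite kC -h2 in h3.
exact: (absorb_half p0 (powR_gt0 (p - 1) k0) P0 T0 h1 h3).
Qed.

(** As omega/(omega+eta) < 1, the exponent 1 is available as the lower endpoint of an interpolation
    with 2; the conjugate of an exponent p > 2 lies between these two. *)
Lemma almost_diagonal_bounded D D' eta N p a : (2 * dimN S + 2 <= N)%N ->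
  (decayN S + dimN S <= N)%N -> 0 < eta <= 1 ->
  upper_dim S / (upper_dim S + eta) < p ->
  almost_diagonal D D' eta N a -> sq_bounded D D' p a.
Proof.
move=> hN hN' eta01 crit ad; have /andP[eta0 _] := eta01.
have w0 : 0 <= upper_dim S.
  by rewrite divr_ge0 ?ln_ge0 ?Cmu_ge1 ?ler1n.
have c0 : 0 <= upper_dim S / (upper_dim S + eta) by rewrite divr_ge0//; lra.
have c1 : upper_dim S / (upper_dim S + eta) < 1.
  by rewrite ltr_pdivrMr; lra.
have p0 : 0 < p by exact: le_lt_trans crit.
have apos D1 D2 b : almost_diagonal D1 D2 eta N b ->
    forall j i, wav_index D2 j -> wav_index D1 i -> 0 <= b j i.
  by move=> [C _ H] j i Wj Wi; have [] := H j i Wj Wi.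
have mid D1 D2 b q : 1 <= q < 2 -> almost_diagonal D1 D2 eta N b ->
    sq_bounded D1 D2 q b.
  move=> /andP[q1 q2] adb; have b1 : sq_bounded D1 D2 1 b.
    by apply: sq_bounded_le1 adb => //; rewrite ltr01 lexx.
  have [q1E|q1'] := eqVneq q 1; first by rewrite q1E.
  apply: (@sq_bounded_interpolate _ _ q 1) => //; first exact: apos adb.
    by rewrite lt_def q1'.
  exact: sq_bounded_2 adb.
have [p1|p1] := leP p 1.
  by apply: sq_bounded_le1 ad => //; rewrite p0 p1.
have [p2|p2|->] := ltgtP p 2.
- by apply: mid => //; rewrite (ltW p1).
- apply: sq_bounded_dual => //; first exact: apos ad.
  apply: mid; last exact: almost_diagonal_tr.
  by rewrite ler_pdivlMr ?ltr_pdivrMr; lra.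
- exact: sq_bounded_2 ad.
Qed.

End SquareFunctionBound.

(** * Wavelets and their expansions *)

Section Wavelets.
Context (R : realType) (disp : measure_display) (X : measurableType disp).
Variables (S : sht R X).
Local Notation d := (dist S).
Local Notation B := (qball (dist S)).
Local Notation V := (vol S).
Local Notation A := (A0 S).
Local Notation K := (Cmu S).
Local Notation E := (reldist S).

Lemma exp_poly_decay (a nu : R) N : 0 < a -> 0 < nu ->
  exists2 C, 0 < C & forall t, 0 <= t -> expR (- nu * t `^ a) <= C * (1 + t) ^- N.
Proof.
move=> a0 nu0.
(* exp y dominates (y/m)^m, and a m >= N ensures (t^a)^m >= t^N for t >= 1. *)
pose m := (Num.bound (N%:R / a)).+1.
have hm : N%:R <= a * m%:R.
  rewrite -ler_pdivrMl// mulrC.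
  have /archi_boundP/ltW h : 0 <= N%:R / a by pos.
  by apply: (le_trans h); rewrite ler_nat.
have m0 : 0 < m%:R :> R by rewrite ltr0n.
pose C := 2 ^+ N * (1 + (m%:R / nu) ^+ m).
have C0 : 0 < C by rewrite /C; pos.
exists C => // t t0.
have t1 : 0 < 1 + t by lra.
rewrite ler_pdivlMr; last by pos.
rewrite -[leLHS]mulrC -ler_pdivlMr; last by pos.
rewrite -expRN mulNr opprK.
have e1 : 1 <= expR (nu * t `^ a) by rewrite -expR0 ler_expR; pos.
have [{}t1|{}t1] := leP t 1.
  have : (1 + t) ^+ N <= 2 ^+ N by apply: lerXn_le; lra.
  move=> /le_trans; apply; rewrite /C.
  rewrite -[leLHS]mulr1 -mulrA ler_pM2l; last by pos.
  rewrite -[leLHS]mulr1 ler_pM//.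
  by rewrite lerDl; pos.
have : (1 + t) ^+ N <= (2 * t) ^+ N by apply: lerXn_le; lra.
move=> /le_trans; apply; rewrite /C exprMn -mulrA ler_pM2l; last by pos.
have h2 : (nu / m%:R) ^+ m * (t `^ a) ^+ m <= expR (nu * t `^ a).
  rewrite -exprMn.
  have -> : nu * t `^ a = (nu / m%:R * t `^ a) *+ m.
    by rewrite -mulr_natr; field; rewrite pnatr_eq0.
  rewrite -[X in expR X]mulr_natl expRM_natl.
  apply: lerXn_le; first by pos.
  by apply: le_trans (expR_ge1Dx _); rewrite lerDr.
have h3 : t ^+ N <= (t `^ a) ^+ m.
  rewrite -(powR_mulrn m (powR_ge0 _ _)) -powRrM -(powR_mulrn N); last by lra.
  by apply: ler_powR => //; lra.
rewrite mulrDl mul1r; apply: (@le_trans _ _ ((m%:R / nu) ^+ m * expR (nu * t `^ a))).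
  rewrite -ler_pdivrMl; last by pos.
  apply: le_trans h2; rewrite -exprVn invf_div ler_pM2l//; by pos.
by rewrite lerDr; pos.
Qed.

(** The Hoelder condition is required for all pairs of points. With the decay at both points on the
    right, it follows from the size condition once the points are farther apart than [r], so no
    restriction on distances has to be carried along. *)
Definition molecule (eta : R) (N : nat) (r : R) (y : X) (c : R) (f : X -> R) :=
  [/\ measurable_fun setT f, forall x, `|f x| <= c * E r y x ^- N,
    forall x x', `|f x - f x'| <=
      c * (d x x' / r) `^ eta * (E r y x ^- N + E r y x' ^- N)
  & (\int[mu S]_x (f x)%:E = 0)%E].

Lemma molecule_ge0 eta N r y c f : 0 < r -> molecule eta N r y c f -> 0 <= c.
Proof.
move=> r0 [_ h _ _]; have := le_trans (normr_ge0 _) (h y).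
by rewrite pmulr_lge0//; pos.
Qed.

Lemma molecule_weaken eta b N M r y c c' f : 0 < r -> 0 < b <= eta -> (M <= N)%N ->
  c <= c' -> molecule eta N r y c f -> molecule b M r y (2 * c') f.
Proof.
move=> r0 /andP[b0 be] MN cc mol; have c0 := molecule_ge0 r0 mol.
case: mol => mf sz hol int0.
have EE x : E r y x ^- N <= E r y x ^- M by apply: reldist_expN_anti.
have Ep x n : 0 <= E r y x ^- n by pos.
have sz' x : `|f x| <= c' * E r y x ^- M.
  by apply: (le_trans (sz x)); apply: ler_pM.
split=> //.
  move=> x; apply: (le_trans (sz' x)).
  by rewrite ler_wpM2r// ler_peMl ?ler1n//; lra.
move=> x x'; have s0 : 0 <= d x x' / r by pos.
have c'0 : 0 <= c' by lra.
have [d1|d1] := leP (d x x' / r) 1.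
  apply: (le_trans (hol x x')).
  apply: ler_pM; [by pos|by apply: addr_ge0|..|by apply: lerD].
  apply: ler_pM; [by []|by pos|by lra|].
  have [->|sp] := eqVneq (d x x' / r) 0.
    by rewrite !powR0// gt_eqF//; lra.
  apply: ger_powR => //; rewrite d1 andbT lt0r sp; pos.
have b1 : 1 <= (d x x' / r) `^ b.
  by rewrite -[leLHS](powRr0 (d x x' / r)) ler_powR// ltW.
apply: (le_trans (ler_normB _ _)).
apply: (le_trans (lerD (sz' x) (sz' x'))).
rewrite -mulrDr ler_wpM2r//; first by apply: addr_ge0.
by rewrite -[leLHS]mulr1 ler_pM//; lra.
Qed.
Lemma l2_measurable f : l2 S f -> measurable_fun setT f.
Proof. by move=> /sub_Lfun_mfun; rewrite inE. Qed.

Lemma measurable_psi eta (D : reference_grid S) (W : ah_wavelets eta D) i :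
  wav_index D i -> measurable_fun setT (psi W i).
Proof. by move=> Wi; apply: l2_measurable; have [h _ _] := psi_basis W; apply: h. Qed.

Lemma exp_a_gt0 : 0 < exp_a S.
Proof.
rewrite /exp_a invr_gt0 ltr_pwDl// mulr_ge0// divr_ge0// ln_ge0//; first exact: A0_ge1.
by lra.
Qed.

Lemma molecule_psi eta (D : reference_grid S) (W : ah_wavelets eta D) N : 0 < eta ->
  exists2 C, 0 < C & forall i, wav_index D i ->
    molecule eta N (wscale D i) i.2 (C / Num.sqrt (wvol D i)) (psi W i).
Proof.
move=> eta0; have [C [nu [C0 nu0 sz hol]]] := psi_bounds W.
have [C' C'0 dec] := exp_poly_decay N exp_a_gt0 nu0.
exists (C * C'); first by pos.
move=> i Wi; have r0 := wscale_gt0 D i.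
have s0 : 0 < (Num.sqrt (wvol D i))^-1 by pos.
have env x : wav_envelope D nu i x <=
    C' * (Num.sqrt (wvol D i))^-1 * E (wscale D i) i.2 x ^- N.
  rewrite /wav_envelope [C' * _]mulrC -mulrA ler_pM2l//; apply: dec; pos.
have env0 x : 0 <= wav_envelope D nu i x.
  rewrite /wav_envelope; apply: mulr_ge0; first exact: ltW.
  exact: expR_ge0.
split; first exact: measurable_psi.
- move=> x; apply: (le_trans (sz i x Wi)).
  apply: (le_trans (ler_wpM2l (ltW C0) (env x))).
  by rewrite !mulrA.
- move=> x x'; have q0 : 0 <= d x x' / wscale D i by pos.
  have dE y : 0 <= C' * (Num.sqrt (wvol D i))^-1 * E (wscale D i) i.2 y ^- N.
    by apply: le_trans (env0 y) (env y).
  have [h|h] := leP (d x x') (wscale D i).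
    apply: (le_trans (hol i x x' Wi h)).
    apply: (@le_trans _ _ (C * (d x x' / wscale D i) `^ eta *
        (C' * (Num.sqrt (wvol D i))^-1 * E (wscale D i) i.2 x ^- N))).
      by apply: ler_wpM2l (env x); pos.
    rewrite [leRHS](_ : _ = C * (d x x' / wscale D i) `^ eta *
       (C' * (Num.sqrt (wvol D i))^-1 * E (wscale D i) i.2 x ^- N +
        C' * (Num.sqrt (wvol D i))^-1 * E (wscale D i) i.2 x' ^- N)); last by ring.
    by apply: ler_wpM2l; [pos|rewrite lerDl].
  have q1 : 1 <= (d x x' / wscale D i) `^ eta.
    rewrite -[leLHS](powRr0 (d x x' / wscale D i)) ler_powR ?ltW//.
    by rewrite ltr_pdivlMr// mul1r.
  apply: (le_trans (ler_normB _ _)).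
  apply: (le_trans (lerD (sz i x Wi) (sz i x' Wi))); rewrite -mulrDr.
  rewrite [leRHS](_ : _ = C * ((d x x' / wscale D i) `^ eta *
       (C' * (Num.sqrt (wvol D i))^-1 * E (wscale D i) i.2 x ^- N +
        C' * (Num.sqrt (wvol D i))^-1 * E (wscale D i) i.2 x' ^- N))); last by ring.
  rewrite ler_pM2l//; apply: (le_trans (lerD (env x) (env x'))).
  by apply: ler_peMl => //; apply: addr_ge0.
- exact: psi_cancel.
Qed.

Lemma integral_reldistC N r y : 0 < r -> (decayN S <= N)%N ->
  (\int[mu S]_x (E r y x ^- N)%:E <= (2 ^+ (decayN S).+1 * V r y)%:E)%E.
Proof.
by move=> r0 hN; under eq_integral do rewrite reldist_sym; exact: integral_reldist.
Qed.

Lemma integrable_reldist N r y c : 0 < r -> (decayN S <= N)%N ->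
  (mu S).-integrable setT (EFin \o (fun x => c * E r y x ^- N)).
Proof.
move=> r0 hN; apply/integrableP; split.
  apply/measurable_EFinP/measurable_funM => //.
  exact: measurable_reldist_expN.
have e0 x : `|E r y x ^- N| = E r y x ^- N by rewrite ger0_norm//; pos.
under eq_integral => x _ do rewrite /= normrM e0.
rewrite integralZr_ge0//; last by move=> x; pos.
  have h := integral_reldistC y r0 hN.
  apply: (@le_lt_trans _ _ (`|c|%:E * (2 ^+ (decayN S).+1 * V r y)%:E)%E).
    exact: lee_wpmul2l.
  by rewrite -EFinM ltry.
exact: measurable_reldist_expN.
Qed.

Lemma integrable_dominated (f g : X -> R) : measurable_fun setT f ->
  (mu S).-integrable setT (EFin \o g) -> (forall x, `|f x| <= g x) ->
  (mu S).-integrable setT (EFin \o f).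
Proof.
move=> mf ig fg; apply: (le_integrable measurableT _ _ ig).
  exact/measurable_EFinP.
move=> x _ /=; rewrite lee_fin; apply: (le_trans (fg x)); exact: ler_norm.
Qed.

Lemma integrable_molecule eta N r y c f : 0 < r -> (decayN S <= N)%N ->
  molecule eta N r y c f -> (mu S).-integrable setT (EFin \o f).
Proof.
move=> r0 hN [mf sz _ _]; apply: integrable_dominated (integrable_reldist y c r0 hN) sz.
exact: mf.
Qed.

Definition pairing (f g : X -> R) : R := (\int[mu S]_x (f x * g x))%R.

Lemma pairingC f g : pairing f g = pairing g f.
Proof. by apply: eq_Rintegral => x _; rewrite mulrC. Qed.

Lemma molecule_le1 eta N r y c f x : 0 < r -> molecule eta N r y c f -> `|f x| <= c.
Proof.
move=> r0 mol; have c0 := molecule_ge0 r0 mol; case: mol => _ sz _ _.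
by apply: (le_trans (sz x)); rewrite ler_piMr// reldist_expN_le1.
Qed.

(* The cancellation of the molecule f of the smaller scale is tested against
   g - g(y), y being the center of f. *)
Lemma molecule_pairing eta N : 0 < eta <= 1 -> exists2 C, 0 < C &
  forall r r' y y' c c' f g, 0 < r -> r <= r' ->
  molecule eta (N + decayN S).+1 r y c f ->
  molecule eta (N + decayN S).+1 r' y' c' g ->
  `|pairing f g| <= C * (c * c') * (r / r') `^ eta * E r' y' y ^- N * V r y.
Proof.
move=> /andP[eta0 eta1].
exists ((A ^+ N + 1) * 2 ^+ (decayN S).+1); first by pos.
move=> r r' y y' c c' f g r0 rr' mf mg.
have r'0 : 0 < r' by exact: lt_le_trans rr'.
have c0 := molecule_ge0 r0 mf; have c'0 := molecule_ge0 r'0 mg.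
have hN : (decayN S <= (N + decayN S).+1)%N by rewrite leqW// leq_addl.
have if_ := integrable_molecule r0 hN mf.
have gle x := molecule_le1 x r'0 mg.
have [meas_f szf _ intf] := mf; have [meas_g szg holg _] := mg.
have ifg : (mu S).-integrable setT (EFin \o (fun x => f x * g x)).
  apply: (@integrable_dominated _ (fun x => c' * `|f x|)).
  - exact: measurable_funM.
  - have := integrableZl measurableT c' (integrable_norm if_).
    by apply: eq_integrable.
  - by move=> x; rewrite normrM mulrC ler_wpM2r.
have ifgy : (mu S).-integrable setT (EFin \o (fun x => f x * g y)).
  have := integrableZr measurableT (g y) if_; by apply: eq_integrable.
have -> : pairing f g = (\int[mu S]_x (f x * g x - f x * g y))%R.
  rewrite RintegralB// RintegralZr//.
  by rewrite (_ : (\int[mu S]_x f x)%R = 0) ?mul0r ?subr0// /Rintegral intf.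
have ibd := integrable_reldist y
  (((A ^+ N + 1) * (c * c') * (r / r') `^ eta * E r' y' y ^- N)) r0 (leqnn (decayN S)).
apply: (le_trans (le_normr_Rintegral _ (_ : (mu S).-integrable setT _))) => //.
  have := integrableB measurableT ifg ifgy; by apply: eq_integrable.
set M := (_ * _ * _ * _)%R in ibd.
have M0 : 0 <= M by rewrite /M; pos.
apply: (@le_trans _ _ (\int[mu S]_x (M * E r y x ^- decayN S))%R).
  apply: le_Rintegral => //.
    have := integrable_norm (integrableB measurableT ifg ifgy); by apply: eq_integrable.
  move=> x _; rewrite -mulrBr normrM.
  have h1 : (d y x / r') `^ eta <= (r / r') `^ eta * E r y x.
    have -> : d y x / r' = (r / r') * (d y x / r) by field; rewrite !gt_eqF.
    rewrite powRM; [|by pos|by pos].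
    apply: ler_wpM2l; first by pos.
    have s0 : 0 <= d y x / r by pos.
    apply: (@le_trans _ _ (E r y x `^ eta)).
      by apply: ge0_ler_powR; rewrite ?nnegrE /reldist ?lerDr//; try lra; rewrite ltW.
    rewrite -[leRHS]powRr1; last by pos.
    by apply: ler_powR => //; exact: reldist_ge1.
  (* The Hoelder factor costs one power of the relative distance, and moving the decay of [g] from x
     to y costs N. The order N + decayN + 1 of the decay of [f] pays for both and leaves an
     integrable power. *)
  have h2 : `|g x - g y| <= c' * ((r / r') `^ eta * E r y x) *
      ((A ^+ N + 1) * E r y x ^+ N * E r' y' y ^- N).
    rewrite distrC; apply: (le_trans (holg y x)).
    have e1 : 1 <= E r y x by exact: reldist_ge1.
    have anti z : E r' y' z ^- (N + decayN S).+1 <= E r' y' z ^- N.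
      by apply: reldist_expN_anti => //; rewrite leqW// leq_addr.
    apply: ler_pM; [by pos|by apply: addr_ge0; pos|by apply: ler_wpM2l|].
    rewrite addrC; apply: (le_trans (lerD (anti x) (anti y))).
    have t1 : E r' y' x ^- N <= (A * E r y x) ^+ N * E r' y' y ^- N.
      have := reldist_inv_tri S N y x y' r'0.
      rewrite (reldist_sym S r' x y') (reldist_sym S r' y y').
      move=> /le_trans; apply; apply: ler_wpM2r; first by pos.
      apply: lerXn_le; first by pos.
      by rewrite ler_pM2l; [exact: reldist_anti|pos].
    apply: (le_trans (lerD t1 (lexx _))).
    rewrite -[X in _ + X]mul1r -mulrDl ler_wpM2r//; first by pos.
    rewrite exprMn mulrDl lerD2l mul1r; exact: exprn_ege1.
  apply: (le_trans (ler_pM (normr_ge0 _) (normr_ge0 _) (szf x) h2)).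
  apply: eqle; rewrite /M exprS exprD.
  by field; rewrite !gt_eqF//; pos.
rewrite RintegralZl//; last first.
  have := integrable_reldist y 1 r0 (leqnn (decayN S)).
  by apply: eq_integrable => // x _ /=; rewrite mul1r.
have h : \int[mu S]_x (E r y x ^- decayN S) <= 2 ^+ (decayN S).+1 * V r y.
  have h0 := integral_reldistC y r0 (leqnn (decayN S)).
  rewrite /Rintegral -lee_fin fineK; first exact: h0.
  rewrite ge0_fin_numE; first exact: le_lt_trans h0 (ltry _).
  by apply: integral_ge0 => x _; rewrite lee_fin; pos.
apply: (le_trans (ler_wpM2l M0 h)); apply: eqle; rewrite /M; ring.
Qed.

(** The L^2 normalizations of the two wavelets turn the volume of the finer ball in
    [molecule_pairing] into the square root of the volume ratio. *)
Lemma almost_diagonal_pairing eta (D D' : reference_grid S)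
    (W : ah_wavelets eta D) (W' : ah_wavelets eta D') N : 0 < eta <= 1 ->
  almost_diagonal D D' eta N (fun j i => `|pairing (psi W' j) (psi W i)|).
Proof.
move=> eta01; have /andP[eta0 _] := eta01.
have [C C0 HC] := molecule_pairing N eta01.
have [c c0 Hc] := molecule_psi W (N + decayN S).+1 eta0.
have [c' c'0 Hc'] := molecule_psi W' (N + decayN S).+1 eta0.
have sq a b : 0 < a -> 0 < b ->
    (Num.sqrt a)^-1 * (Num.sqrt b)^-1 * a = Num.sqrt (a / b) :> R.
  move=> a0 b0; rewrite sqrtrM ?ltW// sqrtrV ?ltW// -{2}(sqr_sqrtr (ltW a0)).
  by field; rewrite !gt_eqF//; pos.
exists (C * (c * c')); first by pos.
move=> j i Wj Wi; split=> // rr.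
- rewrite pairingC.
  apply: (le_trans (HC _ _ _ _ _ _ _ _ (wscale_gt0 D i) rr (Hc i Wi) (Hc' j Wj))).
  apply: eqle; rewrite -(sq _ _ (wvol_gt0 D i) (wvol_gt0 D' j)).
  rewrite (reldist_sym S _ j.2) /wvol; ring.
- apply: (le_trans (HC _ _ _ _ _ _ _ _ (wscale_gt0 D' j) rr (Hc' j Wj) (Hc i Wi))).
  apply: eqle; rewrite -(sq _ _ (wvol_gt0 D' j) (wvol_gt0 D i)).
  by rewrite /wvol; ring.
Qed.

Lemma reldist_decay_mul M rho x y z : 0 < rho ->
  E rho y x ^- M * E rho y z ^- M <= A ^+ M * E rho x z ^- M.
Proof.
move=> r0; have h : E rho x z ^+ M <= (A * E rho x y * E rho y z) ^+ M.
  by apply: lerXn_le; [pos|exact: reldist_tri].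
have p1 : 0 < E rho y x by pos.
have p2 : 0 < E rho y z by pos.
have p3 : 0 < E rho x z by pos.
rewrite ler_pdivlMr; last by pos.
rewrite -invfM mulrC ler_pdivrMr; last by pos.
by move: h; rewrite (reldist_sym S rho x y) !exprMn mulrA.
Qed.

Lemma powR_le_id (b x : R) : 1 <= x -> b <= 1 -> x `^ b <= x.
Proof. by move=> x1 b1; rewrite -[leRHS]powRr1 ?ler_powR// (le_trans ler01). Qed.

Lemma powR_split (r s e : R) : 0 < r -> r `^ (s + e) = r `^ s * r `^ e.
Proof. by move=> r0; rewrite powRD// (gt_eqF r0) implybT. Qed.

Lemma decay_budget n M N1 N : (n + 2 <= M)%N -> (M + N1 + n + 1 <= N)%N ->
  [/\ N = N.-1.+1, (M <= N.-1)%N, (M + N1 <= N)%N, N = (N - n.+1 + n.+1)%N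
    & (M <= N - n.+1)%N].
Proof. by move=> h1 h2; split; lia. Qed.

(** * Weighted sums of the expansion coefficients *)

Section Coefficients.
Variables (D : reference_grid S) (x0 : X) (eta b g e : R) (N M N1 : nat).
Hypotheses (b0 : 0 <= b) (g0 : 0 <= g) (eta1 : eta <= 1) (e0 : 0 < e).
Hypotheses (be : b + 2 * e <= eta) (ge : g + 3 * e <= eta).
Hypotheses (hM : (dimN S + 2 <= M)%N) (hN : (M + N1 + dimN S + 1 <= N)%N).

Local Notation r := (wscale D).
Local Notation m i := (minratio (wscale D i) 1).

(** Budget of r^eta at a small scale: r^b pays for the Hoelder condition, r^e for the weight, and
    r^e remains for the sum over generations; hence b + 2e <= eta. *)
Lemma coef_small Ca i x T : 0 <= Ca -> r i <= 1 ->
  0 <= T <= Ca * r i `^ eta * E 1 i.2 x0 ^- N ->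
  T * (r i `^ b)^-1 * (E 1 i.2 x0 / m i) `^ e * E (r i) i.2 x ^- N <=
  Ca * A ^+ M * K * V 1 x0 * m i `^ e * E (r i) i.2 x ^- N1 *
   ((V (E 1 x x0) x0)^-1 * (E 1 x x0 `^ b)^-1 * (E 1 x x0 `^ g)^-1).
Proof.
move: b0 g0 eta1 e0 be ge hM hN => hb hg he1 he hbe hge hM' hN'.
have [NE1 NE2 NE3 NE4 NE5] := decay_budget hM' hN'.
move=> Ca0 r1 /andP[T0 hT]; have r0 := wscale_gt0 D i.
rewrite (minratio_le r0 r1) divr1.
have e1 : 1 <= E 1 i.2 x0 by exact: reldist_ge1.
have L1 : 1 <= E 1 x x0 by exact: reldist_ge1.
have L0 : 0 < E 1 x x0 by pos.
have VL0 : 0 < V (E 1 x x0) x0 by pos.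
have pw a c : 0 < a -> 0 < a `^ c :> R by exact: powR_gt0.
have p1 : 1 <= E (r i) i.2 x by exact: reldist_ge1.
have p0 : 0 < E (r i) i.2 x by pos.
have q0 : 0 < E 1 i.2 x0 by pos.
have s1 : r i `^ eta * (r i `^ b)^-1 * (E 1 i.2 x0 / r i) `^ e <= r i `^ e * E 1 i.2 x0.
  have -> : (E 1 i.2 x0 / r i) `^ e = E 1 i.2 x0 `^ e * (r i `^ e)^-1.
    rewrite powRM; [|exact: ltW|by pos].
    by rewrite powR_inv// ltW.
  have h1 : r i `^ eta <= r i `^ b * r i `^ e * r i `^ e.
    rewrite -(powR_split b e r0) -(powR_split (b + e) e r0).
    by apply: ger_powR; [rewrite r0|lra].
  have h2 : E 1 i.2 x0 `^ e <= E 1 i.2 x0 by apply: powR_le_id => //; lra.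
  have := ler_pM (powR_ge0 _ _) (powR_ge0 _ _) h1 h2.
  move=> h3; rewrite [leLHS](_ : _ = r i `^ eta * E 1 i.2 x0 `^ e /
     (r i `^ b * r i `^ e)); last by field; rewrite !gt_eqF//; pos.
  rewrite ler_pdivrMr; last by apply: mulr_gt0; pos.
  by apply: (le_trans h3); apply: eqle; ring.
have s2 : E 1 i.2 x0 ^- N * E 1 i.2 x0 * E (r i) i.2 x ^- N <=
    A ^+ M * E 1 x x0 ^- M * E (r i) i.2 x ^- N1.
  have h1 : E 1 i.2 x0 ^- N * E 1 i.2 x0 <= E 1 i.2 x0 ^- M.
    rewrite NE1 exprS invfM mulrAC mulVf ?gt_eqF// mul1r.
    by exact: reldist_expN_anti.
  have h2 : E (r i) i.2 x ^- N <= E 1 i.2 x ^- M * E (r i) i.2 x ^- N1.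
    apply: (@le_trans _ _ (E (r i) i.2 x ^- (M + N1))).
      by exact: reldist_expN_anti.
    rewrite exprD invfM ler_pM2r; last by pos.
    rewrite lef_pV2 ?posrE; [|by pos|by pos].
    by apply: lerXn_le; [pos|exact: reldist_anti].
  apply: (@le_trans _ _ (E 1 i.2 x0 ^- M * (E 1 i.2 x ^- M * E (r i) i.2 x ^- N1))).
    by apply: ler_pM => //; pos.
  rewrite mulrA ler_pM2r; last by pos.
  by rewrite mulrC; apply: reldist_decay_mul.
have s3 : E 1 x x0 ^- M <= K * V 1 x0 *
    ((V (E 1 x x0) x0)^-1 * (E 1 x x0 `^ b)^-1 * (E 1 x x0 `^ g)^-1).
  have h1 : V (E 1 x x0) x0 <= K * E 1 x x0 ^+ dimN S * V 1 x0.
    by have := vol_scale S x0 L1 ltr01; rewrite mulr1.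
  have h2 : E 1 x x0 `^ b <= E 1 x x0 by apply: powR_le_id => //; lra.
  have h3 : E 1 x x0 `^ g <= E 1 x x0 by apply: powR_le_id => //; lra.
  rewrite -!invfM ler_pdivlMr; last by apply: mulr_gt0; [apply: mulr_gt0|]; pos.
  rewrite mulrC ler_pdivrMr; last by pos.
  apply: (@le_trans _ _ (K * E 1 x x0 ^+ dimN S * V 1 x0 * E 1 x x0 * E 1 x x0)).
    by apply: ler_pM; [pos|pos|apply: ler_pM => //; pos|].
  apply: (@le_trans _ _ (K * V 1 x0 * E 1 x x0 ^+ (dimN S + 2))).
    by apply: eqle; rewrite exprD; ring.
  by apply: ler_wpM2l; [pos|apply: ler_weXn2l].
set U := _ * _ * (_ `^ g)^-1 in s3 *.
have ie0 : 0 <= (E 1 i.2 x0 / r i) `^ e by exact: powR_ge0.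
apply: (@le_trans _ _ (Ca * r i `^ eta * E 1 i.2 x0 ^- N *
   (r i `^ b)^-1 * (E 1 i.2 x0 / r i) `^ e * E (r i) i.2 x ^- N)).
  do 3 (apply: ler_wpM2r; first by pos); exact: hT.
rewrite [leLHS](_ : _ = Ca * (r i `^ eta * (r i `^ b)^-1 * (E 1 i.2 x0 / r i) `^ e) *
  (E 1 i.2 x0 ^- N * E (r i) i.2 x ^- N)); last by ring.
apply: (@le_trans _ _ (Ca * (r i `^ e * E 1 i.2 x0) *
  (E 1 i.2 x0 ^- N * E (r i) i.2 x ^- N))).
  by apply: ler_wpM2r; [pos|apply: ler_wpM2l].
rewrite [leLHS](_ : _ = Ca * r i `^ e *
  (E 1 i.2 x0 ^- N * E 1 i.2 x0 * E (r i) i.2 x ^- N)); last by ring.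
apply: (@le_trans _ _ (Ca * r i `^ e * (A ^+ M * (K * V 1 x0 * U) * E (r i) i.2 x ^- N1))).
  apply: ler_wpM2l; first by pos.
  apply: (le_trans s2); apply: ler_wpM2r; first by pos.
  by apply: ler_wpM2l => //; pos.
by apply: eqle; ring.
Qed.

(** Budget of r^-eta at a large scale: passing from relative distances at scale 1 to those at scale
    r costs r^g for the decay and r^e for the weight, the weight contains a further r^e, and r^-e
    remains for the sum over generations; hence g + 3e <= eta. The factors r^b cancel. *)
Lemma coef_large Ca i x T : 0 <= Ca -> 1 <= r i ->
  0 <= T <= Ca * (r i `^ eta)^-1 * (wvol D i)^-1 * E (r i) i.2 x0 ^- N ->
  T * (r i `^ b)^-1 * (E 1 i.2 x0 / m i) `^ e * E (r i) i.2 x ^- N <=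
  Ca * A ^+ dimN S * A ^+ M * K ^+ 2 * m i `^ e * E (r i) i.2 x ^- N1 *
   ((V (E 1 x x0) x0)^-1 * (E 1 x x0 `^ b)^-1 * (E 1 x x0 `^ g)^-1).
Proof.
move: b0 g0 eta1 e0 be ge hM hN => hb hg he1 he hbe hge hM' hN'.
have [NE1 NE2 NE3 NE4 NE5] := decay_budget hM' hN'.
move=> Ca0 r1 /andP[T0 hT]; have r0 := wscale_gt0 D i.
rewrite minratioC (minratio_le ltr01 r1) div1r invrK.
have L1 : 1 <= E 1 x x0 by exact: reldist_ge1.
have L0 : 0 < E 1 x x0 by pos.
have Lr1 : 1 <= E (r i) x x0 by exact: reldist_ge1.
have Lr0 : 0 < E (r i) x x0 by pos.
have VL0 : 0 < V (E 1 x x0) x0 by pos.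
have p1 : 1 <= E (r i) i.2 x by exact: reldist_ge1.
have p0 : 0 < E (r i) i.2 x by pos.
have q1 : 1 <= E (r i) i.2 x0 by exact: reldist_ge1.
have q0 : 0 < E (r i) i.2 x0 by pos.
have scaleE y : E 1 y x0 <= r i * E (r i) y x0.
  rewrite /reldist divr1 mulrDr mulr1 mulrCA divff ?gt_eqF// mulr1.
  by rewrite lerD2r.
have powE c y : 0 <= c -> c <= 1 -> E 1 y x0 `^ c <= r i `^ c * E (r i) y x0.
  move=> c0 c1.
  apply: (@le_trans _ _ ((r i * E (r i) y x0) `^ c)).
    by apply: ge0_ler_powR; rewrite ?nnegrE//; pos.
  rewrite powRM; [|by pos|by pos].
  apply: ler_wpM2l; first by pos.
  by apply: powR_le_id => //; exact: reldist_ge1.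
have s1 : (E 1 i.2 x0 * r i) `^ e <= r i `^ e * r i `^ e * E (r i) i.2 x0.
  rewrite powRM; [|by pos|by pos].
  rewrite mulrC -mulrA ler_wpM2l//; first by pos.
  by apply: powE; lra.
have s2 : (wvol D i)^-1 <= K * A ^+ dimN S * E (r i) i.2 x0 ^+ dimN S * (V (r i) x0)^-1.
  rewrite ler_pdivlMr; last by pos.
  rewrite mulrC ler_pdivrMr; last by pos.
  have := vol_change S x0 i.2 r0; rewrite (reldist_sym S _ x0) exprMn /wvol.
  by move=> h; apply: (le_trans h); apply: eqle; ring.
have s3 : E (r i) i.2 x0 ^- N * E (r i) i.2 x0 * E (r i) i.2 x0 ^+ dimN S *
    E (r i) i.2 x ^- N <= A ^+ M * E (r i) x x0 ^- M * E (r i) i.2 x ^- N1.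
  have h1 : E (r i) i.2 x0 ^- N * E (r i) i.2 x0 * E (r i) i.2 x0 ^+ dimN S
      <= E (r i) i.2 x0 ^- M.
    rewrite [in X in X <= _]NE4 exprD exprS.
    rewrite [leLHS](_ : _ = E (r i) i.2 x0 ^- (N - (dimN S).+1)); last first.
      by field; rewrite !gt_eqF//; pos.
    by exact: reldist_expN_anti.
  have h2 : E (r i) i.2 x ^- N <= E (r i) i.2 x ^- M * E (r i) i.2 x ^- N1.
    rewrite -invfM -exprD; exact: reldist_expN_anti.
  apply: (@le_trans _ _ (E (r i) i.2 x0 ^- M * (E (r i) i.2 x ^- M * E (r i) i.2 x ^- N1))).
    by apply: ler_pM => //; pos.
  rewrite mulrA ler_pM2r; last by pos.
  by rewrite mulrC; apply: reldist_decay_mul.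
have s4 : (V (r i) x0)^-1 * E (r i) x x0 ^- M <= K * (r i `^ b * r i `^ g) *
    ((V (E 1 x x0) x0)^-1 * (E 1 x x0 `^ b)^-1 * (E 1 x x0 `^ g)^-1).
  have h1 : V (E 1 x x0) x0 <= K * E (r i) x x0 ^+ dimN S * V (r i) x0.
    apply: le_trans (vol_scale S x0 Lr1 r0).
    by rewrite mulrC; apply: vol_mono.
  have h2 : E 1 x x0 `^ b <= r i `^ b * E (r i) x x0 by apply: powE => //; lra.
  have h3 : E 1 x x0 `^ g <= r i `^ g * E (r i) x x0 by apply: powE => //; lra.
  rewrite -!invfM ler_pdivlMr; last by apply: mulr_gt0; [apply: mulr_gt0|]; pos.
  rewrite mulrC ler_pdivrMr; last by pos.
  apply: (@le_trans _ _ (K * E (r i) x x0 ^+ dimN S * V (r i) x0 *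
     (r i `^ b * E (r i) x x0) * (r i `^ g * E (r i) x x0))).
    by apply: ler_pM; [pos|pos|apply: ler_pM => //; pos|].
  apply: (@le_trans _ _ (K * (r i `^ b * r i `^ g) * (V (r i) x0 *
     E (r i) x x0 ^+ (dimN S + 2)))).
    by apply: eqle; rewrite exprD; ring.
  by apply: ler_wpM2l; [pos|apply: ler_wpM2l; [pos|apply: ler_weXn2l]].
have s5 : r i `^ e * r i `^ e * r i `^ g <= r i `^ eta * (r i)^-1 `^ e.
  have -> : (r i)^-1 `^ e = (r i `^ e)^-1.
    by rewrite powR_inv// ltW.
  rewrite ler_pdivlMr; last by pos.
  rewrite -(powR_split e e r0) -(powR_split (e + e) g r0) -(powR_split _ e r0).
  by apply: ler_powR => //; lra.
set U := _ * _ * (_ `^ g)^-1 in s4 *.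
have U0 : 0 <= U by rewrite /U; pos.
have ie0 : 0 <= (E 1 i.2 x0 * r i) `^ e by exact: powR_ge0.
have t1 : T <= Ca * (r i `^ eta)^-1 * (K * A ^+ dimN S * E (r i) i.2 x0 ^+ dimN S *
    (V (r i) x0)^-1) * E (r i) i.2 x0 ^- N.
  apply: (le_trans hT); apply: ler_wpM2r; first by pos.
  by apply: ler_wpM2l => //; pos.
apply: (@le_trans _ _ (Ca * (r i `^ eta)^-1 * (K * A ^+ dimN S * E (r i) i.2 x0 ^+ dimN S *
    (V (r i) x0)^-1) * E (r i) i.2 x0 ^- N *
   (r i `^ b)^-1 * (r i `^ e * r i `^ e * E (r i) i.2 x0) * E (r i) i.2 x ^- N)).
  apply: ler_wpM2r; first by pos.
  apply: ler_pM => //; first by pos.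
  by apply: ler_wpM2r => //; pos.
rewrite [leLHS](_ : _ = Ca * (r i `^ eta)^-1 * (K * A ^+ dimN S * (V (r i) x0)^-1) *
   (r i `^ b)^-1 * (r i `^ e * r i `^ e) * (E (r i) i.2 x0 ^- N * E (r i) i.2 x0 * E (r i) i.2 x0 ^+ dimN S *
    E (r i) i.2 x ^- N)); last by ring.
apply: (@le_trans _ _ (Ca * (r i `^ eta)^-1 * (K * A ^+ dimN S * (V (r i) x0)^-1) *
   (r i `^ b)^-1 * (r i `^ e * r i `^ e) * (A ^+ M * E (r i) x x0 ^- M * E (r i) i.2 x ^- N1))).
  by apply: ler_wpM2l => //; pos.
rewrite [leLHS](_ : _ = Ca * (r i `^ eta)^-1 * K * A ^+ dimN S *
   (r i `^ b)^-1 * (r i `^ e * r i `^ e) * A ^+ M * E (r i) i.2 x ^- N1 *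
   ((V (r i) x0)^-1 * E (r i) x x0 ^- M)); last by ring.
apply: (@le_trans _ _ (Ca * (r i `^ eta)^-1 * K * A ^+ dimN S *
   (r i `^ b)^-1 * (r i `^ e * r i `^ e) * A ^+ M * E (r i) i.2 x ^- N1 *
   (K * (r i `^ b * r i `^ g) * U))).
  by apply: ler_wpM2l => //; pos.
rewrite [leLHS](_ : _ = (Ca * A ^+ dimN S * A ^+ M * K ^+ 2 * E (r i) i.2 x ^- N1 * U) *
  ((r i `^ eta)^-1 * (r i `^ e * r i `^ e * r i `^ g))); last first.
  by field; rewrite !gt_eqF//; pos.
apply: (@le_trans _ _ ((Ca * A ^+ dimN S * A ^+ M * K ^+ 2 * E (r i) i.2 x ^- N1 * U) *
  (r i)^-1 `^ e)).
  apply: ler_wpM2l; first by pos.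
  by rewrite mulrC ler_pdivrMr; [rewrite [leRHS]mulrC|pos].
by apply: eqle; ring.
Qed.

End Coefficients.

(** Take a finite set whose sum is within [kap] of the supremum of all finite sums; adding one more
    index cannot exceed the supremum. *)
Lemma small_tail (T : eqType) (P : T -> Prop) (w : T -> R) (C kap : R) :
  (forall s, uniq s -> (forall i, i \in s -> P i) -> \sum_(i <- s) w i <= C) ->
  0 < kap ->
  exists s, [/\ uniq s, forall i, i \in s -> P i
    & forall i, P i -> i \notin s -> w i < kap].
Proof.
move=> bd kap0.
pose A_ := [set v | exists s, [/\ uniq s, forall i, i \in s -> P i
   & v = \sum_(i <- s) w i]].
have hs : has_sup A_.
  split; first by exists 0, [::]; rewrite big_nil.
  by exists C => _ [s [us Ps ->]]; exact: bd.
have [_ [s [us Ps ->]] h] := sup_adherent kap0 hs.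
exists s; split => // i Pi is_.
have : \sum_(j <- i :: s) w j <= sup A_.
  apply: sup_upper_bound => //; exists (i :: s); split => //.
    by rewrite /= is_.
  by move=> j; rewrite in_cons => /predU1P[->//|/Ps].
by rewrite big_cons; move: h; lra.
Qed.

Definition tailN : nat := (decayN S + dimN S)%N.
(** The budget of [coef_small] and [coef_large] with M = dimN + 2 and [tailN], the decay needed by
    [sum_reldist], left over for the sum over one generation. *)
Definition expanN : nat := (dimN S + 2 + tailN + dimN S + 1)%N.

(** One power is spent on the sum over generations and [tailN] powers on the sum within each.
    Summability forces the weights to tend to infinity along the indices. *)
Lemma weight_sum (D : reference_grid S) x0 : exists2 C, 0 < C & forall J, windices D J ->
  \sum_(i <- J) (minratio (wscale D i) 1 / E 1 i.2 x0) ^+ tailN.+1 <= C.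
Proof.
have [C C0 HC] := sum_reldist D (leqnn tailN).
have q01 : 0 < delta D < 1 by rewrite delta_gt0 delta_lt1.
have [C' C'0 HC'] := sum_minratio q01 ltr01.
exists (C * C'); first by pos.
move=> J WJ; rewrite (sum_gens J).
apply: (@le_trans _ _ (\sum_(k <- gens J) C * minratio (delta D ^ k) 1 `^ 1)); last first.
  by rewrite -mulr_sumr ler_pM2l//; apply: HC' => //; exact: undup_uniq.
apply: ler_sum => k _; have r0 : 0 < delta D ^ k by rewrite exprz_gt0// delta_gt0.
have m0 : 0 < minratio (delta D ^ k) 1 by apply: minratio_gt0.
have m1 : minratio (delta D ^ k) 1 <= 1 by apply: minratio_le1.
rewrite powRr1; last exact: ltW.
rewrite [leRHS]mulrC; apply: le_trans (ler_wpM2l (ltW m0) (HC J k x0 WJ)).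
rewrite mulr_sumr; apply: ler_sum => i /eqP ik; rewrite /wscale ik exprS.
have e1 : 1 <= E 1 i.2 x0 by exact: reldist_ge1.
have e0 : 0 < E 1 i.2 x0 by pos.
have er0 : 0 < E (delta D ^ k) i.2 x0 by pos.
have h : minratio (delta D ^ k) 1 / E 1 i.2 x0 <= (E (delta D ^ k) i.2 x0)^-1.
  rewrite ler_pdivrMr// mulrC ler_pdivlMr//.
  have [r1|/ltW r1] := leP (delta D ^ k) 1.
    rewrite minratio_le// divr1 /reldist divr1 mulrDr mulr1 mulrCA divff ?gt_eqF// mulr1.
    by rewrite lerD2r.
  apply: (@le_trans _ _ (E (delta D ^ k) i.2 x0)); last exact: reldist_anti.
  by rewrite ler_piMl// ltW.
apply: ler_pM; [by pos|by pos| |].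
  by rewrite ler_pdivrMr// ler_peMr// ltW.
by rewrite -exprVn; apply: lerXn_le h; pos.
Qed.

Lemma weight_tail (D : reference_grid S) x0 (e T : R) : 0 < e -> 0 < T ->
  exists J, windices D J /\ forall i, wav_index D i -> i \notin J ->
    T <= (E 1 i.2 x0 / minratio (wscale D i) 1) `^ e.
Proof.
move=> e0 T0; have [C C0 HC] := weight_sum D x0.
have [J [uJ WJ HJ]] := @small_tail _ (wav_index D) _ C ((T `^ e^-1) ^- tailN.+1)
  (fun s us Ws => HC s (conj us Ws)) ltac:(pos).
exists J; split => // i Wi iJ; have := HJ i Wi iJ.
have m0 : 0 < minratio (wscale D i) 1 by apply: minratio_gt0 => //; pos.
have E0 : 0 < E 1 i.2 x0 by pos.
have T1 : 0 < T `^ e^-1 by pos.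
rewrite -exprVn => h.
have h1 : T `^ e^-1 <= E 1 i.2 x0 / minratio (wscale D i) 1.
  have : minratio (wscale D i) 1 / E 1 i.2 x0 < (T `^ e^-1)^-1.
    rewrite -(ltr_pXn2r (ltn0Sn tailN))// nnegrE; pos.
  rewrite -[_ / E _ _ _]invrK ltf_pV2 ?posrE// invf_div => [/ltW//|]; pos.
have := ge0_ler_powR (ltW e0) (_ : _ \is Num.nneg) (_ : _ \is Num.nneg) h1.
rewrite !nnegrE -powRrM mulVf ?gt_eqF// powRr1 ?(ltW T0)//.
by apply; pos.
Qed.

Lemma coef_sum (D : reference_grid S) x0 eta b g e : 0 <= b -> 0 <= g -> eta <= 1 ->
  0 < e -> b + 2 * e <= eta -> g + 3 * e <= eta ->
  exists2 C, 0 < C & forall Ca (T : int * X -> R), 0 <= Ca ->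
    (forall i, wav_index D i -> [/\ 0 <= T i,
      wscale D i <= 1 -> T i <= Ca * wscale D i `^ eta * E 1 i.2 x0 ^- expanN
      & 1 <= wscale D i -> T i <= Ca * (wscale D i `^ eta)^-1 * (wvol D i)^-1 *
          E (wscale D i) i.2 x0 ^- expanN]) ->
    forall J x, windices D J ->
    \sum_(i <- J) T i * (wscale D i `^ b)^-1 * (E 1 i.2 x0 / minratio (wscale D i) 1) `^ e
       * E (wscale D i) i.2 x ^- expanN <=
    C * Ca * ((V (E 1 x x0) x0)^-1 * (E 1 x x0 `^ b)^-1 * (E 1 x x0 `^ g)^-1).
Proof.
move=> b0 g0 eta1 e0 be ge.
have [C C0 HC] := sum_reldist D (leqnn tailN).
have q01 : 0 < delta D < 1 by rewrite delta_gt0 delta_lt1.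
have [C' C'0 HC'] := sum_minratio q01 e0.
pose M := (dimN S + 2)%N.
pose c1 := A ^+ M * K * V 1 x0.
pose c2 := A ^+ dimN S * A ^+ M * K ^+ 2.
have c10 : 0 < c1 by rewrite /c1; pos.
have c20 : 0 < c2 by rewrite /c2; pos.
exists ((c1 + c2) * (C * C')); first by pos.
move=> Ca T Ca0 HT J x WJ; set U := _ * _ * (_ `^ g)^-1.
have U0 : 0 <= U by rewrite /U; pos.
have term i : i \in J -> T i * (wscale D i `^ b)^-1 *
    (E 1 i.2 x0 / minratio (wscale D i) 1) `^ e * E (wscale D i) i.2 x ^- expanN <=
    (c1 + c2) * Ca * U * (minratio (wscale D i) 1 `^ e * E (wscale D i) i.2 x ^- tailN).
  move=> /(proj2 WJ) Wi; have [T0 h1 h2] := HT i Wi.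
  have Y0 : 0 <= minratio (wscale D i) 1 `^ e * E (wscale D i) i.2 x ^- tailN by pos.
  have [r1|/ltW r1] := leP (wscale D i) 1.
    apply: (le_trans (coef_small b0 g0 eta1 e0 be ge (leqnn _) (leqnn _) x Ca0 r1
      (_ : 0 <= T i <= _))); first by rewrite T0 h1.
    rewrite [leLHS](_ : _ = c1 * Ca * U * (minratio (wscale D i) 1 `^ e *
      E (wscale D i) i.2 x ^- tailN)); last by rewrite /c1 /U; ring.
    apply: ler_wpM2r => //; apply: ler_wpM2r => //; apply: ler_wpM2r => //.
    by rewrite lerDl ltW.
  apply: (le_trans (coef_large b0 g0 eta1 e0 be ge (leqnn _) (leqnn _) x Ca0 r1
      (_ : 0 <= T i <= _))); first by rewrite T0 h2.
  rewrite [leLHS](_ : _ = c2 * Ca * U * (minratio (wscale D i) 1 `^ e *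
      E (wscale D i) i.2 x ^- tailN)); last by rewrite /c2 /U; ring.
  apply: ler_wpM2r => //; apply: ler_wpM2r => //; apply: ler_wpM2r => //.
  by rewrite lerDr ltW.
rewrite big_seq; apply: (le_trans (ler_sum _ term)).
rewrite -big_seq -mulr_sumr.
have -> : (c1 + c2) * (C * C') * Ca * U = (c1 + c2) * Ca * U * (C * C') by ring.
apply: ler_wpM2l; first by pos.
rewrite (sum_gens J); apply: (@le_trans _ _ (\sum_(k <- gens J) C * minratio (delta D ^ k) 1 `^ e)).
  apply: ler_sum => k _; rewrite mulrC.
  apply: le_trans (ler_wpM2l (powR_ge0 _ _) (HC J k x WJ)).
  by rewrite mulr_sumr; apply: ler_sum => i /eqP ik; rewrite /wscale ik.
by rewrite -mulr_sumr ler_pM2l//; apply: HC' => //; exact: undup_uniq.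
Qed.

(** A linear class on which pairings are finite and bilinear; its global Hoelder bound gives the
    continuity that turns smallness in L^2 into pointwise bounds. *)
Definition admissible (eta : R) (f : X -> R) :=
  [/\ measurable_fun setT f, (mu S).-integrable setT (EFin \o f),
    \int[mu S]_x f x = 0, exists c, forall x, `|f x| <= c
  & exists H, forall x x', `|f x - f x'| <= H * d x x' `^ eta].

Lemma admissible_molecule eta N r y c f : 0 < r -> (decayN S <= N)%N ->
  molecule eta N r y c f -> admissible eta f.
Proof.
move=> r0 hN mol; have c0 := molecule_ge0 r0 mol.
have if_ := integrable_molecule r0 hN mol.
have [mf sz hol int0] := mol; split => //.
- by rewrite /Rintegral int0.
- by exists c => x; apply: molecule_le1 mol.
- exists (c * (r^-1) `^ eta * 2) => x x'; apply: (le_trans (hol x x')).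
  rewrite powRM; [|by pos|by pos].
  have h1 := reldist_expN_le1 S N y x r0; have h2 := reldist_expN_le1 S N y x' r0.
  rewrite [leRHS](_ : _ = c * (d x x' `^ eta * r^-1 `^ eta) * 2); last by ring.
  by apply: ler_wpM2l; [pos|lra].
Qed.

Lemma admissible_lin eta f g a : admissible eta f -> admissible eta g ->
  admissible eta (fun x => f x + a * g x).
Proof.
move=> [mf if_ f0 [c hc] [H hH]] [mg ig g0 [c' hc'] [H' hH']].
have iag : (mu S).-integrable setT (EFin \o (fun x => a * g x)).
  have := integrableZl measurableT a ig; by apply: eq_integrable.
split.
- by apply: measurable_funD => //; exact: measurable_funM.
- have := integrableD measurableT if_ iag; by apply: eq_integrable.
- by rewrite RintegralD// RintegralZl// f0 g0 mulr0 addr0.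
- exists (c + `|a| * c') => x; apply: (le_trans (ler_normD _ _)).
  by rewrite normrM lerD// ler_wpM2l.
- exists (H + `|a| * H') => x x'.
  rewrite (_ : _ - _ = (f x - f x') + a * (g x - g x')); last by ring.
  apply: (le_trans (ler_normD _ _)); rewrite normrM mulrDl lerD//.
  by rewrite -mulrA ler_wpM2l.
Qed.

Lemma admissible0 eta : admissible eta (fun=> 0).
Proof.
split.
- exact: measurable_cst.
- exact: integrable0.
- by rewrite Rintegral_cst// mul0r.
- by exists 0 => x; rewrite normr0.
- by exists 0 => x x'; rewrite subrr normr0 mul0r.
Qed.

Lemma admissible_sum eta (I : eqType) (s : seq I) (a : I -> R) (f : I -> X -> R) :
  (forall i, i \in s -> admissible eta (f i)) ->
  admissible eta (fun x => \sum_(i <- s) a i * f i x).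
Proof.
elim: s => [|i s IH] H.
  under eq_fun do rewrite big_nil; exact: admissible0.
under eq_fun do rewrite big_cons addrC.
apply: admissible_lin; last by apply: H; rewrite mem_head.
by apply: IH => j js; apply: H; rewrite in_cons js orbT.
Qed.

Lemma admissible_sub eta f g : admissible eta f -> admissible eta g ->
  admissible eta (fun x => f x - g x).
Proof.
by move=> nf ng; under eq_fun do rewrite -mulN1r; exact: admissible_lin.
Qed.

Lemma admissible_integrableM eta eta' f g : admissible eta f -> admissible eta' g ->
  (mu S).-integrable setT (EFin \o (fun x => f x * g x)).
Proof.
move=> [mf if_ f0 _ _] [mg ig g0 [c hc] _].
apply: (@integrable_dominated _ (fun x => c * `|f x|)).
- exact: measurable_funM.
- have := integrableZl measurableT c (integrable_norm if_).
  by apply: eq_integrable.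
- by move=> x; rewrite normrM mulrC ler_wpM2r.
Qed.

Lemma pairing_lin eta eta' f g h a : admissible eta f -> admissible eta' g -> admissible eta' h ->
  pairing f (fun x => g x + a * h x) = pairing f g + a * pairing f h.
Proof.
move=> nf ng nh; rewrite /pairing.
have i1 := admissible_integrableM nf ng; have i2 := admissible_integrableM nf nh.
rewrite -RintegralZl// -RintegralD//.
  by apply: eq_Rintegral => x _; ring.
have := integrableZl measurableT a i2; by apply: eq_integrable.
Qed.

Lemma pairing_sum eta eta' f (I : eqType) (s : seq I) (a : I -> R) (g : I -> X -> R) :
  admissible eta f -> (forall i, i \in s -> admissible eta' (g i)) ->
  pairing f (fun x => \sum_(i <- s) a i * g i x) = \sum_(i <- s) a i * pairing f (g i).
Proof.
move=> nf; elim: s => [|i s IH] H.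
  rewrite big_nil /pairing /Rintegral.
  by under eq_integral do rewrite big_nil mulr0; rewrite integral0.
have ns j : j \in s -> admissible eta' (g j) by move=> js; apply: H; rewrite in_cons js orbT.
under eq_fun do rewrite big_cons addrC.
rewrite big_cons addrC -IH//.
exact: (pairing_lin (a i) nf (admissible_sum a ns) (H i (mem_head _ _))).
Qed.

Lemma admissible_psi eta (D : reference_grid S) (W : ah_wavelets eta D) i : 0 < eta ->
  wav_index D i -> admissible eta (psi W i).
Proof.
move=> eta0 Wi; have [C C0 HC] := molecule_psi W (decayN S) eta0.
by apply: admissible_molecule (wscale_gt0 D i) (leqnn _) (HC i Wi).
Qed.

Lemma pairing_psi eta (D : reference_grid S) (W : ah_wavelets eta D) i k :
  wav_index D i -> wav_index D k -> pairing (psi W i) (psi W k) = (i == k)%:R.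
Proof.
by move=> Wi Wk; have [_ h _] := psi_basis W; rewrite /pairing /Rintegral h.
Qed.

Lemma pairing_sub eta f g : admissible eta f -> admissible eta g ->
  pairing (fun x => f x - g x) (fun x => f x - g x) =
  pairing f f - 2 * pairing f g + pairing g g.
Proof.
move=> nf ng; have E0 : (fun x => f x - g x) = (fun x => f x + (-1) * g x).
  by apply/funext => x; rewrite mulN1r.
have nh : admissible eta (fun x => f x + (-1) * g x) by exact: admissible_lin.
rewrite E0 (pairing_lin _ nh nf ng) pairingC (pairing_lin _ nf nf ng).
rewrite [X in _ + -1 * X]pairingC (pairing_lin _ ng nf ng) (pairingC g f); ring.
Qed.

(** * Finite wavelet projections *)

Section Projection.
Variables (eta : R) (D : reference_grid S) (W : ah_wavelets eta D) (f : X -> R).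
Hypotheses (eta0 : 0 < eta) (nf : admissible eta f).

Definition wproj (J : seq (int * X)) (x : X) : R :=
  \sum_(i <- J) pairing f (psi W i) * psi W i x.

(** Completing the square: the last sum measures the loss against the projection, for which it
    vanishes. *)
Lemma residual_norm J (a : int * X -> R) : windices D J ->
  let h := fun x => f x - \sum_(i <- J) a i * psi W i x in
  pairing h h = pairing f f - \sum_(i <- J) pairing f (psi W i) ^+ 2 +
    \sum_(i <- J) (a i - pairing f (psi W i)) ^+ 2.
Proof.
move=> [uJ WJ] h.
have npsi i : i \in J -> admissible eta (psi W i) by move=> /WJ Wi; exact: admissible_psi.
have ns : admissible eta (fun x => \sum_(i <- J) a i * psi W i x) by exact: admissible_sum.
rewrite /h (pairing_sub nf ns) (pairing_sum _ nf npsi) (pairing_sum _ ns npsi).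
have -> : \sum_(i <- J) a i * pairing (fun x => \sum_(i <- J) a i * psi W i x) (psi W i) =
    \sum_(i <- J) a i ^+ 2.
  apply: eq_big_seq => i iJ; rewrite pairingC (pairing_sum _ (npsi i iJ) npsi).
  rewrite (bigD1_seq i)//= pairing_psi ?eqxx ?mulr1; [|exact: WJ|exact: WJ].
  rewrite big1_seq ?addr0 ?expr2// => k /andP[ki kJ].
  rewrite pairing_psi; [|exact: WJ|exact: WJ].
  by rewrite eq_sym (negbTE ki) mulr0.
rewrite -[RHS]addrA; have -> : - \sum_(i <- J) pairing f (psi W i) ^+ 2 +
    \sum_(i <- J) (a i - pairing f (psi W i)) ^+ 2 =
    \sum_(i <- J) a i ^+ 2 - 2 * \sum_(i <- J) a i * pairing f (psi W i).
  rewrite mulr_sumr -sumrN -sumrN -!big_split/=; apply: eq_bigr => i _; ring.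
ring.
Qed.

(** Density provides some combination close to [f]; the projection onto its indices together with
    [J0] is at least as close. *)
Lemma wproj_dense J0 kap : 0 < kap -> windices D J0 -> l2 S f ->
  exists J, [/\ windices D J, {subset J0 <= J} &
    pairing (fun x => f x - wproj J x) (fun x => f x - wproj J x) <= kap].
Proof.
move=> kap0 [u0 W0] l2f; have [_ _ /(_ f l2f)] := psi_basis W.
have sk : 0 < Num.sqrt kap by pos.
move=> /(_ _ sk)[n [i [c [Wi hN]]]].
pose J := undup (J0 ++ [seq i m | m <- enum 'I_n]).
have WJ : windices D J.
  split; first exact: undup_uniq.
  by move=> k; rewrite mem_undup mem_cat => /orP[/W0//|/mapP[m _ ->]].
exists J; split => //; first by move=> k kJ; rewrite mem_undup mem_cat kJ.
(* The indices supplied by density may repeat, so the coefficients of equal indices are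
   collected. *)
pose a k := \sum_(m < n | i m == k) c m.
have aE x : \sum_(m < n) c m * psi W (i m) x = \sum_(k <- J) a k * psi W k x.
  under [RHS]eq_bigr do rewrite mulr_suml.
  rewrite (exchange_big_dep xpredT)//=; apply: eq_bigr => m _.
  rewrite big_mkcond/= (bigD1_seq (i m))/=.
  - rewrite eqxx/= big1 ?addr0// => k; rewrite eq_sym => ki.
    by rewrite (negbTE ki).
  - by rewrite mem_undup mem_cat map_f ?orbT// mem_enum.
  - exact: undup_uniq.
have := residual_norm a WJ; set h := fun x => _ => /= hE.
have h1 : pairing h h <= kap.
  have hE2 : (\int[mu S]_x (h x * h x)%:E = 'N[mu S]_2%:E[EFin \o h] `^ 2)%E.
    rewrite poweR_Lnorm//; apply: eq_integral => x _ /=.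
    by rewrite powR_mulrn// real_normK ?num_real// expr2.
  have n0 := Lnorm_ge0 (mu S) 2%:E (EFin \o h).
  have hN' : ('N[mu S]_2%:E[EFin \o h] < (Num.sqrt kap)%:E)%E.
    apply: le_lt_trans hN; rewrite le_eqVlt; apply/orP; left; apply/eqP.
    by apply: eq_Lnorm => x /=; rewrite /h aE.
  rewrite /pairing /Rintegral hE2.
  move: n0 hN'; case: ('N[mu S]_2%:E[EFin \o h])%E => [v| |]//.
  rewrite lee_fin lte_fin => v0 vk; rewrite poweR_EFin/= powR_mulrn//.
  by rewrite -(sqr_sqrtr (ltW kap0)); apply: lerXn_le => //; exact: ltW.
have := residual_norm (fun i => pairing f (psi W i)) WJ; rewrite /= => ->.
rewrite [X in _ + X]big1 ?addr0; last by move=> k _; rewrite subrr expr0n.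
apply: le_trans h1; rewrite hE lerDl; pos.
Qed.

End Projection.

(** The size factor in the norm of G at scale 1, with V_1(x0) + V(x, x0) replaced by the volume, of
    the same order, of the ball of radius 1 + d(x, x0) around [x0]. *)
Definition envelope (x0 : X) (g : R) (x : X) : R :=
  (V (E 1 x x0) x0)^-1 * (E 1 x x0 `^ g)^-1.

(** For e > 0, large far from [x0] and at scales far from 1 in either direction, so that only
    finitely many indices have weight below a given bound. *)
Definition weight (D : reference_grid S) (x0 : X) (e : R) (i : int * X) : R :=
  (E 1 i.2 x0 / minratio (wscale D i) 1) `^ e.

(* Both conditions of [G_bound] for r = 1, up to constants, with the closed
   condition on d(x, x') that [G2_half_bound] requires. *)
Definition test_bound (x0 : X) (b g c : R) (h : X -> R) :=
  (forall x, `|h x| <= c * envelope x0 g x) /\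
  (forall x x', d x x' <= E 1 x x0 / (2 * A) ->
    `|h x - h x'| <= c * (d x x' / E 1 x x0) `^ b * envelope x0 g x).

Lemma reldist_near x0 x x' : d x x' <= E 1 x x0 / (2 * A) -> E 1 x x0 <= 2 * A * E 1 x' x0.
Proof.
move=> h; have A1 := A0_ge1 S; have Ap := A0_gt0 S.
have := dist_quasi S x x0 x'.
have : A * d x x' <= E 1 x x0 / 2.
  rewrite mulrC -ler_pdivlMr//; apply: (le_trans h); apply: eqle; field.
  by rewrite gt_eqF.
rewrite /reldist !divr1 mulrDr => h1 h2.
have h3 : 2 * A * (1 + d x' x0) = 2 * A + 2 * (A * d x' x0) by ring.
rewrite h3; lra.
Qed.

Lemma envelope_near x0 g x x' : 0 <= g -> d x x' <= E 1 x x0 / (2 * A) ->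
  envelope x0 g x' <= K * (2 * A) ^+ dimN S * (2 * A) `^ g * envelope x0 g x.
Proof.
move=> g0 /reldist_near h; have A1 := A0_ge1 S; have Ap := A0_gt0 S.
have a1 : 1 <= 2 * A by lra.
have e0 : 0 < E 1 x x0 by pos.
have e0' : 0 < E 1 x' x0 by pos.
have p0 : 0 < 2 * A * E 1 x' x0 by pos.
have h1 : V (E 1 x x0) x0 <= K * (2 * A) ^+ dimN S * V (E 1 x' x0) x0.
  by apply: le_trans (vol_scale S x0 a1 e0'); apply: vol_mono.
have h2 : E 1 x x0 `^ g <= (2 * A) `^ g * E 1 x' x0 `^ g.
  rewrite -powRM; [|by pos|by pos].
  by apply: ge0_ler_powR; rewrite ?nnegrE// ltW.
rewrite /envelope -!invfM ler_pdivlMr; last by apply: mulr_gt0; pos.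
rewrite mulrC ler_pdivrMr; last by apply: mulr_gt0; pos.
apply: (le_trans (ler_pM (vol_ge0 _ _ _) (powR_ge0 _ _) h1 h2)).
by apply: eqle; ring.
Qed.
(** The constant depends on [r] and [y]: one fixed wavelet is viewed at scale 1 around [x0], to be
    compared with all wavelets of the other family. *)
Lemma molecule_recenter eta N r y c f x0 : 0 < r -> 0 < eta -> molecule eta N r y c f ->
  exists2 c', 0 < c' & molecule eta N 1 x0 c' f.
Proof.
move=> r0 eta0 mol; have c0 := molecule_ge0 r0 mol.
pose k := A * E 1 x0 y * (1 + r).
have k0 : 0 < k by rewrite /k; pos.
have EE x : E r y x ^- N <= k ^+ N * E 1 x0 x ^- N.
  have h : E 1 x0 x <= k * E r y x.
    apply: (le_trans (reldist_tri S x0 y x ltr01)).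
    rewrite /k -[leRHS]mulrA; apply: ler_wpM2l; first by pos.
    rewrite /reldist divr1.
    have -> : (1 + r) * (1 + d y x / r) = 1 + d y x + (r + d y x / r).
      by field; rewrite gt_eqF.
    by rewrite lerDl; pos.
  have p1 : 0 < E 1 x0 x by pos.
  have p2 : 0 < E r y x by pos.
  rewrite ler_pdivlMr; last by pos.
  rewrite mulrC ler_pdivrMr; last by pos.
  by rewrite -exprMn; apply: lerXn_le => //; exact: ltW.
case: mol => mf sz hol i0.
have c1 : 0 < c + 1 by lra.
exists ((c + 1) * k ^+ N * (1 + (r^-1) `^ eta)); first by pos.
have q0 : 0 <= (r^-1) `^ eta by pos.
have p0 x : 0 <= E 1 x0 x ^- N by pos.
have kN0 : 0 <= k ^+ N by pos.
split=> //.
  move=> x; apply: (le_trans (sz x)).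
  apply: (@le_trans _ _ ((c + 1) * (k ^+ N * E 1 x0 x ^- N))).
    by apply: ler_pM => //; [pos|lra].
  rewrite mulrA ler_wpM2r// ler_peMr ?lerDl//; pos.
move=> x x'; apply: (le_trans (hol x x')).
rewrite powRM; [|by pos|by pos].
rewrite divr1 [leLHS](_ : _ = c * r^-1 `^ eta * (d x x' `^ eta * (E r y x ^- N + E r y x' ^- N)));
  last by ring.
rewrite [leRHS](_ : _ = (c + 1) * (1 + r^-1 `^ eta) * (d x x' `^ eta *
  (k ^+ N * E 1 x0 x ^- N + k ^+ N * E 1 x0 x' ^- N))); last by ring.
have D0 : 0 <= d x x' `^ eta by pos.
apply: ler_pM.
- by pos.
- by apply: mulr_ge0 => //; apply: addr_ge0; pos.
- by apply: ler_pM => //; lra.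
- by apply: ler_wpM2l => //; apply: lerD.
Qed.

(** * Tails of the expansion of a wavelet *)

Section Tails.
Variables (eta b g e : R) (D D' : reference_grid S) (x0 : X).
Variables (W : ah_wavelets eta D) (W' : ah_wavelets eta D') (j : int * X).
Hypotheses (eta01 : 0 < eta <= 1) (Wj : wav_index D' j).
Hypotheses (b0 : 0 < b) (g0 : 0 <= g) (e0 : 0 < e).
Hypotheses (be : b + 2 * e <= eta) (ge : g + 3 * e <= eta).
Local Notation a i := (`|pairing (psi W' j) (psi W i)|).

(** The fixed wavelet counts as a molecule of scale 1: psi_i is the finer of the two when its scale
    is at most 1 and the coarser one otherwise. *)
Lemma coef_bound : exists2 Ca, 0 < Ca & forall i, wav_index D i ->
  let T := a i / Num.sqrt (wvol D i) in
  [/\ 0 <= T, wscale D i <= 1 -> T <= Ca * wscale D i `^ eta * E 1 i.2 x0 ^- expanN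
    & 1 <= wscale D i -> T <= Ca * (wscale D i `^ eta)^-1 * (wvol D i)^-1 *
          E (wscale D i) i.2 x0 ^- expanN].
Proof.
have /andP[eta0 _] := eta01.
have [C C0 HC] := molecule_pairing expanN eta01.
have [c c0 Hc] := molecule_psi W (expanN + decayN S).+1 eta0.
have [c' c'0 Hc'] := molecule_psi W' (expanN + decayN S).+1 eta0.
have [k k0 Hk] := molecule_recenter x0 (wscale_gt0 D' j) eta0 (Hc' j Wj).
exists (C * (c * k) * (1 + V 1 x0)); first by pos.
move=> i Wi T; have r0 := wscale_gt0 D i; have v0 := wvol_gt0 D i.
have s0 : 0 < Num.sqrt (wvol D i) by pos.
have sv : wvol D i = Num.sqrt (wvol D i) ^+ 2 by rewrite sqr_sqrtr// ltW.
have V0 : 0 < V 1 x0 by pos.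
have k1 : 1 <= 1 + V 1 x0 by rewrite lerDl ltW.
have k2 : V 1 x0 <= 1 + V 1 x0 by rewrite lerDr.
split; first by rewrite /T; pos.
- move=> r1; have := HC _ _ _ _ _ _ _ _ r0 r1 (Hc i Wi) Hk.
  rewrite pairingC divr1 (reldist_sym S 1 x0) => h.
  rewrite /T ler_pdivrMr//; apply: (le_trans h).
  have -> : V (wscale D i) i.2 = Num.sqrt (wvol D i) ^+ 2 by rewrite -sv.
  rewrite [leLHS](_ : _ = C * (c * k) * wscale D i `^ eta * E 1 i.2 x0 ^- expanN *
    Num.sqrt (wvol D i)); last by field; rewrite !gt_eqF//; pos.
  apply: ler_wpM2r; first exact: ltW.
  apply: ler_wpM2r; first by pos.
  apply: ler_wpM2r; first by pos.
  by rewrite ler_peMr//; pos.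
- move=> r1; have := HC _ _ _ _ _ _ _ _ ltr01 r1 Hk (Hc i Wi).
  move=> h; rewrite /T ler_pdivrMr//; apply: (le_trans h).
  have -> : (1 / wscale D i) `^ eta = (wscale D i `^ eta)^-1.
    by rewrite div1r powR_inv// ltW.
  have -> : (wvol D i)^-1 = (Num.sqrt (wvol D i))^-1 ^+ 2 by rewrite exprVn -sv.
  rewrite [leLHS](_ : _ = C * (c * k) * V 1 x0 * ((wscale D i `^ eta)^-1 *
     (Num.sqrt (wvol D i))^-1 * E (wscale D i) i.2 x0 ^- expanN)); last by ring.
  rewrite [leRHS](_ : _ = C * (c * k) * (1 + V 1 x0) * ((wscale D i `^ eta)^-1 *
     (Num.sqrt (wvol D i))^-1 * E (wscale D i) i.2 x0 ^- expanN)); last first.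
    by field; rewrite !gt_eqF//; pos.
  by apply: ler_wpM2r; [pos|apply: ler_wpM2l; [pos|]].
Qed.

(** The sums stay bounded with the weight inserted, so tails over indices of large weight are small.
    This is [coef_sum] with Hoelder exponent 0. *)
Lemma weighted_size : exists2 C, 0 < C & forall J x, windices D J ->
  \sum_(i <- J) a i * weight D x0 e i * `|psi W i x| <= C * envelope x0 g x.
Proof.
move: eta01 (b0) (g0) (e0) (be) (ge) => /andP[eta0 eta1] hb hg he hbe hge.
have [Ca Ca0 HCa] := coef_bound.
have hbe0 : 0 + 2 * e <= eta by lra.
have [C C0 HC] := coef_sum D x0 (lexx 0) hg eta1 he hbe0 hge.
have [c c0 Hc] := molecule_psi W expanN eta0.
exists (c * (C * Ca)); first by pos.
move=> J x WJ; have := HC Ca _ (ltW Ca0) HCa J x WJ.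
rewrite powRr0 invr1 mulr1 -/(envelope x0 g x) => h.
rewrite -mulrA; apply: le_trans (ler_wpM2l (ltW c0) h).
rewrite mulr_sumr big_seq [leRHS]big_seq; apply: ler_sum => i /(proj2 WJ) Wi.
have [_ sz _ _] := Hc i Wi.
rewrite powRr0 invr1 mulr1 -/(weight D x0 e i).
apply: (@le_trans _ _ (a i * weight D x0 e i *
   (c / Num.sqrt (wvol D i) * E (wscale D i) i.2 x ^- expanN))).
  by apply: ler_wpM2l (sz x); rewrite /weight; pos.
by apply: eqle; rewrite /weight; ring.
Qed.

Lemma weighted_diff : exists2 C, 0 < C & forall J x x', windices D J ->
  d x x' <= E 1 x x0 / (2 * A) ->
  \sum_(i <- J) a i * weight D x0 e i * `|psi W i x - psi W i x'| <=
    C * (d x x' / E 1 x x0) `^ b * envelope x0 g x.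
Proof.
move: eta01 (b0) (g0) (e0) (be) (ge) => /andP[eta0 eta1] hb hg he hbe hge.
have [Ca Ca0 HCa] := coef_bound.
have hbeta : 0 < b <= eta by lra.
have [C C0 HC] := coef_sum D x0 (ltW hb) hg eta1 he hbe hge.
have [c c0 Hc] := molecule_psi W expanN eta0.
pose k := K * (2 * A) ^+ dimN S * (2 * A) `^ g.
have k0 : 0 < k by rewrite /k; pos.
pose m := (2 * A) `^ b.
have m0 : 0 < m by rewrite /m; pos.
exists (2 * c * (C * Ca) * (1 + m * k)); first by pos.
move=> J x x' WJ near.
have L0 : 0 < E 1 x x0 by pos.
have L0' : 0 < E 1 x' x0 by pos.
have U0 y : 0 <= envelope x0 g y by rewrite /envelope; pos.
have hx y : \sum_(i <- J) a i / Num.sqrt (wvol D i) * (wscale D i `^ b)^-1 *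
    weight D x0 e i * E (wscale D i) i.2 y ^- expanN <=
    C * Ca * ((E 1 y x0 `^ b)^-1 * envelope x0 g y).
  have := HC Ca _ (ltW Ca0) HCa J y WJ.
  by move=> /le_trans; apply; apply: eqle; rewrite /envelope; ring.
have Lb : (E 1 x' x0 `^ b)^-1 <= m * (E 1 x x0 `^ b)^-1.
  rewrite ler_pdivlMr; last by pos.
  rewrite mulrC ler_pdivrMr; last by pos.
  rewrite /m -powRM; [|by pos|by pos].
  apply: ge0_ler_powR; rewrite ?nnegrE; [exact: ltW|exact: ltW|by pos|].
  exact: reldist_near.
have hsum : \sum_(i <- J) a i / Num.sqrt (wvol D i) * (wscale D i `^ b)^-1 *
    weight D x0 e i * (E (wscale D i) i.2 x ^- expanN + E (wscale D i) i.2 x' ^- expanN) <=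
    C * Ca * (1 + m * k) * ((E 1 x x0 `^ b)^-1 * envelope x0 g x).
  under eq_bigr do rewrite mulrDr; rewrite big_split/=.
  apply: (le_trans (lerD (hx x) (hx x'))).
  have h : (E 1 x' x0 `^ b)^-1 * envelope x0 g x' <=
      m * (E 1 x x0 `^ b)^-1 * (k * envelope x0 g x).
    by apply: ler_pM => //; [pos|exact: envelope_near].
  rewrite -mulrDr -mulrA ler_wpM2l//; first by pos.
  by apply: (le_trans (lerD (lexx _) h)); apply: eqle; ring.
rewrite powRM; [|by pos|by pos].
have -> : (E 1 x x0)^-1 `^ b = (E 1 x x0 `^ b)^-1.
  by rewrite powR_inv// ltW.
rewrite [leRHS](_ : _ = 2 * c * d x x' `^ b * (C * Ca * (1 + m * k) *
  ((E 1 x x0 `^ b)^-1 * envelope x0 g x))); last by ring.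
have dp : 0 <= 2 * c * d x x' `^ b by pos.
apply: le_trans (ler_wpM2l dp hsum).
rewrite mulr_sumr big_seq [leRHS]big_seq; apply: ler_sum => i /(proj2 WJ) Wi.
have r0 := wscale_gt0 D i.
have [_ _ hol _] := molecule_weaken r0 hbeta (leqnn _) (lexx _) (Hc i Wi).
apply: (@le_trans _ _ (a i * weight D x0 e i * (2 * (c / Num.sqrt (wvol D i)) *
   (d x x' / wscale D i) `^ b *
   (E (wscale D i) i.2 x ^- expanN + E (wscale D i) i.2 x' ^- expanN)))).
  by apply: ler_wpM2l (hol x x'); rewrite /weight; pos.
apply: eqle; rewrite powRM; [|by pos|by pos].
have -> : (wscale D i)^-1 `^ b = (wscale D i `^ b)^-1.
  by rewrite powR_inv// ltW.
ring.
Qed.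

End Tails.

Lemma sum_uniq_cat (J0 J : seq (int * X)) (F : int * X -> R) : uniq J0 -> uniq J ->
  {subset J0 <= J} ->
  \sum_(i <- J) F i = \sum_(i <- J0) F i + \sum_(i <- J | i \notin J0) F i.
Proof.
move=> u0 u sub; rewrite (bigID (mem J0))/=; congr (_ + _).
rewrite -big_filter; apply: perm_big; apply: uniq_perm => //; first exact: filter_uniq.
by move=> i; rewrite mem_filter andb_idr// => /sub.
Qed.

Lemma sum_off_le (J0 J : seq (int * X)) (w F : int * X -> R) T :
  (forall i, i \in J -> 0 <= F i) -> 0 < T ->
  (forall i, i \in J -> i \notin J0 -> T <= w i) -> (forall i, 0 <= w i) ->
  \sum_(i <- J | i \notin J0) F i <= T^-1 * \sum_(i <- J) w i * F i.
Proof.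
move=> F0 T0 hT w0; rewrite mulr_sumr big_mkcond/= big_seq [leRHS]big_seq.
apply: ler_sum => i iJ; case: ifPn => iJ0.
  by rewrite mulrA ler_peMl ?F0// mulrC ler_pdivlMr// mul1r hT.
by rewrite mulr_ge0 ?mulr_ge0 ?w0 ?F0// invr_ge0 ltW.
Qed.

(* A continuous residual exceeding the tail bound at x would exceed it on a
   ball around x, so all later residuals would stay away from 0 in L^2. *)
Lemma residual_le eta (D : reference_grid S) (W : ah_wavelets eta D) f J0 x
    (M rho : R) : 0 < eta -> admissible eta f -> l2 S f -> windices D J0 -> 0 < rho ->
  (forall J z, windices D J -> {subset J0 <= J} -> d x z <= rho ->
     `|wproj W f J z - wproj W f J0 z| <= M) ->
  `|f x - wproj W f J0 x| <= M.
Proof.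
move=> eta0 nf l2f WJ0 rho0 tail; rewrite leNgt; apply/negP => big.
pose h z := f z - wproj W f J0 z.
have npr J : windices D J -> admissible eta (wproj W f J).
  by move=> WJ; apply: admissible_sum => i /(proj2 WJ) Wi; exact: admissible_psi.
have nh J : windices D J -> admissible eta (fun z => f z - wproj W f J z).
  by move=> WJ; exact: admissible_sub (npr J WJ).
have [_ _ _ _ [H hH]] := nh J0 WJ0.
pose kap := `|h x| - M.
have kap0 : 0 < kap by rewrite subr_gt0.
pose H' := `|H| + 1.
have H'0 : 0 < H' by rewrite /H' ltr_wpDl.
(* Within this radius the Hoelder bound changes the residual by at most half of the excess [kap]. *)
pose s := Num.min rho ((kap / 2 / H') `^ eta^-1).
have s0 : 0 < s by rewrite /s lt_min rho0/=; pos.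
have hball z : d x z < s -> forall J, windices D J -> {subset J0 <= J} ->
    kap / 2 <= `|f z - wproj W f J z|.
  rewrite lt_min => /andP[z1 z2] J WJ sub.
  have t := tail J z WJ sub (ltW z1).
  have c : `|h x - h z| <= kap / 2.
    apply: (le_trans (hH x z)).
    apply: (@le_trans _ _ (H' * d x z `^ eta)).
      by apply: ler_wpM2r; [pos|rewrite /H'; have := ler_norm H; lra].
    rewrite mulrC -ler_pdivlMr//.
    have -> : kap / 2 / H' = ((kap / 2 / H') `^ eta^-1) `^ eta.
      by rewrite -powRrM mulVf ?gt_eqF// powRr1//; pos.
    by apply: ge0_ler_powR; rewrite ?nnegrE ?powR_ge0 ?dist_ge0 ?ltW.
  have e1 : h x = (h x - h z) + (f z - wproj W f J z) +
      (wproj W f J z - wproj W f J0 z) by rewrite /h; ring.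
  have := ler_normD (h x - h z + (f z - wproj W f J z)) (wproj W f J z - wproj W f J0 z).
  rewrite -e1; have := ler_normD (h x - h z) (f z - wproj W f J z).
  move: c t; rewrite /kap; set n1 := `|_|; set n2 := `|_|; set n3 := `|_|; set n4 := `|_ + _|.
  by lra.
have V0 : 0 < V s x by pos.
have k0 : 0 < (kap / 2) ^+ 2 * V s x / 2 by pos.
(* The target is half of the lower bound that the ball of radius [s] imposes on the squared L^2 norm
   of every later residual. *)
have [J [WJ sub]] := wproj_dense W eta0 nf k0 WJ0 l2f.
apply/negP; rewrite -ltNge.
apply: (@lt_le_trans _ _ ((kap / 2) ^+ 2 * V s x)).
  by rewrite ltr_pdivrMr// ltr_pMr ?ltr1n//; pos.
have nr := nh J WJ; have [mr _ _ _ _] := nr.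
have iq := admissible_integrableM nr nr.
rewrite -lee_fin /pairing /Rintegral fineK; last exact: integrable_fin_num.
rewrite EFinM -mu_ballE//.
have -> : mu S (B x s) = (\int[mu S]_z (\1_(B x s) z)%:E)%E.
  by rewrite integral_indic ?setIT//; exact: sht_ball_measurable.
have mB : measurable_fun setT (\1_(B x s) : X -> R).
  by apply: measurable_indic; exact: sht_ball_measurable.
rewrite -integralZr_ge0//; last by pos.
apply: le_integral_ge0.
- exact: measurable_funM.
- exact: measurable_funM.
- by move=> z; rewrite mulr_ge0 ?indicE//; pos.
- move=> z; rewrite -expr2 indicE; case: (pselect (B x s z)) => Bz.
    rewrite mem_set// mulr1 -[leRHS]real_normK ?num_real//; apply: lerXn_le; first by pos.
    exact: hball.
  by rewrite memNset// mulr0 sqr_ge0.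
Qed.

Lemma wproj_diff eta (D : reference_grid S) (W : ah_wavelets eta D) f J0 J z :
  windices D J0 -> windices D J -> {subset J0 <= J} ->
  wproj W f J z - wproj W f J0 z =
  \sum_(i <- J | i \notin J0) pairing f (psi W i) * psi W i z.
Proof.
move=> [u0 _] [u _] sub; rewrite /wproj (sum_uniq_cat _ u0 u sub).
by rewrite addrAC subrr add0r.
Qed.

(** The size of the residual follows from [residual_le] and the weighted tails. For its differences
    at two points, the part between J0 and a larger J is estimated by the weighted tails of
    differences, and the part beyond J by its size, which is made smaller than any [kap]; this J may
    depend on the two points. *)
Lemma wavelet_expansion eta b g (D D' : reference_grid S) (W : ah_wavelets eta D)
    (W' : ah_wavelets eta D') j x0 eps :
  0 < eta <= 1 -> wav_index D' j -> 0 < b < eta -> 0 <= g < eta -> 0 < eps ->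
  exists J, windices D J /\
    test_bound x0 b g eps (fun x => psi W' j x - wproj W (psi W' j) J x).
Proof.
move=> eta01 Wj /andP[b0 beta] /andP[g0 geta] eps0.
have /andP[eta0 eta1] := eta01.
have [e [e0 be ge]] : exists e, [/\ 0 < e, b + 2 * e <= eta & g + 3 * e <= eta].
  exists (Num.min (eta - b) (eta - g) / 4).
  have h1 : Num.min (eta - b) (eta - g) <= eta - b by rewrite ge_min lexx.
  have h2 : Num.min (eta - b) (eta - g) <= eta - g by rewrite ge_min lexx orbT.
  have h3 : 0 < Num.min (eta - b) (eta - g) by rewrite lt_min !subr_gt0 beta.
  by split; lra.
have [C1 C10 HC1] := weighted_size x0 W W' eta01 Wj b0 g0 e0 be ge.
have [C2 C20 HC2] := weighted_diff x0 W W' eta01 Wj b0 g0 e0 be ge.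
have nf := admissible_psi W' eta0 Wj.
have l2f : l2 S (psi W' j) by have [h _ _] := psi_basis W'; exact: h.
pose k := K * (2 * A) ^+ dimN S * (2 * A) `^ g.
have k0 : 0 < k by rewrite /k; pos.
pose off (J0 : seq (int * X)) (T : R) :=
  forall i, wav_index D i -> i \notin J0 -> T <= weight D x0 e i.
have w0 i : 0 <= weight D x0 e i by rewrite /weight; pos.
have U0 x : 0 <= envelope x0 g x by rewrite /envelope; pos.
have sizeT J0 T x : windices D J0 -> 0 < T -> off J0 T ->
    `|psi W' j x - wproj W (psi W' j) J0 x| <= C1 * k / T * envelope x0 g x.
  move=> WJ0 T0 HT.
  have r0 : 0 < E 1 x x0 / (2 * A) by pos.
  apply: (residual_le (W := W) eta0 nf l2f WJ0 r0) => J z WJ sub near.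
  rewrite wproj_diff//; apply: (le_trans (ler_norm_sum _ _ _)).
  under eq_bigr do rewrite normrM.
  apply: (le_trans (sum_off_le _ T0 (w := weight D x0 e) _ w0)).
  - by move=> i _; pos.
  - by move=> i iJ; apply: HT; exact: (proj2 WJ).
  apply: (@le_trans _ _ (T^-1 * (C1 * envelope x0 g z))).
    apply: ler_wpM2l; first by pos.
    by apply: le_trans (HC1 J z WJ); apply: eqle; apply: eq_bigr => i _; ring.
  apply: (@le_trans _ _ (T^-1 * (C1 * (k * envelope x0 g x)))).
    apply: ler_wpM2l; first by pos.
    by apply: ler_wpM2l; [pos|exact: envelope_near].
  by apply: eqle; ring.
(* Off [J0] all weights are at least [T]; dividing the weighted bounds by [T] leaves at most [eps]
   in both the size and the Hoelder condition. *)
pose T := (C1 * k + C2) / eps.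
have T0 : 0 < T by rewrite /T; pos.
have [J0 [WJ0 HJ0]] := weight_tail D x0 e0 T0.
have ht c : 0 <= c -> c <= C1 * k + C2 -> c / T <= eps.
  move=> c0 cle; rewrite ler_pdivrMr// /T mulrC divfK// gt_eqF//.
exists J0; split => //; split.
  move=> x; apply: (le_trans (sizeT J0 T x WJ0 T0 HJ0)).
  apply: ler_wpM2r => //; apply: ht; first by pos.
  by rewrite lerDl ltW.
move=> x x' near.
apply/ler_addgt0Pr => kap kap0.
pose T' := C1 * k * (envelope x0 g x + envelope x0 g x') / kap + 1.
have T'0 : 0 < T'.
  by apply: ltr_wpDl => //; apply: mulr_ge0; [apply: mulr_ge0; [pos|exact: addr_ge0]|pos].
have [J1 [WJ1 HJ1]] := weight_tail D x0 e0 T'0.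
pose J := undup (J0 ++ J1).
have WJ : windices D J.
  split; first exact: undup_uniq.
  by move=> i; rewrite mem_undup mem_cat => /orP[/(proj2 WJ0)|/(proj2 WJ1)].
have sub : {subset J0 <= J} by move=> i iJ; rewrite mem_undup mem_cat iJ.
have HJ : off J T'.
  by move=> i Wi; rewrite mem_undup mem_cat negb_or => /andP[_]; exact: HJ1.
have s1 := sizeT J T' x WJ T'0 HJ; have s2 := sizeT J T' x' WJ T'0 HJ.
have s3 : `|psi W' j x - wproj W (psi W' j) J x| +
    `|psi W' j x' - wproj W (psi W' j) J x'| <= kap.
  apply: (le_trans (lerD s1 s2)); rewrite -mulrDr.
  rewrite mulrAC ler_pdivrMr//.
  rewrite [leRHS](_ : _ = C1 * k * (envelope x0 g x + envelope x0 g x') + kap).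
    by rewrite lerDl ltW.
  by rewrite /T'; field; rewrite gt_eqF.
have s4 : `|(wproj W (psi W' j) J x - wproj W (psi W' j) J0 x) -
     (wproj W (psi W' j) J x' - wproj W (psi W' j) J0 x')| <=
    eps * (d x x' / E 1 x x0) `^ b * envelope x0 g x.
  rewrite !wproj_diff// -sumrB; apply: (le_trans (ler_norm_sum _ _ _)).
  under eq_bigr do rewrite -mulrBr normrM.
  apply: (le_trans (sum_off_le _ T0 (w := weight D x0 e) _ w0)).
  - by move=> i _; pos.
  - by move=> i iJ; apply: HJ0; exact: (proj2 WJ).
  apply: (@le_trans _ _ (T^-1 * (C2 * (d x x' / E 1 x x0) `^ b * envelope x0 g x))).
    apply: ler_wpM2l; first by pos.
    by apply: le_trans (HC2 J x x' WJ near); apply: eqle; apply: eq_bigr => i _; ring.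
  have := ht C2 (ltW C20) _; rewrite lerDr => h.
  rewrite [leLHS](_ : _ = C2 / T * ((d x x' / E 1 x x0) `^ b * envelope x0 g x)); last by ring.
  rewrite -[leRHS]mulrA; apply: ler_wpM2r; last by apply: h; pos.
  by apply: mulr_ge0 => //; pos.
set p0 := psi W' j x in s3 *; set p1 := psi W' j x' in s3 *.
set q0 := wproj W _ J x in s3 s4; set q1 := wproj W _ J x' in s3 s4.
set t0 := wproj W _ J0 x in s4 *; set t1 := wproj W _ J0 x' in s4 *.
have -> : p0 - t0 - (p1 - t1) = ((q0 - t0) - (q1 - t1)) + ((p0 - q0) - (p1 - q1)) by ring.
apply: (le_trans (ler_normD _ _)); apply: lerD s4 _.
exact: le_trans (ler_normB _ _) s3.
Qed.

End Wavelets.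

(** * Test functions and distributions *)

Section TestFunctions.
Context (R : realType) (disp : measure_display) (X : measurableType disp).
Variables (S : sht R X) (x0 : X).
Local Notation d := (dist S).
Local Notation B := (qball (dist S)).
Local Notation V := (vol S).
Local Notation A := (A0 S).
Local Notation K := (Cmu S).
Local Notation E := (reldist S).

Lemma reldist1E x : E 1 x x0 = 1 + d x x0.
Proof. by rewrite /reldist divr1. Qed.

Lemma envelope_gt0 g x : 0 < envelope S x0 g x.
Proof. rewrite /envelope; pos. Qed.

Lemma test_bound_ge0 b g c f : test_bound S x0 b g c f -> 0 <= c.
Proof.
move=> [h _]; have := le_trans (normr_ge0 _) (h x0).
by rewrite pmulr_lge0// envelope_gt0.
Qed.

Lemma vol0 x : V 0 x = 0.
Proof.
rewrite /vol; have -> : B x 0 = set0; last by rewrite measure0.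
by apply/seteqP; split=> // y; rewrite /qball/= ltNge dist_ge0.
Qed.

(** Compares V_1(x0) plus V(x, x0) or V(x0, x) with the volume of the ball of radius 1 + d(x, x0)
    around [x0]. *)
Definition volK : R := 1 + K * (2 * A) ^+ dimN S.

Lemma volK_gt0 : 0 < volK.
Proof. rewrite /volK; pos. Qed.

Lemma vol_pair_le x : V 1 x0 + Vol S x x0 <= volK * V (E 1 x x0) x0.
Proof.
have A1 := A0_ge1 S; have Ap := A0_gt0 S.
have a1 : 1 <= 2 * A by lra.
have E0 : 0 < E 1 x x0 by pos.
have E1 : 1 <= E 1 x x0 by exact: reldist_ge1.
rewrite /volK mulrDl mul1r; apply: lerD; first exact: vol_mono.
rewrite /Vol; have := dist_ge0 S x x0; rewrite le_eqVlt => /orP[/eqP <-|d0].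
  by rewrite vol0; pos.
apply: le_trans (vol_scale S x0 a1 E0).
apply: vol_sub => //; first by pos.
move=> y; rewrite /qball/= => xy.
apply: (le_lt_trans (dist_quasi S x0 y x)); rewrite (dist_sym S x0).
rewrite (_ : 2 * A * E 1 x x0 = A * (2 * E 1 x x0)); last by ring.
by rewrite ltr_pM2l// reldist1E mulrDr; lra.
Qed.

Lemma vol_pair_le_sym x : V 1 x0 + Vol S x0 x <= volK * V (E 1 x x0) x0.
Proof.
have A1 := A0_ge1 S; have K1 := Cmu_ge1 S.
have E0 : 0 < E 1 x x0 by pos.
have E1 : 1 <= E 1 x x0 by exact: reldist_ge1.
rewrite /volK mulrDl mul1r; apply: lerD; first exact: vol_mono.
apply: (@le_trans _ _ (V (E 1 x x0) x0)); last first.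
  rewrite ler_peMl//; first by pos.
  by apply: mulr_ege1 => //; apply: exprn_ege1; lra.
rewrite /Vol (dist_sym S x0); have := dist_ge0 S x x0.
rewrite le_eqVlt => /orP[/eqP <-|d0]; first by rewrite vol0; pos.
by apply: vol_mono => //; rewrite reldist1E lerDr.
Qed.

Lemma envelope_le (v g : R) x : 0 < v -> v <= volK * V (E 1 x x0) x0 ->
  envelope S x0 g x <= volK * v^-1 * (1 / (1 + d x x0)) `^ g.
Proof.
move=> v0 hv; have E0 : 0 < E 1 x x0 by pos.
have -> : (1 / (1 + d x x0)) `^ g = (E 1 x x0 `^ g)^-1.
  by rewrite -reldist1E div1r powR_inv// ltW.
rewrite /envelope ler_pM2r; last by pos.
rewrite ler_pdivlMr//.
by rewrite mulrC ler_pdivrMr//; pos.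
Qed.

Lemma vol_pair_gt0 x : 0 < V 1 x0 + Vol S x x0.
Proof. by rewrite /Vol ltr_pwDl//; pos. Qed.

Lemma vol_pair_gt0_sym x : 0 < V 1 x0 + Vol S x0 x.
Proof. by rewrite /Vol ltr_pwDl//; pos. Qed.

Lemma test_bound_G b g c f : test_bound S x0 b g c f ->
  G_bound S x0 1 b g f (volK * c).
Proof.
move=> tb; have c0 := test_bound_ge0 tb; have [sz hol] := tb.
have env x := envelope_le g (vol_pair_gt0 x) (vol_pair_le x).
split=> [x|x y xy].
  apply: (le_trans (sz x)); apply: (le_trans (ler_wpM2l c0 (env x))).
  by apply: eqle; ring.
apply: (le_trans (hol x y _)).
  by rewrite reldist1E mulrC ltW.
rewrite reldist1E; apply: (le_trans (ler_wpM2l _ (env x))); first by pos.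
by apply: eqle; ring.
Qed.

Lemma G_bound_ge0 b g f C : G_bound S x0 1 b g f C -> 0 <= C.
Proof.
move=> [h _]; have := le_trans (normr_ge0 _) (h x0); rewrite -mulrA.
rewrite pmulr_lge0//; apply: mulr_gt0.
  by rewrite invr_gt0 vol_pair_gt0.
by rewrite distxx addr0 divr1 powR1.
Qed.

Lemma G_norm_ge0 b g f : 0 <= G_norm S x0 1 b g f.
Proof.
rewrite /G_norm; have [->|/set0P ne] := eqVneq [set C | G_bound S x0 1 b g f C] set0.
  by rewrite inf0.
by apply: lb_le_inf => // C; exact: G_bound_ge0.
Qed.

Lemma G_norm_test b g c f : test_bound S x0 b g c f -> G_norm S x0 1 b g f <= volK * c.
Proof.
move=> /test_bound_G h; apply: ge_inf => //.
by exists 0 => C; exact: G_bound_ge0.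
Qed.

Lemma test_bound_lin b g c c' f h a : test_bound S x0 b g c f -> test_bound S x0 b g c' h ->
  test_bound S x0 b g (c + `|a| * c') (fun x => f x + a * h x).
Proof.
move=> [sz hol] [sz' hol']; split=> [x|x x' near].
  apply: (le_trans (ler_normD _ _)); rewrite normrM mulrDl lerD//.
  by rewrite -mulrA ler_wpM2l.
rewrite (_ : _ - _ = (f x - f x') + a * (h x - h x')); last by ring.
apply: (le_trans (ler_normD _ _)); rewrite normrM !mulrDl lerD ?hol//.
by rewrite -2!mulrA ler_wpM2l// mulrA hol'.
Qed.

Lemma test_bound0 b g : test_bound S x0 b g 0 (fun=> 0).
Proof. by split=> [x|x x' _]; rewrite ?subrr normr0 !mul0r. Qed.

Lemma test_bound_scale b g c f a : test_bound S x0 b g c f ->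
  test_bound S x0 b g (`|a| * c) (fun x => a * f x).
Proof.
move=> h; have := test_bound_lin a (test_bound0 b g) h.
by rewrite add0r; under eq_fun do rewrite add0r.
Qed.

Lemma test_bound_weaken b b' g c f : 0 < b <= b' -> test_bound S x0 b' g c f ->
  test_bound S x0 b g c f.
Proof.
move=> /andP[b0 bb] tb; have c0 := test_bound_ge0 tb; have [sz hol] := tb.
have A1 := A0_ge1 S; have Ap := A0_gt0 S.
split=> // x x' near; apply: (le_trans (hol x x' near)).
apply: ler_wpM2r; first exact: ltW (envelope_gt0 _ _).
apply: ler_wpM2l => //.
have q0 : 0 <= d x x' / E 1 x x0 by pos.
have [->|qp] := eqVneq (d x x' / E 1 x x0) 0.
  by rewrite !powR0// gt_eqF//; lra.
apply: ger_powR => //; rewrite lt0r qp q0/=.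
rewrite ler_pdivrMr; last by pos.
apply: (le_trans near); rewrite mul1r ler_pdivrMr; last by pos.
by rewrite ler_peMr//; [pos|lra].
Qed.

(** A linear class of one-variable factors whose tensor products lie in G(eta1, eta2; g1, g2), the
    space whose closure is [G_ring]. *)
Definition testf (eta g : R) (f : X -> R) :=
  admissible S eta f /\ exists c, test_bound S x0 eta g c f.

Lemma testf_lin eta g f h a : testf eta g f -> testf eta g h ->
  testf eta g (fun x => f x + a * h x).
Proof.
move=> [nf [c hc]] [nh [c' hc']]; split; first exact: admissible_lin.
by exists (c + `|a| * c'); exact: test_bound_lin.
Qed.

Lemma testf0 eta g : testf eta g (fun=> 0).
Proof. by split; [exact: admissible0|exists 0; exact: test_bound0]. Qed.

Lemma testf_scale eta g f a : testf eta g f -> testf eta g (fun x => a * f x).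
Proof.
move=> h; have := testf_lin a (testf0 eta g) h.
by under eq_fun do rewrite add0r.
Qed.

Lemma testf_sum eta g (I : eqType) (s : seq I) (a : I -> R) (f : I -> X -> R) :
  (forall i, i \in s -> testf eta g (f i)) ->
  testf eta g (fun x => \sum_(i <- s) a i * f i x).
Proof.
elim: s => [|i s IH] H.
  under eq_fun do rewrite big_nil; exact: testf0.
under eq_fun do rewrite big_cons addrC.
apply: testf_lin; last by apply: H; rewrite mem_head.
by apply: IH => j js; apply: H; rewrite in_cons js orbT.
Qed.

Lemma testf_G eta b g f : 0 < b <= eta -> testf eta g f -> G S x0 1 b g f.
Proof.
move=> hb [[mf if_ f0 _ _] [c hc]]; split => //.
  rewrite -[LHS]fineK; last exact: integrable_fin_num.
  by congr EFin; exact: f0.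
by exists (volK * c); apply: test_bound_G; exact: test_bound_weaken hc.
Qed.

Lemma testf_psi eta g (D : reference_grid S) (W : ah_wavelets eta D) i : 0 < eta <= 1 ->
  0 <= g <= 1 -> wav_index D i -> testf eta g (psi W i).
Proof.
move=> /andP[eta0 eta1] /andP[g0 g1] Wi; split; first exact: admissible_psi.
(* [dimN] powers pay for the volume in the envelope, one for the decay [g <= 1], and one for
   dividing distances by 1 + d(x, x0) in the Hoelder condition. *)
pose N := (dimN S + 2)%N.
have [C C0 HC] := molecule_psi W N eta0.
have [c c0 [mf sz hol _]] := molecule_recenter x0 (wscale_gt0 D i) eta0 (HC i Wi).
have A1 := A0_ge1 S; have Ap := A0_gt0 S.
have a1 : 1 <= (2 * A) ^+ N by apply: exprn_ege1; lra.
pose k := K * V 1 x0.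
have k0 : 0 < k by rewrite /k; pos.
have env x : E 1 x x0 * E 1 x0 x ^- N <= k * envelope S x0 g x.
  have E1 : 1 <= E 1 x x0 by exact: reldist_ge1.
  have E0 : 0 < E 1 x x0 by pos.
  rewrite /envelope (reldist_sym S 1 x0) -invfM ler_pdivlMr; last by apply: mulr_gt0; pos.
  rewrite mulrC mulrA ler_pdivrMr; last by pos.
  have h1 : V (E 1 x x0) x0 <= K * E 1 x x0 ^+ dimN S * V 1 x0.
    by have := vol_scale S x0 E1 ltr01; rewrite mulr1.
  have h2 : E 1 x x0 `^ g <= E 1 x x0 by exact: powR_le_id.
  apply: (@le_trans _ _ (K * E 1 x x0 ^+ dimN S * V 1 x0 * E 1 x x0 * E 1 x x0)).
    apply: ler_wpM2r; first exact: ltW.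
    by apply: ler_pM => //; pos.
  by apply: eqle; rewrite /N /k exprD; ring.
have U0 x := envelope_gt0 g x.
have Np x : 0 <= E 1 x0 x ^- N by pos.
exists (c * (k * (1 + (2 * A) ^+ N))); split=> [x|x x' near].
  apply: (le_trans (sz x)); rewrite -mulrA ler_pM2l//.
  apply: (@le_trans _ _ (k * envelope S x0 g x)).
    by apply: le_trans (env x); rewrite ler_peMl//; exact: reldist_ge1.
  rewrite -mulrA ler_pM2l//; have := U0 x; set u := envelope _ _ _ _.
  by move=> u0; rewrite ler_peMl//; [exact: ltW|lra].
have E0 : 0 < E 1 x x0 by pos.
have E0' : 0 < E 1 x' x0 by pos.
have E1 : 1 <= E 1 x x0 by exact: reldist_ge1.
apply: (le_trans (hol x x')); rewrite divr1.
have s1 : E 1 x0 x ^- N + E 1 x0 x' ^- N <= (1 + (2 * A) ^+ N) * E 1 x0 x ^- N.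
  rewrite mulrDl mul1r lerD2l !(reldist_sym S 1 x0).
  rewrite ler_pdivlMr; last by pos.
  rewrite mulrC ler_pdivrMr; last by pos.
  rewrite -exprMn; apply: lerXn_le; first exact: ltW.
  exact: reldist_near.
have s2 : d x x' `^ eta <= (d x x' / E 1 x x0) `^ eta * E 1 x x0.
  have {1}-> : d x x' = d x x' / E 1 x x0 * E 1 x x0 by rewrite divfK// gt_eqF.
  rewrite powRM; [|by pos|by pos].
  by apply: ler_wpM2l; [pos|exact: powR_le_id].
rewrite -mulrA -[leRHS]mulrA -[leRHS]mulrA ler_pM2l//.
apply: (le_trans (ler_pM (powR_ge0 _ _) (addr_ge0 (Np x) (Np x')) s2 s1)).
rewrite [leLHS](_ : _ = (d x x' / E 1 x x0) `^ eta * (1 + (2 * A) ^+ N) *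
  (E 1 x x0 * E 1 x0 x ^- N)); last by ring.
rewrite [leRHS](_ : _ = (d x x' / E 1 x x0) `^ eta * (1 + (2 * A) ^+ N) *
  (k * envelope S x0 g x)); last by ring.
by apply: ler_wpM2l => //; apply: mulr_ge0; [pos|lra].
Qed.

End TestFunctions.

Lemma tensor_half_bound (R : realType) (d1 d2 : measure_display)
    (X1 : measurableType d1) (X2 : measurableType d2)
    (S1 : sht R X1) (S2 : sht R X2) x0 y0 b1 b2 g1 g2 c1 c2 f1 f2 :
  test_bound S1 x0 b1 g1 c1 f1 -> test_bound S2 y0 b2 g2 c2 f2 ->
  G2_half_bound S1 S2 x0 y0 1 1 b1 b2 g1 g2 (fun x y => f1 x * f2 y)
    (volK S1 * volK S2 * (c1 * c2)).
Proof.
move=> t1 t2; have c10 := test_bound_ge0 t1; have c20 := test_bound_ge0 t2.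
have [sz hol] := t2.
have k10 := volK_gt0 S1.
have env y := envelope_le g2 (vol_pair_gt0_sym S2 y0 y) (vol_pair_le_sym S2 y0 y).
have Gs a : G_norm S1 x0 1 b1 g1 (fun x => f1 x * a) <= volK S1 * (`|a| * c1).
  under eq_fun do rewrite mulrC.
  by apply: G_norm_test; exact: test_bound_scale.
split=> [y|y y' near].
  apply: (le_trans (Gs _)).
  apply: (@le_trans _ _ (volK S1 * (c2 * envelope S2 y0 g2 y * c1))).
    by apply: ler_wpM2l; [exact: ltW|apply: ler_wpM2r].
  apply: (@le_trans _ _ (volK S1 * c2 * c1 * envelope S2 y0 g2 y)).
    by apply: eqle; ring.
  apply: (le_trans (ler_wpM2l _ (env y))); first by pos.
  by apply: eqle; ring.
under eq_fun do rewrite -mulrBr.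
apply: (le_trans (Gs _)).
have near' : dist S2 y y' <= reldist S2 1 y y0 / (2 * A0 S2) by rewrite reldist1E.
have := hol y y' near'; rewrite reldist1E => h.
apply: (@le_trans _ _ (volK S1 * (c2 * (dist S2 y y' / (1 + dist S2 y y0)) `^ b2 *
   envelope S2 y0 g2 y * c1))).
  by apply: ler_wpM2l; [exact: ltW|apply: ler_wpM2r].
apply: (@le_trans _ _ (volK S1 * c2 * c1 * (dist S2 y y' / (1 + dist S2 y y0)) `^ b2 *
   envelope S2 y0 g2 y)).
  by apply: eqle; ring.
apply: (le_trans (ler_wpM2l _ (env y))); first by pos.
by apply: eqle; ring.
Qed.

(** * Tensor products as test functions *)

Section Tensors.
Context (R : realType) (d1 d2 : measure_display).
Context (X1 : measurableType d1) (X2 : measurableType d2).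
Variables (S1 : sht R X1) (S2 : sht R X2) (x0 : X1) (y0 : X2).

Lemma tensor_bound b1 b2 g1 g2 c1 c2 f1 f2 :
  test_bound S1 x0 b1 g1 c1 f1 -> test_bound S2 y0 b2 g2 c2 f2 ->
  G2_bound S1 S2 x0 y0 1 1 b1 b2 g1 g2 (fun x y => f1 x * f2 y)
    (volK S1 * volK S2 * (c1 * c2)).
Proof.
move=> t1 t2; split; first exact: tensor_half_bound.
under eq_fun => y do under eq_fun => x do rewrite mulrC.
rewrite (_ : volK S1 * _ * _ = volK S2 * volK S1 * (c2 * c1)); last by ring.
exact: tensor_half_bound.
Qed.

Lemma G2_bound_ge0 b1 b2 g1 g2 f C : G2_bound S1 S2 x0 y0 1 1 b1 b2 g1 g2 f C -> 0 <= C.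
Proof.
move=> [[h _] _]; have := le_trans (G_norm_ge0 _ _ _ _ _) (h y0); rewrite -mulrA.
rewrite pmulr_lge0//; apply: mulr_gt0.
  by rewrite invr_gt0; exact: vol_pair_gt0.
by rewrite distxx addr0 divr1 powR1.
Qed.

Lemma G2_norm_le b1 b2 g1 g2 f C : G2_bound S1 S2 x0 y0 1 1 b1 b2 g1 g2 f C ->
  G2_norm S1 S2 x0 y0 1 1 b1 b2 g1 g2 f <= C.
Proof.
move=> h; apply: ge_inf => //.
by exists 0 => c; exact: G2_bound_ge0.
Qed.

Variables (eta1 eta2 b1 b2 g1 g2 : R).
Hypotheses (hb1 : 0 < b1 < eta1) (hb2 : 0 < b2 < eta2).

Lemma tensor_G2 e1 e2 f1 f2 : 0 < e1 <= eta1 -> 0 < e2 <= eta2 ->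
  testf S1 x0 eta1 g1 f1 -> testf S2 y0 eta2 g2 f2 ->
  G2 S1 S2 x0 y0 1 1 e1 e2 g1 g2 (fun x y => f1 x * f2 y).
Proof.
move=> he1 he2 t1 t2; split.
- move=> y; apply: (testf_G he1); under eq_fun do rewrite mulrC; exact: testf_scale.
- move=> x; apply: (testf_G he2); exact: testf_scale.
- have [_ [c1 h1]] := t1; have [_ [c2 h2]] := t2.
  exists (volK S1 * volK S2 * (c1 * c2)); apply: tensor_bound.
    exact: test_bound_weaken h1.
  exact: test_bound_weaken h2.
Qed.

(** Such a tensor product already has the full regularity eta1, eta2, so it serves as its own
    approximation. *)
Lemma tensor_G_ring f1 f2 : testf S1 x0 eta1 g1 f1 -> testf S2 y0 eta2 g2 f2 ->
  G_ring S1 S2 x0 y0 eta1 eta2 b1 b2 g1 g2 (fun x y => f1 x * f2 y).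
Proof.
move: hb1 hb2 => /andP[b10 be1] /andP[b20 be2] t1 t2.
have e10 := lt_trans b10 be1; have e20 := lt_trans b20 be2.
split; first by apply: tensor_G2 => //; rewrite ?b10 ?b20 ltW.
move=> e e0; exists (fun x y => f1 x * f2 y).
  by apply: tensor_G2 => //; rewrite ?e10 ?e20 lexx.
apply: le_lt_trans e0.
have -> : (fun x y => f1 x * f2 y - f1 x * f2 y) = (fun (x : X1) (y : X2) => 0 * 0 : R).
  by apply/funext => x; apply/funext => y; rewrite subrr mulr0.
rewrite -[leRHS](mulr0 (volK S1 * volK S2)) -[in leRHS](mulr0 0).
apply: G2_norm_le; apply: (@tensor_bound b1 b2 g1 g2 0 0 (fun=> 0) (fun=> 0)).
  exact: test_bound0.
exact: test_bound0.
Qed.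

Section Distributions.
Variable F : (X1 -> X2 -> R) -> R.
Hypothesis HF : distributions S1 S2 x0 y0 eta1 eta2 b1 b2 g1 g2 F.

Lemma distr_lin1 f h k a : testf S1 x0 eta1 g1 f -> testf S1 x0 eta1 g1 h ->
  testf S2 y0 eta2 g2 k ->
  F (fun x y => (f x + a * h x) * k y) =
  F (fun x y => f x * k y) + a * F (fun x y => h x * k y).
Proof.
move=> tf th tk; have [_ lin _] := HF.
rewrite addrC -lin; [|exact: tensor_G_ring|exact: tensor_G_ring].
by congr F; apply/funext => x; apply/funext => y; ring.
Qed.

Lemma distr_lin2 f h k a : testf S2 y0 eta2 g2 f -> testf S2 y0 eta2 g2 h ->
  testf S1 x0 eta1 g1 k ->
  F (fun x y => k x * (f y + a * h y)) =
  F (fun x y => k x * f y) + a * F (fun x y => k x * h y).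
Proof.
move=> tf th tk; have [_ lin _] := HF.
rewrite addrC -lin; [|exact: tensor_G_ring|exact: tensor_G_ring].
by congr F; apply/funext => x; apply/funext => y; ring.
Qed.

Lemma distr_zero : F (fun _ _ => 0) = 0.
Proof.
have [_ lin _] := HF.
have h : G_ring S1 S2 x0 y0 eta1 eta2 b1 b2 g1 g2 (fun (x : X1) (y : X2) => 0 * 0 : R).
  by apply: (@tensor_G_ring (fun=> 0) (fun=> 0)); exact: testf0.
have := lin 1 _ _ h h.
have -> : (fun (x : X1) (y : X2) => 1 * (0 * 0) + 0 * 0 : R) = (fun _ _ => 0).
  by apply/funext => x; apply/funext => y; ring.
have -> : (fun (x : X1) (y : X2) => 0 * 0 : R) = (fun _ _ => 0).
  by apply/funext => x; apply/funext => y; ring.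
by rewrite mul1r => h1; lra.
Qed.

Lemma distr_sum1 (I : eqType) (s : seq I) (a : I -> R) (f : I -> X1 -> R) k :
  (forall i, i \in s -> testf S1 x0 eta1 g1 (f i)) -> testf S2 y0 eta2 g2 k ->
  F (fun x y => (\sum_(i <- s) a i * f i x) * k y) =
  \sum_(i <- s) a i * F (fun x y => f i x * k y).
Proof.
move=> + tk; elim: s => [|i s IH] H.
  rewrite big_nil -[RHS]distr_zero.
  by congr F; apply/funext => x; apply/funext => y; rewrite big_nil mul0r.
have ts : forall j, j \in s -> testf S1 x0 eta1 g1 (f j).
  by move=> j js; apply: H; rewrite in_cons js orbT.
rewrite big_cons -IH// addrC -distr_lin1//.
- by congr F; apply/funext => x; apply/funext => y; rewrite big_cons addrC.
- exact: testf_sum.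
- by apply: H; rewrite mem_head.
Qed.

Lemma distr_sum2 (I : eqType) (s : seq I) (a : I -> R) (f : I -> X2 -> R) k :
  (forall i, i \in s -> testf S2 y0 eta2 g2 (f i)) -> testf S1 x0 eta1 g1 k ->
  F (fun x y => k x * (\sum_(i <- s) a i * f i y)) =
  \sum_(i <- s) a i * F (fun x y => k x * f i y).
Proof.
move=> + tk; elim: s => [|i s IH] H.
  rewrite big_nil -[RHS]distr_zero.
  by congr F; apply/funext => x; apply/funext => y; rewrite big_nil mulr0.
have ts : forall j, j \in s -> testf S2 y0 eta2 g2 (f j).
  by move=> j js; apply: H; rewrite in_cons js orbT.
rewrite big_cons -IH// addrC -distr_lin2//.
- by congr F; apply/funext => x; apply/funext => y; rewrite big_cons addrC.
- exact: testf_sum.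
- by apply: H; rewrite mem_head.
Qed.

Lemma distr_tensor_le : exists2 C, 0 < C & forall c1 c2 f1 f2,
  testf S1 x0 eta1 g1 f1 -> testf S2 y0 eta2 g2 f2 ->
  test_bound S1 x0 b1 g1 c1 f1 -> test_bound S2 y0 b2 g2 c2 f2 ->
  `|F (fun x y => f1 x * f2 y)| <= C * (c1 * c2).
Proof.
have [_ _ [C HC]] := HF.
have k10 := volK_gt0 S1; have k20 := volK_gt0 S2.
exists ((`|C| + 1) * (volK S1 * volK S2)).
  by apply: mulr_gt0; [rewrite ltr_wpDl|exact: mulr_gt0].
move=> c1 c2 f1 f2 tf1 tf2 tb1 tb2.
have c10 := test_bound_ge0 tb1; have c20 := test_bound_ge0 tb2.
apply: (le_trans (HC _ (tensor_G_ring tf1 tf2))).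
have h := G2_norm_le (tensor_bound tb1 tb2).
have b0 : 0 <= volK S1 * volK S2 * (c1 * c2) by pos.
rewrite -mulrA; apply: (@le_trans _ _ ((`|C| + 1) * G2_norm S1 S2 x0 y0 1 1 b1 b2 g1 g2
    (fun x y => f1 x * f2 y))).
  apply: ler_wpM2r; last by have := ler_norm C; lra.
  have ne : [set C | G2_bound S1 S2 x0 y0 1 1 b1 b2 g1 g2 (fun x y => f1 x * f2 y) C] !=set0.
    by exists (volK S1 * volK S2 * (c1 * c2)); exact: tensor_bound.
  by apply: lb_le_inf => // c; exact: G2_bound_ge0.
by apply: ler_wpM2l.
Qed.

Hypotheses (eta1_lt1 : eta1 < 1) (eta2_lt1 : eta2 < 1).
Hypotheses (hg1 : 0 <= g1 < eta1) (hg2 : 0 <= g2 < eta2).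

(** With projections P and residuals r in each variable, f1 f2 = P1 P2 + P1 r2 + r1 f2. The last two
    terms are small because [F] is bounded on tensor products by the product of the one-variable
    bounds; linearity expands the first. *)
Lemma coefficient_expansion (D1 D1' : reference_grid S1) (D2 D2' : reference_grid S2)
    (W1 : ah_wavelets eta1 D1) (W1' : ah_wavelets eta1 D1')
    (W2 : ah_wavelets eta2 D2) (W2' : ah_wavelets eta2 D2') j1 j2 eps :
  wav_index D1' j1 -> wav_index D2' j2 -> 0 < eps ->
  exists J1 J2, [/\ windices D1 J1, windices D2 J2 &
    `|F (fun x y => psi W1' j1 x * psi W2' j2 y)| <= eps +
    \sum_(i1 <- J1) `|pairing S1 (psi W1' j1) (psi W1 i1)| *
    \sum_(i2 <- J2) `|pairing S2 (psi W2' j2) (psi W2 i2)| *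
      `|F (fun x y => psi W1 i1 x * psi W2 i2 y)|].
Proof.
move: hb1 hb2 eta1_lt1 eta2_lt1 hg1 hg2 => hb1' hb2' e1 e2 hg1' hg2' Wj1 Wj2 eps0.
have he1 : 0 < eta1 <= 1 by lra.
have he2 : 0 < eta2 <= 1 by lra.
have hgg1 : 0 <= g1 <= 1 by lra.
have hgg2 : 0 <= g2 <= 1 by lra.
have hbb1 : 0 < b1 <= eta1 by lra.
have hbb2 : 0 < b2 <= eta2 by lra.
have [C C0 HC] := distr_tensor_le.
have t1 := testf_psi x0 W1' he1 hgg1 Wj1.
have t2 := testf_psi y0 W2' he2 hgg2 Wj2.
have [c1 hc1] := proj2 t1; have [c2 hc2] := proj2 t2.
have {}hc1 := test_bound_weaken hbb1 hc1; have {}hc2 := test_bound_weaken hbb2 hc2.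
have c10 := test_bound_ge0 hc1; have c20 := test_bound_ge0 hc2.
(* The summand [eps] keeps [q] positive and makes [ep] at most 1, so that the bound c1 + ep for P1
   stays below c1 + 1. *)
pose q := C * (c1 + 1 + c2) + eps.
have q0 : 0 < q by apply: ltr_wpDl => //; apply: mulr_ge0; [exact: ltW|lra].
pose ep := eps / q.
have ep0 : 0 < ep by rewrite /ep; pos.
have ep1 : ep <= 1.
  rewrite ler_pdivrMr// mul1r /q lerDr; apply: mulr_ge0; [exact: ltW|lra].
have epC : C * (c1 + 1 + c2) * ep <= eps.
  rewrite /ep mulrA ler_pdivrMr// mulrC ler_wpM2l ?(ltW eps0)// /q lerDl; exact: ltW.
have [J1 [WJ1 r1]] := wavelet_expansion W1 W1' x0 he1 Wj1 hb1' hg1' ep0.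
have [J2 [WJ2 r2]] := wavelet_expansion W2 W2' y0 he2 Wj2 hb2' hg2' ep0.
exists J1, J2; split => //.
set P1 := wproj W1 (psi W1' j1) J1 in r1; set P2 := wproj W2 (psi W2' j2) J2 in r2.
have tp1 i : i \in J1 -> testf S1 x0 eta1 g1 (psi W1 i).
  by move=> /(proj2 WJ1); exact: testf_psi.
have tp2 i : i \in J2 -> testf S2 y0 eta2 g2 (psi W2 i).
  by move=> /(proj2 WJ2); exact: testf_psi.
have tP1 : testf S1 x0 eta1 g1 P1 by exact: testf_sum.
have tP2 : testf S2 y0 eta2 g2 P2 by exact: testf_sum.
have tr1 : testf S1 x0 eta1 g1 (fun x => psi W1' j1 x + (-1) * P1 x) by exact: testf_lin.
have tr2 : testf S2 y0 eta2 g2 (fun x => psi W2' j2 x + (-1) * P2 x) by exact: testf_lin.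
have rE1 : (fun x => psi W1' j1 x - P1 x) = (fun x => psi W1' j1 x + (-1) * P1 x).
  by apply/funext => x; rewrite mulN1r.
have rE2 : (fun x => psi W2' j2 x - P2 x) = (fun x => psi W2' j2 x + (-1) * P2 x).
  by apply/funext => x; rewrite mulN1r.
rewrite rE1 in r1; rewrite rE2 in r2.
have bP1 : test_bound S1 x0 b1 g1 (c1 + `|-1| * ep) P1.
  have := test_bound_lin (-1) hc1 r1.
  congr test_bound; apply/funext => x; ring.
have F1 : F (fun x y => psi W1' j1 x * psi W2' j2 y) =
    F (fun x y => P1 x * P2 y) +
    F (fun x y => P1 x * (psi W2' j2 y + (-1) * P2 y)) +
    F (fun x y => (psi W1' j1 x + (-1) * P1 x) * psi W2' j2 y).
  by rewrite distr_lin1// distr_lin2//; ring.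
have -> : eps + \sum_(i1 <- J1) `|pairing S1 (psi W1' j1) (psi W1 i1)| *
    \sum_(i2 <- J2) `|pairing S2 (psi W2' j2) (psi W2 i2)| *
      `|F (fun x y => psi W1 i1 x * psi W2 i2 y)| =
   \sum_(i1 <- J1) `|pairing S1 (psi W1' j1) (psi W1 i1)| *
    \sum_(i2 <- J2) `|pairing S2 (psi W2' j2) (psi W2 i2)| *
      `|F (fun x y => psi W1 i1 x * psi W2 i2 y)| + eps by rewrite addrC.
rewrite F1 -addrA; apply: (le_trans (ler_normD _ _)); apply: lerD.
  rewrite [F _](distr_sum1 _ tp1 tP2); apply: (le_trans (ler_norm_sum _ _ _)).
  rewrite big_seq [leRHS]big_seq; apply: ler_sum => i1 i1J.
  rewrite normrM; apply: ler_wpM2l => //.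
  rewrite [F _](distr_sum2 _ tp2 (tp1 _ i1J)); apply: (le_trans (ler_norm_sum _ _ _)).
  by apply: ler_sum => i2 _; rewrite normrM.
apply: (le_trans (ler_normD _ _)).
have h1 := HC _ _ _ _ tP1 tr2 bP1 r2; have h2 := HC _ _ _ _ tr1 t2 r1 hc2.
apply: (le_trans (lerD h1 h2)); rewrite normrN1 mul1r.
apply: le_trans epC.
rewrite [leLHS](_ : _ = C * ((c1 + ep) + c2) * ep); last by ring.
by apply: ler_wpM2r; [exact: ltW|apply: ler_wpM2l; [exact: ltW|lra]].
Qed.

End Distributions.

End Tensors.

(** * Product square functions *)

Section ProductSquareFunction.
Context (R : realType) (d1 d2 : measure_display).
Context (X1 : measurableType d1) (X2 : measurableType d2).
Variables (S1 : sht R X1) (S2 : sht R X2).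

Definition sqf2 (D1 : reference_grid S1) (D2 : reference_grid S2)
    (L1 : seq (int * X1)) (L2 : seq (int * X2)) (s : int * X1 -> int * X2 -> R)
    (x : X1) (y : X2) : R :=
  \sum_(j1 <- L1) \sum_(j2 <- L2) s j1 j2 ^+ 2 *
    (\1_(wav_cube D1 j1) x * \1_(wav_cube D2 j2) y / (cubem D1 j1 * cubem D2 j2)).

(** For fixed [y] the product square function is a one-parameter one whose coefficients are l^2
    norms in the second variable. *)
Lemma sqf2E D1 D2 L1 L2 s x y : windices D2 L2 ->
  sqf2 D1 D2 L1 L2 s x y =
  sqf D1 L1 (fun j1 => Num.sqrt (sqf D2 L2 (s j1) y)) x.
Proof.
move=> WL2; rewrite /sqf2 [RHS]/sqf; apply: eq_bigr => j1 _.
rewrite sqr_sqrtr ?sqf_ge0// /sqf mulr_suml mulr_sumr; apply: eq_bigr => j2 _.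
by rewrite invfM; ring.
Qed.

Lemma sqf2_ge0 D1 D2 L1 L2 s x y : windices D1 L1 -> windices D2 L2 ->
  0 <= sqf2 D1 D2 L1 L2 s x y.
Proof. by move=> W1 W2; rewrite sqf2E// sqf_ge0. Qed.

Lemma measurable_sqf2 D1 D2 L1 L2 s : windices D1 L1 -> windices D2 L2 ->
  measurable_fun setT (fun z : X1 * X2 => sqf2 D1 D2 L1 L2 s z.1 z.2).
Proof.
move=> [_ W1] [_ W2]; rewrite /sqf2.
apply: measurable_sum_seq => j1 /W1 Wj1; apply: measurable_sum_seq => j2 /W2 Wj2.
apply: measurable_funM => //; apply: measurable_funM => //; apply: measurable_funM.
  by apply: (measurableT_comp _ measurable_fst); exact: measurable_cube_indic.
by apply: (measurableT_comp _ measurable_snd); exact: measurable_cube_indic.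
Qed.

Lemma measurable_sqf2_powR D1 D2 L1 L2 s q : windices D1 L1 -> windices D2 L2 ->
  measurable_fun setT (fun z : X1 * X2 => sqf2 D1 D2 L1 L2 s z.1 z.2 `^ q).
Proof.
move=> W1 W2; apply: (measurableT_comp (measurable_powR q)).
exact: measurable_sqf2.
Qed.

Lemma integral_sqf2_1 D1 D2 L1 L2 s q : windices D1 L1 -> windices D2 L2 ->
  (\int[mu S1 \x mu S2]_z (sqf2 D1 D2 L1 L2 s z.1 z.2 `^ q)%:E =
   \int[mu S1]_x \int[mu S2]_y (sqf2 D1 D2 L1 L2 s x y `^ q)%:E)%E.
Proof.
move=> W1 W2; rewrite fubini_tonelli1//.
  by apply/measurable_EFinP; exact: measurable_sqf2_powR.
by move=> z; rewrite lee_fin powR_ge0.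
Qed.

Lemma integral_sqf2_2 D1 D2 L1 L2 s q : windices D1 L1 -> windices D2 L2 ->
  (\int[mu S1 \x mu S2]_z (sqf2 D1 D2 L1 L2 s z.1 z.2 `^ q)%:E =
   \int[mu S2]_y \int[mu S1]_x (sqf2 D1 D2 L1 L2 s x y `^ q)%:E)%E.
Proof.
move=> W1 W2; rewrite fubini_tonelli2//.
  by apply/measurable_EFinP; exact: measurable_sqf2_powR.
by move=> z; rewrite lee_fin powR_ge0.
Qed.

Lemma measurable_sqf2_int1 D1 D2 L1 L2 s q : windices D1 L1 -> windices D2 L2 ->
  measurable_fun setT
    (fun y => \int[mu S1]_x (sqf2 D1 D2 L1 L2 s x y `^ q)%:E)%E.
Proof.
move=> W1 W2; apply: (@measurable_fun_fubini_tonelli_G _ _ _ _ _ (mu S1)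
  (fun z : X1 * X2 => (sqf2 D1 D2 L1 L2 s z.1 z.2 `^ q)%:E)).
  by apply/measurable_EFinP; exact: measurable_sqf2_powR.
by move=> z; rewrite lee_fin powR_ge0.
Qed.

Lemma measurable_sqf2_x D1 D2 L1 L2 s q y : windices D1 L1 -> windices D2 L2 ->
  measurable_fun setT (fun x => sqf2 D1 D2 L1 L2 s x y `^ q).
Proof.
move=> W1 W2; under eq_fun do rewrite sqf2E//.
exact: measurable_sqf_powR.
Qed.

(* Minkowski's inequality in l^2 of the second variable moves a inside. *)
Lemma sq_bounded_first (D1 D1' : reference_grid S1) (D2 : reference_grid S2) p a :
  0 <= p -> (forall j i, 0 <= a j i) -> sq_bounded D1 D1' p a ->
  exists2 C, 0 < C & forall J1 L1 L2 s, windices D1 J1 -> windices D1' L1 ->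
    windices D2 L2 -> (forall i j, 0 <= s i j) ->
    (\int[mu S1 \x mu S2]_z
       (sqf2 D1' D2 L1 L2 (fun j1 j2 => apply_mx a J1 (s^~ j2) j1) z.1 z.2 `^ (p / 2))%:E <=
     C%:E * \int[mu S1 \x mu S2]_z (sqf2 D1 D2 J1 L2 s z.1 z.2 `^ (p / 2))%:E)%E.
Proof.
move=> p0 a0 [C C0 HC]; exists C => // J1 L1 L2 s WJ1 WL1 WL2 s0.
rewrite !integral_sqf2_2//.
rewrite -ge0_integralZl//; last first.
- by rewrite lee_fin ltW.
- by move=> y _; apply: integral_ge0 => x _; rewrite lee_fin powR_ge0.
- exact: measurable_sqf2_int1.
apply: ge0_le_integral => //.
- by move=> y _; apply: integral_ge0 => x _; rewrite lee_fin powR_ge0.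
- exact: measurable_sqf2_int1.
- by apply: measurable_funeM; exact: measurable_sqf2_int1.
move=> y _.
pose v i1 := Num.sqrt (sqf D2 L2 (s i1) y).
have v0 i1 : 0 <= v i1 by exact: sqrtr_ge0.
apply: (@le_trans _ _ (\int[mu S1]_x (sqf D1' L1 (apply_mx a J1 v) x `^ (p / 2))%:E)%E).
  apply: le_integral_ge0.
  - exact: measurable_sqf2_x.
  - exact: measurable_sqf_powR.
  - by move=> x; exact: powR_ge0.
  - move=> x; apply: ge0_ler_powR; rewrite ?nnegrE ?sqf_ge0 ?sqf2_ge0//.
      by rewrite divr_ge0.
    rewrite sqf2E// /sqf big_seq [leRHS]big_seq; apply: ler_sum => j1 j1L.
    have m0 := cubem_gt0 (proj2 WL1 _ j1L).
    apply: ler_wpM2l; first by pos.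
    rewrite ler_pM2r ?invr_gt0//; apply: lerXn_le; first exact: sqrtr_ge0.
    rewrite /apply_mx.
    apply: (@le_trans _ _ (\sum_(i1 <- J1) Num.sqrt (sqf D2 L2 (fun j2 => a j1 i1 * s i1 j2) y))).
      apply: sqf_sqrt_le => //.
        by move=> j _; rewrite lexx andbT; apply: sumr_ge0 => i _; rewrite mulr_ge0.
      by move=> g j _ _; rewrite mulr_ge0.
    by apply: ler_sum => i1 _; rewrite sqrt_sqfZ.
apply: (le_trans (HC J1 L1 v WJ1 WL1 v0)).
by under [in leRHS]eq_integral => x _ do rewrite sqf2E//.
Qed.

End ProductSquareFunction.

Lemma sqf2_swap (R : realType) (d1 d2 : measure_display)
    (X1 : measurableType d1) (X2 : measurableType d2)
    (S1 : sht R X1) (S2 : sht R X2) (D1 : reference_grid S1) (D2 : reference_grid S2)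
    L1 L2 s x y :
  sqf2 D1 D2 L1 L2 s x y = sqf2 D2 D1 L2 L1 (fun j i => s i j) y x.
Proof.
rewrite /sqf2 exchange_big/=; apply: eq_bigr => j2 _; apply: eq_bigr => j1 _.
by rewrite [\1__ y * _]mulrC [cubem D2 _ * _]mulrC.
Qed.

(** Exchanging the two factors makes the bound in the first variable serve for the second. *)
Lemma integral_sqf2_swap (R : realType) (d1 d2 : measure_display)
    (X1 : measurableType d1) (X2 : measurableType d2)
    (S1 : sht R X1) (S2 : sht R X2) (D1 : reference_grid S1) (D2 : reference_grid S2)
    L1 L2 s q : windices D1 L1 -> windices D2 L2 ->
  (\int[mu S1 \x mu S2]_z (sqf2 D1 D2 L1 L2 s z.1 z.2 `^ q)%:E =
   \int[mu S2 \x mu S1]_z (sqf2 D2 D1 L2 L1 (fun j i => s i j) z.1 z.2 `^ q)%:E)%E.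
Proof.
move=> W1 W2; rewrite (integral_sqf2_1 s q W1 W2).
rewrite (integral_sqf2_2 (fun j i => s i j) q W2 W1).
by apply: eq_integral => x _; apply: eq_integral => y _; rewrite sqf2_swap.
Qed.

Lemma sq_bounded_product (R : realType) (d1 d2 : measure_display)
    (X1 : measurableType d1) (X2 : measurableType d2)
    (S1 : sht R X1) (S2 : sht R X2) (D1 D1' : reference_grid S1)
    (D2 D2' : reference_grid S2) p a1 a2 :
  0 <= p -> (forall j i, 0 <= a1 j i) -> (forall j i, 0 <= a2 j i) ->
  sq_bounded D1 D1' p a1 -> sq_bounded D2 D2' p a2 ->
  exists2 C, 0 < C & forall J1 J2 L1 L2 s, windices D1 J1 -> windices D2 J2 ->
    windices D1' L1 -> windices D2' L2 -> (forall i j, 0 <= s i j) ->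
    (\int[mu S1 \x mu S2]_z
       (sqf2 D1' D2' L1 L2 (fun j1 j2 =>
          apply_mx a1 J1 (fun i1 => apply_mx a2 J2 (s i1) j2) j1) z.1 z.2 `^ (p / 2))%:E <=
     C%:E * \int[mu S1 \x mu S2]_z (sqf2 D1 D2 J1 J2 s z.1 z.2 `^ (p / 2))%:E)%E.
Proof.
move=> p0 a10 a20 sb1 sb2.
have [C1 C10 H1] := sq_bounded_first D2' p0 a10 sb1.
have [C2 C20 H2] := sq_bounded_first D1 p0 a20 sb2.
exists (C1 * C2); first by pos.
move=> J1 J2 L1 L2 s WJ1 WJ2 WL1 WL2 s0.
apply: (le_trans (H1 J1 L1 L2 (fun i1 j2 => apply_mx a2 J2 (s i1) j2) WJ1 WL1 WL2 _)).
  by move=> i j; apply: sumr_ge0 => k _; rewrite mulr_ge0.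
rewrite EFinM -muleA; apply: lee_wpmul2l; first by rewrite lee_fin ltW.
rewrite (integral_sqf2_swap (fun i1 j2 => apply_mx a2 J2 (s i1) j2) (p / 2) WJ1 WL2).
rewrite (integral_sqf2_swap s (p / 2) WJ1 WJ2).
exact: (H2 J2 L2 J1 (fun i2 i1 => s i1 i2)).
Qed.

(** * Infinite sums as suprema over finite rectangles of indices *)

Section Exhaustion.

Lemma countable_exhaustion (T : choiceType) (K : set T) : countable K ->
  exists L : nat -> seq T, [/\ forall n, uniq (L n), forall n i, i \in L n -> K i,
    forall m n, (m <= n)%N -> {subset L m <= L n}
    & forall i, K i -> exists n, i \in L n].
Proof.
move=> /pfcard_geP[->|[f]].
  by exists (fun=> [::]); split => // i [].
exists (fun n => undup [seq f i | i <- iota 0 n]); split.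
- by move=> n; exact: undup_uniq.
- by move=> n i; rewrite mem_undup => /mapP[k _ ->]; exact: funS.
- move=> m n mn i; rewrite !mem_undup => /mapP[k km ->]; apply: map_f.
  by move: km; rewrite !mem_iota/= !add0n => /leq_trans; apply.
- move=> i /(@surj _ _ _ _ f)[k _ <-]; exists k.+1.
  by rewrite mem_undup; apply: map_f; rewrite mem_iota/= add0n.
Qed.

Variables (R : realType) (T1 T2 : choiceType) (K1 : set T1) (K2 : set T2).

Lemma sum_le_esum2 (a : T1 * T2 -> R) (L1 : seq T1) (L2 : seq T2) :
  uniq L1 -> uniq L2 -> (forall i, i \in L1 -> K1 i) -> (forall i, i \in L2 -> K2 i) ->
  ((\sum_(i1 <- L1) \sum_(i2 <- L2) a (i1, i2))%:E <=
   \esum_(i in K1 `*` K2) (a i)%:E)%E.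
Proof.
move=> u1 u2 k1 k2; apply: esum_ge.
pose L := [seq (i1, i2) | i1 <- L1, i2 <- L2].
have uL : uniq L by apply: allpairs_uniq => // -[? ?] [? ?] _ _.
exists [set` L].
  split; first exact: finite_seq.
  by move=> _ /allpairsP[[i1 i2] [/= /k1 ? /k2 ? ->]].
rewrite -fsbig_seq// sumEFin lee_fin.
by rewrite [in leRHS]/L big_allpairs.
Qed.

(** Any finite set of pairs lies in a rectangle of the exhaustion, and rectangles are the families
    on which the product estimates are stated. *)
Lemma esum2_sup (a : T1 * T2 -> R) (L1 : nat -> seq T1) (L2 : nat -> seq T2) :
  (forall i, 0 <= a i) -> 
  (forall n, uniq (L1 n)) -> (forall n, uniq (L2 n)) ->
  (forall n i, i \in L1 n -> K1 i) -> (forall n i, i \in L2 n -> K2 i) ->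
  (forall m n, (m <= n)%N -> {subset L1 m <= L1 n}) ->
  (forall m n, (m <= n)%N -> {subset L2 m <= L2 n}) ->
  (forall i, K1 i -> exists n, i \in L1 n) -> (forall i, K2 i -> exists n, i \in L2 n) ->
  \esum_(i in K1 `*` K2) (a i)%:E =
  ereal_sup (range (fun n => (\sum_(i1 <- L1 n) \sum_(i2 <- L2 n) a (i1, i2))%:E)).
Proof.
move=> a0 u1 u2 k1 k2 m1 m2 e1 e2; apply/le_anti/andP; split; last first.
  apply: ge_ereal_sup => _ [n _ <-]; apply: sum_le_esum2 => //; [exact: k1|exact: k2].
apply: ge_ereal_sup => _ [A [finA AK] <-].
have [n An] : exists n, forall i, i \in (finmap.enum_fset (fset_set A)) ->
    (i.1 \in L1 n) && (i.2 \in L2 n).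
  have : forall i, i \in (finmap.enum_fset (fset_set A)) -> A i.
    by move=> i; rewrite in_fset_set// inE.
  elim: (finmap.enum_fset (fset_set A)) => [|i s IH] H; first by exists 0%N.
  have [j js|n Hn] := IH; first by apply: H; rewrite in_cons js orbT.
  have [Ki1 Ki2] := AK _ (H i (mem_head _ _)).
  have [n1 h1] := e1 _ Ki1; have [n2 h2] := e2 _ Ki2.
  exists (maxn n (maxn n1 n2)) => j; rewrite in_cons => /predU1P[->|/Hn/andP[q1 q2]].
    apply/andP; split; [apply: m1 h1|apply: m2 h2].
      by rewrite leq_max leq_maxl orbT.
    by rewrite leq_max leq_maxr orbT.
  by apply/andP; split; [apply: m1 q1|apply: m2 q2]; rewrite leq_maxl.
rewrite fsbig_finite//= sumEFin.
apply: (@le_trans _ _ ((\sum_(i1 <- L1 n) \sum_(i2 <- L2 n) a (i1, i2))%:E)); last first.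
  by apply: ereal_sup_ubound; exists n.
rewrite lee_fin -[leRHS]big_allpairs.
apply: sum_uniq_sub_le.
- exact: finmap.fset_uniq.
- by apply: allpairs_uniq => // -[? ?] [? ?] _ _.
- move=> [i1 i2] /An/= /andP[q1 q2]; apply/allpairsP; exists (i1, i2); split => //.
- by [].
Qed.

End Exhaustion.

Lemma ereal_sup_poweR (R : realType) (u : nat -> \bar R) (q : R) : 0 < q ->
  (forall n, (0 <= u n)%E) ->
  (ereal_sup (range u) `^ q = ereal_sup (range (fun n => u n `^ q)))%E.
Proof.
move=> q0 u0.
have mono r (x y : \bar R) : 0 <= r -> (0 <= x)%E -> (x <= y)%E -> (x `^ r <= y `^ r)%E.
  move=> r0 x0 xy; apply: gt0_ler_poweR => //; rewrite in_itv/= leey andbT//.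
  exact: le_trans xy.
apply/le_anti/andP; split; last first.
  apply: ge_ereal_sup => _ [n _ <-]; apply: mono => //; first exact: ltW.
  by apply: ereal_sup_ubound; exists n.
pose M := ereal_sup (range (fun n => u n `^ q)%E); rewrite -/M.
have uM n : (u n `^ q <= M)%E by apply: ereal_sup_ubound; exists n.
have M0 : (0 <= M)%E by apply: le_trans (uM 0%N); exact: poweR_ge0.
have -> : M = ((M `^ q^-1) `^ q)%E by rewrite -poweRrM mulVf ?gt_eqF// poweRe1.
apply: (mono); first exact: ltW.
  by apply: (le_trans (u0 0%N)); apply: ereal_sup_ubound; exists 0%N.
apply: ge_ereal_sup => _ [n _ <-].
have -> : u n = ((u n `^ q) `^ q^-1)%E by rewrite -poweRrM mulfV ?gt_eqF// poweRe1.
by apply: (mono) => //; [rewrite invr_ge0 ltW|exact: poweR_ge0].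
Qed.

Lemma countable_wav_index (R : realType) (d : measure_display) (X : measurableType d)
    (S : sht R X) (D : reference_grid S) : countable (wav_index D).
Proof.
apply: (@sub_countable _ _ _ (\bigcup_(k in [set: int]) (pair k @` pts D (k + 1)))).
  apply: subset_card_le => -[k x] /= [h _]; exists k => //; by exists x.
apply: bigcup_countable; first exact: countableP.
move=> k _; apply: sub_countable (pts_countable D (k + 1)); exact: card_image_le.
Qed.

(** * The full product square function *)

Section Assembly.
Context (R : realType) (d1 d2 : measure_display).
Context (X1 : measurableType d1) (X2 : measurableType d2).
Variables (S1 : sht R X1) (S2 : sht R X2).
Variables (eta1 eta2 : R).

Definition wcoef (D1 : reference_grid S1) (D2 : reference_grid S2)
    (W1 : ah_wavelets eta1 D1) (W2 : ah_wavelets eta2 D2)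
    (F : (X1 -> X2 -> R) -> R) (i1 : int * X1) (i2 : int * X2) : R :=
  `|F (fun x y => psi W1 i1 x * psi W2 i2 y)|.

Section SquareFunction.
Variables (D1 : reference_grid S1) (D2 : reference_grid S2).
Variables (W1 : ah_wavelets eta1 D1) (W2 : ah_wavelets eta2 D2).
Variable F : (X1 -> X2 -> R) -> R.

Local Notation s := (wcoef W1 W2 F).

(** The square of the square function, written with absolute values of the coefficients; as for
    [sqf], the root goes into the exponent. *)
Definition wenergy (z : X1 * X2) : \bar R :=
  \esum_(i in wav_index D1 `*` wav_index D2)
    (s i.1 i.2 ^+ 2 * (\1_(wav_cube D1 i.1) z.1 * \1_(wav_cube D2 i.2) z.2 /
       (cubem D1 i.1 * cubem D2 i.2)))%:E.

Lemma square_functionE z : square_function W1 W2 F z = (wenergy z `^ 2^-1)%E.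
Proof. by []. Qed.

Lemma wenergy_ge L1 L2 z : windices D1 L1 -> windices D2 L2 ->
  ((sqf2 D1 D2 L1 L2 s z.1 z.2)%:E <= wenergy z)%E.
Proof.
move=> [u1 w1] [u2 w2].
exact: (@sum_le_esum2 R _ _ _ _ (fun i => s i.1 i.2 ^+ 2 *
  (\1_(wav_cube D1 i.1) z.1 * \1_(wav_cube D2 i.2) z.2 /
       (cubem D1 i.1 * cubem D2 i.2)))).
Qed.

Lemma wenergy_exhaustion : exists (L1 : nat -> seq (int * X1)) (L2 : nat -> seq (int * X2)),
  [/\ forall n, windices D1 (L1 n), forall n, windices D2 (L2 n),
    forall z, nondecreasing_seq (fun n => sqf2 D1 D2 (L1 n) (L2 n) s z.1 z.2)
  & forall z, wenergy z = ereal_sup (range (fun n => (sqf2 D1 D2 (L1 n) (L2 n) s z.1 z.2)%:E))].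
Proof.
have [L1 [u1 k1 m1 e1]] := countable_exhaustion (countable_wav_index D1).
have [L2 [u2 k2 m2 e2]] := countable_exhaustion (countable_wav_index D2).
have ind0 (i : int * X1) (j : int * X2) z : wav_index D1 i -> wav_index D2 j ->
    0 <= s i j ^+ 2 * (\1_(wav_cube D1 i) z.1 * \1_(wav_cube D2 j) z.2 /
       (cubem D1 i * cubem D2 j)).
  by move=> /cubem_gt0 c1 /cubem_gt0 c2; pos.
(* Nonnegativity of the terms is known at wavelet indices, while [esum2_sup] asks for it at every
   pair; absolute values reconcile the two. *)
have abs (i : int * X1) (j : int * X2) z : wav_index D1 i -> wav_index D2 j ->
    s i j ^+ 2 * (\1_(wav_cube D1 i) z.1 * \1_(wav_cube D2 j) z.2 /
       (cubem D1 i * cubem D2 j)) =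
    `|s i j ^+ 2 * (\1_(wav_cube D1 i) z.1 * \1_(wav_cube D2 j) z.2 /
       (cubem D1 i * cubem D2 j))|.
  by move=> wi wj; rewrite ger0_norm// ind0.
have sE n z : sqf2 D1 D2 (L1 n) (L2 n) s z.1 z.2 =
    \sum_(i <- L1 n) \sum_(j <- L2 n) `|s i j ^+ 2 *
      (\1_(wav_cube D1 i) z.1 * \1_(wav_cube D2 j) z.2 / (cubem D1 i * cubem D2 j))|.
  rewrite /sqf2; apply: eq_big_seq => i /k1 wi; apply: eq_big_seq => j /k2 wj.
  exact: abs.
exists L1, L2; split.
- by move=> n; split; [exact: u1|exact: k1].
- by move=> n; split; [exact: u2|exact: k2].
- move=> z m n mn; rewrite !sE.
  apply: (@le_trans _ _ (\sum_(i <- L1 m) \sum_(j <- L2 n) `|s i j ^+ 2 *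
      (\1_(wav_cube D1 i) z.1 * \1_(wav_cube D2 j) z.2 / (cubem D1 i * cubem D2 j))|)).
    by apply: ler_sum => i _; apply: sum_uniq_sub_le => //; exact: m2.
  apply: sum_uniq_sub_le => //; first exact: m1.
  by move=> i; apply: sumr_ge0.
- move=> z; rewrite /wenergy.
  rewrite (eq_esum (b := fun i => `|s i.1 i.2 ^+ 2 *
      (\1_(wav_cube D1 i.1) z.1 * \1_(wav_cube D2 i.2) z.2 /
        (cubem D1 i.1 * cubem D2 i.2))|%:E)); last first.
    by move=> [i j] [/= wi wj]; rewrite -abs.
  rewrite (@esum2_sup _ _ _ _ _ _ L1 L2)//.
  have -> // : (fun n => (sqf2 D1 D2 (L1 n) (L2 n) s z.1 z.2)%:E) =
    (fun n => (\sum_(i <- L1 n) \sum_(j <- L2 n) `|s i j ^+ 2 *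
      (\1_(wav_cube D1 i) z.1 * \1_(wav_cube D2 j) z.2 / (cubem D1 i * cubem D2 j))|)%:E).
  by apply/funext => n; rewrite sE.
Qed.

Lemma measurable_wenergy : measurable_fun setT wenergy.
Proof.
have [L1 [L2 [w1 w2 nd E]]] := wenergy_exhaustion.
apply: (@emeasurable_fun_cvg _ _ _ _ (fun n z => (sqf2 D1 D2 (L1 n) (L2 n) s z.1 z.2)%:E)).
  by move=> n; apply/measurable_EFinP; exact: measurable_sqf2.
move=> z _; rewrite E; apply: ereal_nondecreasing_cvgn => m n mn.
by rewrite lee_fin; exact: nd.
Qed.

Lemma wenergy_ge0 z : (0 <= wenergy z)%E.
Proof.
have h : windices D1 [::] by [].
have h' : windices D2 [::] by [].
by apply: le_trans (wenergy_ge z h h'); rewrite lee_fin sqf2_ge0.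
Qed.

Lemma measurable_square_function : measurable_fun setT (square_function W1 W2 F).
Proof.
apply: (measurableT_comp (measurable_poweR 2^-1)); exact: measurable_wenergy.
Qed.

Definition wintegral (p : R) : \bar R :=
  (\int[mu S1 \x mu S2]_z (wenergy z `^ (p / 2)))%E.

Lemma wintegral_ge0 p : (0 <= wintegral p)%E.
Proof. by apply: integral_ge0 => z _; exact: poweR_ge0. Qed.

Lemma Hp_normE p : Hp_norm p W1 W2 F = (wintegral p `^ p^-1)%E.
Proof.
rewrite /Hp_norm unlock; congr (_ `^ _)%E; apply: eq_integral => z _.
by rewrite gee0_abs ?poweR_ge0// square_functionE -poweRrM mulrC.
Qed.

Lemma wintegral_ge p L1 L2 : 0 < p -> windices D1 L1 -> windices D2 L2 ->
  (\int[mu S1 \x mu S2]_z (sqf2 D1 D2 L1 L2 s z.1 z.2 `^ (p / 2))%:E <= wintegral p)%E.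
Proof.
move=> p0 w1 w2; apply: ge0_le_integral => //.
- by move=> z _; rewrite lee_fin powR_ge0.
- by apply/measurable_EFinP; exact: measurable_sqf2_powR.
- by apply: (measurableT_comp (measurable_poweR _)); exact: measurable_wenergy.
- move=> z _; rewrite -poweR_EFin; apply: gt0_ler_poweR; first by rewrite divr_ge0// ltW.
  + by rewrite in_itv/= leey lee_fin sqf2_ge0.
  + by rewrite in_itv/= leey wenergy_ge0.
  + exact: wenergy_ge.
Qed.

(** Monotone convergence along the exhaustion: bounds for finite rectangles, uniform in them, pass
    to the full square function. *)
Lemma wintegral_le p M : 0 < p ->
  (forall L1 L2, windices D1 L1 -> windices D2 L2 ->
    (\int[mu S1 \x mu S2]_z (sqf2 D1 D2 L1 L2 s z.1 z.2 `^ (p / 2))%:E <= M)%E) ->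
  (wintegral p <= M)%E.
Proof.
move=> p0 HM; have [L1 [L2 [w1 w2 nd E]]] := wenergy_exhaustion.
have q0 : 0 < p / 2 by rewrite divr_gt0.
pose h n z := (sqf2 D1 D2 (L1 n) (L2 n) s z.1 z.2 `^ (p / 2))%:E.
have ndh z : nondecreasing_seq (h^~ z).
  move=> m n mn; rewrite lee_fin; apply: ge0_ler_powR; rewrite ?nnegrE ?sqf2_ge0//.
    exact: ltW.
  exact: nd.
have -> : wintegral p = (\int[mu S1 \x mu S2]_z (limn (h^~ z)))%E.
  apply: eq_integral => z _; rewrite E ereal_sup_poweR//; last first.
    by move=> n; rewrite lee_fin sqf2_ge0.
  apply/esym/cvg_lim => //; exact: ereal_nondecreasing_cvgn.
rewrite monotone_convergence//; last 2 first.
- by move=> n; apply/measurable_EFinP; exact: measurable_sqf2_powR.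
- by move=> n z _; rewrite lee_fin powR_ge0.
apply: lime_le.
  apply: ereal_nondecreasing_is_cvgn => m n mn; apply: ge0_le_integral => //.
  - by move=> z _; rewrite lee_fin powR_ge0.
  - by apply/measurable_EFinP; exact: measurable_sqf2_powR.
  - by apply/measurable_EFinP; exact: measurable_sqf2_powR.
  - by move=> z _; exact: ndh.
by apply: nearW => n; exact: HM.
Qed.

End SquareFunction.

(** * Coefficients of one distribution in two wavelet families *)

Section Comparison.
Variables (x0 : X1) (y0 : X2) (b1 b2 g1 g2 : R).
Hypotheses (eta1_01 : 0 < eta1 < 1) (eta2_01 : 0 < eta2 < 1).
Hypotheses (hb1 : 0 < b1 < eta1) (hb2 : 0 < b2 < eta2).
Hypotheses (hg1 : 0 < g1 < eta1) (hg2 : 0 < g2 < eta2).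
Variables (D1 D1' : reference_grid S1) (D2 D2' : reference_grid S2).
Variables (W1 : ah_wavelets eta1 D1) (W1' : ah_wavelets eta1 D1').
Variables (W2 : ah_wavelets eta2 D2) (W2' : ah_wavelets eta2 D2').

Local Notation a1 := (fun j i => `|pairing S1 (psi W1' j) (psi W1 i)|).
Local Notation a2 := (fun j i => `|pairing S2 (psi W2' j) (psi W2 i)|).

Definition transfer (s : int * X1 -> int * X2 -> R) (J1 : seq (int * X1))
    (J2 : seq (int * X2)) (j1 : int * X1) (j2 : int * X2) : R :=
  apply_mx a1 J1 (fun i1 => apply_mx a2 J2 (s i1) j2) j1.

Lemma transfer_ge0 s J1 J2 j1 j2 : (forall i1 i2, 0 <= s i1 i2) ->
  0 <= transfer s J1 J2 j1 j2.
Proof.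
move=> s0; apply: sumr_ge0 => i1 _; apply: mulr_ge0 => //.
by apply: sumr_ge0 => i2 _; apply: mulr_ge0.
Qed.

Lemma transfer_mono s J1 J2 J1' J2' j1 j2 : (forall i1 i2, 0 <= s i1 i2) ->
  uniq J1 -> uniq J1' -> uniq J2 -> uniq J2' -> {subset J1 <= J1'} -> {subset J2 <= J2'} ->
  transfer s J1 J2 j1 j2 <= transfer s J1' J2' j1 j2.
Proof.
move=> s0 u1 u1' u2 u2' h1 h2; rewrite /transfer /apply_mx.
apply: (@le_trans _ _ (\sum_(i1 <- J1) a1 j1 i1 * \sum_(i2 <- J2') a2 j2 i2 * s i1 i2)).
  apply: ler_sum => i1 _; apply: ler_wpM2l => //.
  by apply: sum_uniq_sub_le => // i2; apply: mulr_ge0.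
apply: sum_uniq_sub_le => // i1; apply: mulr_ge0 => //.
by apply: sumr_ge0 => i2 _; apply: mulr_ge0.
Qed.

Variable F : (X1 -> X2 -> R) -> R.
Hypothesis HF : distributions S1 S2 x0 y0 eta1 eta2 b1 b2 g1 g2 F.

(** The error in [coefficient_expansion] is chosen as half of the coefficient and absorbed, which
    gives the factor 2; a zero coefficient is bounded trivially. *)
Lemma wcoef_transfer1 j1 j2 : wav_index D1' j1 -> wav_index D2' j2 ->
  exists J1 J2, [/\ windices D1 J1, windices D2 J2 &
    wcoef W1' W2' F j1 j2 <= 2 * transfer (wcoef W1 W2 F) J1 J2 j1 j2].
Proof.
move: eta1_01 eta2_01 hg1 hg2 => /andP[_ e1] /andP[_ e2] hg1' hg2' w1 w2.
have h1 : 0 <= g1 < eta1 by lra.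
have h2 : 0 <= g2 < eta2 by lra.
have [f0|f0] := eqVneq (wcoef W1' W2' F j1 j2) 0.
  exists [::], [::]; split => //; rewrite f0; apply: mulr_ge0 => //.
  by apply: transfer_ge0 => i1 i2; exact: normr_ge0.
have fp : 0 < wcoef W1' W2' F j1 j2 / 2 by rewrite divr_gt0// lt0r f0 normr_ge0.
have [J1 [J2 [wJ1 wJ2 h]]] := coefficient_expansion hb1 hb2 HF e1 e2 h1 h2 W1 W1' W2 W2' w1 w2 fp.
exists J1, J2; split => //.
have {}h : wcoef W1' W2' F j1 j2 <= wcoef W1' W2' F j1 j2 / 2 +
  transfer (wcoef W1 W2 F) J1 J2 j1 j2 by exact: h.
by move: h; set u := wcoef _ _ _ _ _; set v := transfer _ _ _ _ _; lra.
Qed.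

(** The product bound takes one pair of input families for the whole of [L]; since [transfer] grows
    with the index sets, finitely many coefficients can share them. *)
Lemma wcoef_transfer (L : seq ((int * X1) * (int * X2))) :
  (forall j, j \in L -> wav_index D1' j.1 /\ wav_index D2' j.2) ->
  exists J1 J2, [/\ windices D1 J1, windices D2 J2 & forall j, j \in L ->
    wcoef W1' W2' F j.1 j.2 <= 2 * transfer (wcoef W1 W2 F) J1 J2 j.1 j.2].
Proof.
elim: L => [|j L IH] H; first by exists [::], [::].
have [k kL|J1 [J2 [w1 w2 h]]] := IH; first by apply: H; rewrite in_cons kL orbT.
have [/= wj1 wj2] := H j (mem_head _ _).
have [I1 [I2 [v1 v2 h']]] := wcoef_transfer1 wj1 wj2.
have s0 i1 i2 : 0 <= wcoef W1 W2 F i1 i2 by exact: normr_ge0.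
exists (undup (J1 ++ I1)), (undup (J2 ++ I2)); split.
- split; first exact: undup_uniq.
  by move=> i; rewrite mem_undup mem_cat => /orP[/(proj2 w1)|/(proj2 v1)].
- split; first exact: undup_uniq.
  by move=> i; rewrite mem_undup mem_cat => /orP[/(proj2 w2)|/(proj2 v2)].
- move=> k; rewrite in_cons => /predU1P[->|kL].
    apply: (le_trans h'); rewrite ler_pM2l//; apply: transfer_mono => //.
    + exact: (proj1 v1).
    + exact: undup_uniq.
    + exact: (proj1 v2).
    + exact: undup_uniq.
    + by move=> i iI; rewrite mem_undup mem_cat iI orbT.
    + by move=> i iI; rewrite mem_undup mem_cat iI orbT.
  apply: (le_trans (h k kL)); rewrite ler_pM2l//; apply: transfer_mono => //.
  + exact: (proj1 w1).
  + exact: undup_uniq.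
  + exact: (proj1 w2).
  + exact: undup_uniq.
  + by move=> i iI; rewrite mem_undup mem_cat iI.
  + by move=> i iI; rewrite mem_undup mem_cat iI.
Qed.

End Comparison.

End Assembly.

(** * Comparison of the two Hardy norms *)

Section Independence.
Context (R : realType) (d1 d2 : measure_display).
Context (X1 : measurableType d1) (X2 : measurableType d2).
Variables (S1 : sht R X1) (S2 : sht R X2).

Lemma sq_bounded_pairing (d : measure_display) (X : measurableType d) (S : sht R X)
    (eta p : R) (D D' : reference_grid S) (W : ah_wavelets eta D) (W' : ah_wavelets eta D') :
  0 < eta <= 1 -> upper_dim S / (upper_dim S + eta) < p ->
  sq_bounded D D' p (fun j i => `|pairing S (psi W' j) (psi W i)|).
Proof.
move=> he hp; pose N := maxn (2 * dimN S + 2) (decayN S + dimN S).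
apply: (almost_diagonal_bounded (leq_maxl _ _) (leq_maxr _ _) he hp (eta := eta) (N := N)).
exact: almost_diagonal_pairing.
Qed.

(** The factor 4^(p/2) is the 2 of [wcoef_transfer], squared inside the square function and raised
    to the power p/2. The families J1 and J2 depend on L1 and L2, but their integrals are bounded by
    that of the full square function, with a constant independent of all four families. *)
Lemma Hp_norm_le (eta1 eta2 : R) (x0 : X1) (y0 : X2) (b1 b2 g1 g2 p : R)
    (D1 D1' : reference_grid S1) (D2 D2' : reference_grid S2)
    (W1 : ah_wavelets eta1 D1) (W1' : ah_wavelets eta1 D1')
    (W2 : ah_wavelets eta2 D2) (W2' : ah_wavelets eta2 D2') :
  0 < eta1 < 1 -> 0 < eta2 < 1 -> 0 < b1 < eta1 -> 0 < b2 < eta2 ->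
  0 < g1 < eta1 -> 0 < g2 < eta2 -> 0 < p ->
  upper_dim S1 / (upper_dim S1 + eta1) < p -> upper_dim S2 / (upper_dim S2 + eta2) < p ->
  exists2 C, 0 < C & forall F, distributions S1 S2 x0 y0 eta1 eta2 b1 b2 g1 g2 F ->
    (Hp_norm p W1' W2' F <= C%:E * Hp_norm p W1 W2 F)%E.
Proof.
move=> he1 he2 hb1 hb2 hg1 hg2 p0 hp1 hp2.
have he1' : 0 < eta1 <= 1 by lra.
have he2' : 0 < eta2 <= 1 by lra.
have s1 := sq_bounded_pairing W1 W1' he1' hp1.
have s2 := sq_bounded_pairing W2 W2' he2' hp2.
have [C C0 HC] := sq_bounded_product (ltW p0) (fun j i => normr_ge0 _)
   (fun j i => normr_ge0 _) s1 s2.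
pose C' := 4 `^ (p / 2) * C.
have C'0 : 0 < C' by rewrite /C'; pos.
exists (C' `^ p^-1); first by pos.
move=> F HF; rewrite !Hp_normE -poweR_EFin -poweRM; last 2 first.
- by rewrite lee_fin ltW.
- exact: wintegral_ge0.
have ip : 0 <= p^-1 by rewrite invr_ge0 ltW.
apply: gt0_ler_poweR => //.
- by rewrite in_itv/= leey wintegral_ge0.
- by rewrite in_itv/= leey andbT mule_ge0 ?wintegral_ge0// lee_fin ltW.
apply: wintegral_le => // L1 L2 WL1 WL2.
pose L := [seq (j1, j2) | j1 <- L1, j2 <- L2].
have WL j : j \in L -> wav_index D1' j.1 /\ wav_index D2' j.2.
  by move=> /allpairsP[[j1 j2] [/= /(proj2 WL1) ? /(proj2 WL2) ? ->]].
have [J1 [J2 [WJ1 WJ2 HJ]]] := wcoef_transfer he1 he2 hb1 hb2 hg1 hg2 W1 W1' W2 W2' HF WL.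
have q0 : 0 <= p / 2 by rewrite divr_ge0// ltW.
have sc0 i1 i2 : 0 <= wcoef W1 W2 F i1 i2 by exact: normr_ge0.
pose t := transfer W1 W1' W2 W2' (wcoef W1 W2 F) J1 J2.
apply: (@le_trans _ _ ((4 `^ (p / 2))%:E *
   \int[mu S1 \x mu S2]_z (sqf2 D1' D2' L1 L2 t z.1 z.2 `^ (p / 2))%:E)%E).
  rewrite -integralZr_ge0; last 3 first.
  - exact: powR_ge0.
  - exact: measurable_sqf2_powR.
  - by move=> z; exact: powR_ge0.
  apply: le_integral_ge0.
  - exact: measurable_sqf2_powR.
  - by apply: measurable_funM => //; exact: measurable_sqf2_powR.
  - by move=> z; exact: powR_ge0.
  - move=> z; rewrite -powRM ?sqf2_ge0//.
    apply: ge0_ler_powR; [exact: q0|by rewrite nnegrE sqf2_ge0| |].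
      by rewrite nnegrE mulr_ge0// sqf2_ge0.
    rewrite /sqf2 mulr_sumr big_seq [leRHS]big_seq; apply: ler_sum => j1 j1L.
    rewrite mulr_sumr big_seq [leRHS]big_seq; apply: ler_sum => j2 j2L.
    rewrite mulrA; apply: ler_wpM2r.
      have m1 := cubem_gt0 (proj2 WL1 _ j1L); have m2 := cubem_gt0 (proj2 WL2 _ j2L).
      by pos.
    have jL : (j1, j2) \in L by apply/allpairsP; exists (j1, j2).
    have := lerXn_le 2 (normr_ge0 _) (HJ _ jL).
    by move=> /le_trans; apply; apply: eqle; rewrite /t/=; ring.
rewrite /C' EFinM -muleA; apply: lee_wpmul2l; first by rewrite lee_fin powR_ge0.
apply: (le_trans (HC J1 J2 L1 L2 _ WJ1 WJ2 WL1 WL2 sc0)).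
by apply: lee_wpmul2l; [rewrite lee_fin ltW|exact: wintegral_ge].
Qed.

End Independence.

Theorem corollaryB (R : realType) (d1 d2 : measure_display)
  (X1 : measurableType d1) (X2 : measurableType d2)
  (S1 : sht R X1) (S2 : sht R X2)
  (infinite_mu1 : mu S1 setT = +oo%E) (infinite_mu2 : mu S2 setT = +oo%E)
  (eta1 eta2 : R) (eta1_01 : 0 < eta1 < 1) (eta2_01 : 0 < eta2 < 1)
  (* base point and parameters of the test function spaces *)
  (x0 : X1) (y0 : X2) (b1 b2 g1 g2 : R)
  (b1_eta : 0 < b1 < eta1) (b2_eta : 0 < b2 < eta2)
  (g1_eta : 0 < g1 < eta1) (g2_eta : 0 < g2 < eta2)
  (* first choice of reference grids and wavelets *)
  (D1 : reference_grid S1) (D2 : reference_grid S2)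
  (W1 : ah_wavelets eta1 D1) (W2 : ah_wavelets eta2 D2)
  (* second choice *)
  (D1' : reference_grid S1) (D2' : reference_grid S2)
  (W1' : ah_wavelets eta1 D1') (W2' : ah_wavelets eta2 D2')
  (p : R)
  (hp : Num.max (upper_dim S1 / (upper_dim S1 + eta1))
                (upper_dim S2 / (upper_dim S2 + eta2)) < p) :
  Hp x0 y0 b1 b2 g1 g2 p W1 W2 = Hp x0 y0 b1 b2 g1 g2 p W1' W2' /\
  (exists2 C : R, 0 < C &
     forall F, Hp x0 y0 b1 b2 g1 g2 p W1 W2 F ->
       (Hp_norm p W1' W2' F <= C%:E * Hp_norm p W1 W2 F)%E /\
       (Hp_norm p W1 W2 F <= C%:E * Hp_norm p W1' W2' F)%E).

Proof.
have hmax q r : Num.max q r < p -> q < p /\ r < p by rewrite gt_max => /andP.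
have [hp1 hp2] := hmax _ _ hp.
have dim_ge0 d (X : measurableType d) (S : sht R X) : 0 <= upper_dim S.
  by rewrite /upper_dim divr_ge0// ln_ge0//; [exact: Cmu_ge1|lra].
have p0 : 0 < p.
  apply: le_lt_trans hp1; have := dim_ge0 _ _ S1 => w0.
  by rewrite divr_ge0// addr_ge0//; lra.
have [C C0 HC] := Hp_norm_le x0 y0 W1 W1' W2 W2' eta1_01 eta2_01
  b1_eta b2_eta g1_eta g2_eta p0 hp1 hp2.
have [C' C'0 HC'] := Hp_norm_le x0 y0 W1' W1 W2' W2 eta1_01 eta2_01
  b1_eta b2_eta g1_eta g2_eta p0 hp1 hp2.
have fin (c : R) (u v : \bar R) : 0 < c -> (v <= c%:E * u)%E -> (u < +oo)%E -> (v < +oo)%E.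
  move=> c0 vu uy; apply: (le_lt_trans vu).
  by apply: lte_mul_pinfty => //; rewrite lee_fin ltW.
split.
  (* The two inclusions are the same estimate with the choices exchanged; measurability of the
     square function holds for every functional. *)
  apply/seteqP; split=> F [HF _ nF]; split => //; try exact: measurable_square_function.
  - exact: fin C0 (HC F HF) nF.
  - exact: fin C'0 (HC' F HF) nF.
exists (C + C'); first exact: addr_gt0.
have add (c c' : R) (D1a : reference_grid S1) (D2a : reference_grid S2)
    (Wa : ah_wavelets eta1 D1a) (Wb : ah_wavelets eta2 D2a) F : 0 < c' ->
    (c%:E * Hp_norm p Wa Wb F <= (c + c')%:E * Hp_norm p Wa Wb F)%E.
  move=> c'0; apply: lee_wpmul2r; last by rewrite lee_fin lerDl ltW.
  exact: Lnorm_ge0.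
move=> F [HF _ _]; split.
  by apply: (le_trans (HC F HF)); exact: add.
by apply: (le_trans (HC' F HF)); rewrite [C + C']addrC; exact: add.
Qed.
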